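(* Let $M$ be a $C^\infty$ real hypersurface in $\mathbb{C}^2$ and $p\in M$, and suppose $M$ admits a good coordinate at $p$. If $\Delta_1(M,p)=\infty$, then the following three conditions are equivalent: (i) there exists $\gamma\in\Gamma^{\rm reg}$ tangent to $M$ at $p$ to infinite order; (ii) there exists a good coordinate $(z,w)$ for $M$ at $p$ on which $F$ is flat at the origin; (iii) there exists a good coordinate $(z,w)$ for $M$ at $p$ such that the radius of convergence of the power series $\mathcal{S}(z)$ associated with this coordinate is positive.
   Context: A good coordinate for $M$ at $p$ is a holomorphic coordinate $(z,w)\in\mathbb{C}\times\mathbb{C}$ centered at $p$ in which $M$ has the local defining function $r=2\operatorname{Re}(w)+F(z,\bar z)$, where $F$ is a real-valued $C^\infty$ function near $0\in\mathbb{C}$ with $F(0)=0$ and $\nabla F(0)=0$. $F$ is flat at $0$ if all its Taylor coefficients at $0$ vanish. When $\Delta_1(M,p)=\infty$, the Taylor series of $F$ at $0$ on such a coordinate consists only of pure terms (monomials $z^j$ or $\bar z^j$), so it can be written as $2\sum_{j\ge2}\operatorname{Re}(c_jz^j)$ with uniquely determined $c_j\in\mathbb{C}$; define the formal power series $\mathcal{S}(z)=\sum_{j\ge2}c_jz^j$. $\operatorname{ord}(h)$ is order of vanishing at $0$. $\Gamma$ is the set of germs of nonconstant holomorphic maps $\gamma:(\mathbb{C},0)\to(\mathbb{C}^2,p)$ (good parametrization); $\Delta_1(M,p)=\sup_{\gamma\in\Gamma}\operatorname{ord}(r\circ\gamma)/\operatorname{ord}(\gamma-p)$ for a local defining function $r$;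 $\Gamma^{\rm reg}=\{\gamma\in\Gamma:\operatorname{ord}(\gamma-p)=1\}$. $\gamma$ is tangent to $M$ at $p$ to infinite order if $(r\circ\gamma)(t)=O(t^N)$ for all $N$. *)

(* Defs.v *)
(* MathComp + MathComp-Analysis, with the complex numbers
   C := (R[i])^o from mathcomp-real-closed over an arbitrary R : realType.
   C is a normedModType over itself (so [derivable f z 1] is complex
   differentiability), and real derivatives are taken along real lines
   t |-> z + t d, t : R. *)
From mathcomp Require Import all_boot all_order all_algebra.
From mathcomp Require Import all_classical all_reals all_analysis.
From mathcomp.real_closed Require Import complex.
Import Order.TTheory GRing.Theory Num.Theory numFieldNormedType.Exports.

Set Implicit Arguments.
Unset Strict Implicit.
Unset Printing Implicit Defensive.

Local Open Scope ring_scope.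
Local Open Scope classical_set_scope.

Notation CC R := ((R[i])^o).

Section Defs.
Variable R : realType.

Definition imC : CC R := Complex 0 1.
Definition reC (t : R) : CC R := Complex t 0.
Definition absC (z : CC R) : R :=
  Num.sqrt (complex.Re (z : R[i]) ^+ 2 + complex.Im (z : R[i]) ^+ 2).

Definition rD1 (F : CC R -> R) (d : CC R) : CC R -> R :=
  fun z => derive1 (fun t : R => F (z + reC t * d)) 0.
Definition iterD1 (F : CC R -> R) (ds : seq (CC R)) : CC R -> R :=
  foldr (fun d G => rD1 G d) F ds.

Definition pxy (F : CC R -> R) (a b : nat) : CC R -> R :=
  iterD1 F (nseq a 1 ++ nseq b imC).

Definition smooth1_on (U : set (CC R)) (F : CC R -> R) : Prop :=
  forall ds : seq (CC R),
    (forall z d, U z -> derivable (fun t : R => iterD1 F ds (z + reC t * d)) 0 1)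
    /\ {within U, continuous (iterD1 F ds)}.

Definition rD2 (f : CC R * CC R -> R) (d : CC R * CC R) : CC R * CC R -> R :=
  fun q => derive1 (fun t : R => f (q.1 + reC t * d.1, q.2 + reC t * d.2)) 0.
Definition iterD2 (f : CC R * CC R -> R) (ds : seq (CC R * CC R)) :=
  foldr (fun d G => rD2 G d) f ds.

Definition smooth2_on (U : set (CC R * CC R)) (f : CC R * CC R -> R) : Prop :=
  forall ds : seq (CC R * CC R),
    (forall q d, U q -> derivable
        (fun t : R => iterD2 f ds (q.1 + reC t * d.1, q.2 + reC t * d.2)) 0 1)
    /\ {within U, continuous (iterD2 f ds)}.

Definition local_defining_function (M : set (CC R * CC R)) (p : CC R * CC R)
    (r : CC R * CC R -> R) : Prop :=
  exists U : set (CC R * CC R),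
    [/\ open U, U p, smooth2_on U r,
        (forall q, U q -> (M q <-> r q = 0)) &
        (forall q, U q -> exists d, rD2 r d q != 0)].

Definition smooth_real_hypersurface (M : set (CC R * CC R)) : Prop :=
  forall q, M q -> exists r, local_defining_function M q r.

Definition cder (h : CC R -> CC R) : CC R -> CC R := fun z => 'D_1 h z.

Definition holo1_on (U : set (CC R)) (h : CC R -> CC R) : Prop :=
  forall z, U z -> derivable h z 1.

Definition holo2c_on (U : set (CC R * CC R)) (f : CC R * CC R -> CC R) : Prop :=
  {within U, continuous f} /\
  forall q, U q ->
    derivable (fun z : CC R => f (z, q.2)) q.1 1 /\
    derivable (fun w : CC R => f (q.1, w)) q.2 1.

Definition holo2_on (U : set (CC R * CC R))
    (Phi : CC R * CC R -> CC R * CC R) : Prop :=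
  holo2c_on U (fun q => (Phi q).1) /\ holo2c_on U (fun q => (Phi q).2).

Definition good_coordinate (M : set (CC R * CC R)) (p : CC R * CC R)
    (Phi : CC R * CC R -> CC R * CC R) (F : CC R -> R) : Prop :=
  exists U : set (CC R * CC R),
    [/\ [/\ open U, U p, holo2_on U Phi &
            (forall q1 q2, U q1 -> U q2 -> Phi q1 = Phi q2 -> q1 = q2)],
        [/\ open (Phi @` U),
            (exists Psi, holo2_on (Phi @` U) Psi /\ forall q, U q -> Psi (Phi q) = q) &
            Phi p = (0, 0)],
        (exists delta : R, 0 < delta /\ smooth1_on (fun z => absC z < delta) F
             /\ forall q, U q -> absC (Phi q).1 < delta),
        [/\ F 0 = 0, pxy F 1 0 0 = 0 & pxy F 0 1 0 = 0] &
        (forall q, U q ->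
           (M q <-> 2 * complex.Re ((Phi q).2 : R[i]) + F (Phi q).1 = 0))].

Definition flat_at0 (F : CC R -> R) : Prop :=
  forall a b : nat, pxy F a b 0 = 0.

Definition taylor_hom (F : CC R -> R) (j : nat) (z : CC R) : R :=
  \sum_(a < j.+1)
     pxy F a (j - a) 0 / (a`! * (j - a)`!)%:R
       * (complex.Re (z : R[i])) ^+ a * (complex.Im (z : R[i])) ^+ (j - a).

(* c is the coefficient sequence of S(z) = sum_{j>=2} c_j z^j, i.e. the
   Taylor series of F at 0 equals 2 sum_{j>=2} complex.Re (c_j z^j) *)
Definition S_coefficients (F : CC R -> R) (c : nat -> CC R) : Prop :=
  forall j : nat, (2 <= j)%N ->
    forall z : CC R, taylor_hom F j z = 2 * complex.Re ((c j * z ^+ j : CC R) : R[i]).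

Definition positive_radius (c : nat -> CC R) : Prop :=
  exists z0 : CC R, z0 != 0 /\
    cvgn (series (fun j : nat => if (2 <= j)%N then c j * z0 ^+ j else 0)).

Definition in_Gamma (p : CC R * CC R) (gamma : CC R -> CC R * CC R) : Prop :=
  [/\ exists delta : R, 0 < delta /\
        holo1_on (fun t => absC t < delta) (fun t => (gamma t).1) /\
        holo1_on (fun t => absC t < delta) (fun t => (gamma t).2),
      gamma 0 = p &
      ~ (\forall t \near (0 : CC R), gamma t = p)].

Definition curve_order (p : CC R * CC R) (gamma : CC R -> CC R * CC R) (m : nat) :=
  (forall k, (k < m)%N ->
     iter k cder (fun t => (gamma t).1 - p.1) 0 = 0 /\
     iter k cder (fun t => (gamma t).2 - p.2) 0 = 0) /\
  (iter m cder (fun t => (gamma t).1 - p.1) 0 != 0 \/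
   iter m cder (fun t => (gamma t).2 - p.2) 0 != 0).

Definition in_Gamma_reg (p : CC R * CC R) (gamma : CC R -> CC R * CC R) : Prop :=
  in_Gamma p gamma /\ curve_order p gamma 1.

Definition real_order_ge (g : CC R -> R) (n : nat) : Prop :=
  forall a b : nat, (a + b < n)%N -> pxy g a b 0 = 0.

(* Delta_1(M,p) = sup_{gamma in Gamma} ord(r o gamma) / ord(gamma - p) = +oo,
   computed with the local defining function r *)
Definition Delta1_infinite (p : CC R * CC R) (r : CC R * CC R -> R) : Prop :=
  forall K : nat, exists (gamma : CC R -> CC R * CC R) (m : nat),
    [/\ in_Gamma p gamma, curve_order p gamma m &
        real_order_ge (r \o gamma) (K * m)].

Definition tangent_infinite_order (r : CC R * CC R -> R)
    (gamma : CC R -> CC R * CC R) : Prop :=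
  forall N : nat, exists c delta : R, 0 < delta /\
    forall t : CC R, absC t < delta -> `|r (gamma t)| <= c * absC t ^+ N.

End Defs.

(* Main.v *)
(** Pulling a regular curve back by a good coordinate (z, w) gives a graph
    w = h(z) with h holomorphic, since F has vanishing gradient at 0; because r
    and 2 Re w + F are comparable near p, the curve is tangent to infinite order
    exactly when F + 2 Re h vanishes to infinite order at 0.  The shear
    (z, w) |-> (z, w - h(z)) then turns F into the flat function F + 2 Re h.
    When S converges, h = - S does the same, and conversely a flat F has
    S = 0 and the curve w = 0.

    Holomorphic means complex differentiable, so power series expansions are
    derived from Goursat's theorem on rectangles in logarithmic polar
    coordinates, where circles are vertical sides and the horizontal sides
    cancel by periodicity. *)
Require Import Defs.
From mathcomp Require Import all_boot all_order all_algebra.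
From mathcomp Require Import all_classical all_reals all_analysis.
From mathcomp.real_closed Require Import complex.
From mathcomp Require Import ring lra.
Import Order.TTheory GRing.Theory Num.Theory numFieldNormedType.Exports.
Local Open Scope ring_scope.
Local Open Scope classical_set_scope.

Set Implicit Arguments.
Unset Strict Implicit.
Unset Printing Implicit Defensive.

(** * The modulus and complex derivatives *)

(** The functions [r] and 2 Re w + F are only known to share their zero set M, so they are compared
    through points of M. From a given point q one moves to a point of M at distance O(|value at q|)
    of the first function; the second function vanishes there and is Lipschitz, hence is O(|value at
    q|) at q. For [r] the point of M comes from the intermediate value theorem; for 2 Re w + F over
    w = 0 it is explicit, w = -F(z)/2.

    A tangent regular curve is a graph over z for the following reason. In the coordinate it is
    (alpha, beta), and F = O(|z|^2) forces Re beta = O(|t|^2). A complex linear map with vanishing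
    real part is zero, so beta'(0) = 0; regularity then gives alpha'(0) != 0, and h is beta composed
    with the inverse of alpha.

    All infinite order conditions are handled as bounds O(|z|^N) for every N, and Taylor's formula
    translates them into vanishing derivatives. Holomorphy in two variables means continuity plus
    partial complex derivatives, so the chain rule along curves and the Lipschitz bounds are derived
    from Cauchy estimates. *)

Section Modulus.
Variable R : realType.
Implicit Types (z w : CC R) (x y : R).

Lemma absCE z : `|z : R[i]| = (absC z)%:C%C.
Proof. by rewrite normc_def. Qed.

Lemma absC_ge0 z : 0 <= absC z. Proof. exact: sqrtr_ge0. Qed.

Lemma absCP z x : (`|z : R[i]| < x%:C%C) = (absC z < x).
Proof. by rewrite absCE ltcR. Qed.

Lemma absCM z w : absC (z * w) = absC z * absC w.
Proof.
apply: complexI; rewrite rmorphM /= -!absCE; exact: (@normrM (R[i])).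
Qed.

Lemma absCD z w : absC (z + w) <= absC z + absC w.
Proof. by rewrite -lecR rmorphD /= -!absCE; exact: (@ler_normD _ (R[i])). Qed.

Lemma absCN z : absC (- z) = absC z.
Proof. apply: complexI; rewrite -!absCE; exact: (@normrN _ (R[i])). Qed.

Lemma absCBC z w : absC (z - w) = absC (w - z).
Proof. by rewrite -absCN opprB. Qed.

Lemma absC0 : absC (0 : CC R) = 0.
Proof. by apply: complexI; rewrite -!absCE normr0. Qed.

Lemma absC1 : absC (1 : CC R) = 1.
Proof. by apply: complexI; rewrite -!absCE normr1. Qed.

Lemma absC_eq0 z : (absC z == 0) = (z == 0).
Proof.
rewrite -(inj_eq (@complexI R)) -absCE; exact: (@normr_eq0 _ (R[i])).
Qed.

Lemma absC_gt0 z : (0 < absC z) = (z != 0).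
Proof. by rewrite lt_neqAle eq_sym absC_eq0 absC_ge0 andbT. Qed.

Lemma absCX z n : absC (z ^+ n) = absC z ^+ n.
Proof. by elim: n => [|n ih]; rewrite ?expr0 ?absC1// !exprS absCM ih. Qed.

Lemma absCV z : absC (z^-1) = (absC z)^-1.
Proof. apply: complexI; rewrite fmorphV /= -!absCE; exact: (@normfV (R[i])). Qed.

Lemma absCf z w : absC (z / w) = absC z / absC w.
Proof. by rewrite absCM absCV. Qed.

Lemma absC_reC x : absC (reC x) = `|x|.
Proof. by rewrite /absC /reC /= expr0n addr0 sqrtr_sqr. Qed.

Lemma absC_imC : absC (imC R) = 1.
Proof. by rewrite /absC /imC /= expr0n expr1n add0r sqrtr1. Qed.

Lemma absC_Re z : `|complex.Re (z : R[i])| <= absC z.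
Proof. by rewrite -sqrtr_sqr ler_sqrt ?addr_ge0 ?sqr_ge0// lerDl sqr_ge0. Qed.

Lemma absC_Im z : `|complex.Im (z : R[i])| <= absC z.
Proof. by rewrite -sqrtr_sqr ler_sqrt ?addr_ge0 ?sqr_ge0// lerDr sqr_ge0. Qed.

Lemma absC_sum_le z :
  absC z <= `|complex.Re (z : R[i])| + `|complex.Im (z : R[i])|.
Proof.
rewrite -[leRHS]ger0_norm ?addr_ge0// -sqrtr_sqr ler_sqrt ?sqr_ge0//.
rewrite sqrrD !real_normK ?num_real//.
have := mulr_ge0 (normr_ge0 (complex.Re (z : R[i]))) (normr_ge0 (complex.Im (z : R[i]))).
by lra.
Qed.

Lemma absCB z w : absC (z - w) <= absC z + absC w.
Proof. by rewrite (le_trans (absCD _ _))// absCN. Qed.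

Lemma absC_triangle u z w : absC (z - w) <= absC (z - u) + absC (u - w).
Proof. by rewrite (le_trans _ (absCD _ _))// addrA subrK. Qed.

Lemma absC_lB z w : absC z - absC w <= absC (z - w).
Proof. by rewrite lerBlDr (le_trans _ (absCD _ _))// subrK. Qed.

Lemma absC_sum n (u : nat -> CC R) :
  absC (\sum_(i < n) u i) <= \sum_(i < n) absC (u i).
Proof.
elim: n => [|n ih]; first by rewrite !big_ord0 absC0.
by rewrite !big_ord_recr /= (le_trans (absCD _ _))// lerD2r.
Qed.

(** Balls of [CC R] have radii in [R[i]]. A positive element of [R[i]] is real, so real radii
    suffice and later estimates can stay in [R]. *)
Lemma nbhsCP z (P : set (CC R)) :
  nbhs z P <-> exists2 d : R, 0 < d & forall w, absC (w - z) < d -> P w.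
Proof.
split=> [/nbhs_ballP[e e0 H]|[d d0 H]].
  have [er eE] : exists x, e = x%:C%C :> R[i].
    by exists (complex.Re (e : R[i])); rewrite RRe_real// gtr0_real.
  move: e0; rewrite /= eE ltcR => e0.
  exists er => // w wz; apply: H; rewrite /ball /= eE.
  rewrite -absCP in wz; rewrite distrC; exact: wz.
apply/nbhs_ballP; exists (d%:C%C) => /=; first by rewrite ltcR.
move=> w; rewrite /ball /= => wz; apply: H.
by rewrite -absCP distrC.
Qed.

Lemma open_disc rho : open [set z : CC R | absC z < rho].
Proof.
rewrite openE => z /= zr; apply/nbhsCP; exists (rho - absC z); first by rewrite subr_gt0.
by move=> w wz /=; have := absCD (w - z) z; rewrite subrK; lra.
Qed.

Lemma nbhsC2P (q : CC R * CC R) (P : set (CC R * CC R)) :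
  nbhs q P <-> exists2 d : R, 0 < d &
    forall w : CC R * CC R, absC (w.1 - q.1) < d -> absC (w.2 - q.2) < d -> P w.
Proof.
split=> [[[A B] /= [/nbhsCP[a a0 HA] /nbhsCP[b b0 HB] H]]|[d d0 H]].
  exists (Num.min a b); first by rewrite lt_min a0.
  move=> [w1 w2] /=; rewrite !lt_min => /andP[h1 _] /andP[_ h2].
  by apply: H; split; [apply: HA|apply: HB].
exists ([set w : CC R | absC (w - q.1) < d], [set w : CC R | absC (w - q.2) < d]) => /=.
  by split; apply/nbhsCP; exists d.
by move=> w [] /= h1 h2; apply: H.
Qed.

(** Increment form of complex differentiability: without a punctured neighbourhood or a division,
    errors can be added, composed and compared with Lipschitz bounds. *)
Definition is_cderiv (f : CC R -> CC R) z (l : CC R) := forall e : R, 0 < e ->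
  exists2 d : R, 0 < d & forall k, absC k < d ->
    absC (f (z + k) - f z - l * k) <= e * absC k.

Lemma cderiv_is_derive f z l : is_cderiv f z l <-> is_derive z 1 f l.
Proof.
split=> [H|[/cvg_ex[l' H] E]].
  have L : (fun h : CC R => (h : R[i])^-1 *: ((f \o shift z) ((h : R[i]) *: (1 : CC R)) - f z)) @ (0 : CC R)^' --> l.
    apply/cvgrPdist_le => e e0.
    have [er eE] : exists x, e = x%:C%C :> R[i].
      by exists (complex.Re (e : R[i])); rewrite RRe_real// gtr0_real.
    move: e0; rewrite eE ltcR => e0.
    have [d d0 Hd] := H er e0.
    rewrite near_withinE; apply/nbhsCP; exists d => // k; rewrite subr0 => kd k0.
    have -> : l - k^-1 *: ((f \o shift z) (k *: 1) - f z) =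
      - ((f (z + k) - f z - l * k) / k) :> CC R.
      rewrite /= /GRing.scale /= mulr1 (addrC k); field.
      exact: k0.
    change (`|- ((f (z + k) - f z - l * k) / k) : R[i]| <= er%:C%C).
    rewrite absCE lecR absCN absCf ler_pdivrMr ?absC_gt0//; exact: Hd.
  by split; [apply/cvg_ex; exists l|apply/cvg_lim => //; exact: norm_hausdorff].
have {E}ll : l' = l by rewrite -E; apply/esym/cvg_lim => //; exact: norm_hausdorff.
rewrite {}ll {l'} in H.
move=> e e0.
have e0' : 0 < e%:C%C :> R[i] by rewrite ltcR.
move/cvgrPdist_le: H => /(_ _ e0'); rewrite near_withinE => /nbhsCP[d d0 Hd].
exists d => // k kd; have [->|k0] := eqVneq k 0.
  by rewrite addr0 subrr mulr0 subrr absC0 mulr0.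
move: (Hd k); rewrite subr0 => /(_ kd k0).
have -> : l - k^-1 *: ((f \o shift z) (k *: 1) - f z) =
      - ((f (z + k) - f z - l * k) / k) :> CC R.
  rewrite /= /GRing.scale /= mulr1 (addrC k); field.
  exact: k0.
rewrite absCE lecR absCN absCf ler_pdivrMr ?absC_gt0//.
Qed.

Lemma derivable_cderiv f z : derivable f z 1 <-> exists l, is_cderiv f z l.
Proof.
split=> [H|[l /cderiv_is_derive[]//]].
by exists ('D_1 f z); apply/cderiv_is_derive/derivableP.
Qed.

End Modulus.

Lemma exists_small (R : realType) (l : seq R) : all (fun y => 0 < y) l ->
  exists2 x, 0 < x & all (fun y => x < y) l.
Proof.
elim: l => [|y l ih] /=; first by exists 1.
move=> /andP[y0 /ih[x x0 xl]]; exists (Num.min x (y / 2)).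
  by rewrite lt_min x0 divr_gt0.
apply/andP; split; first by rewrite gt_min ltr_pdivrMr//; apply/orP; right; lra.
by apply: sub_all xl => z xz; rewrite gt_min xz.
Qed.

Lemma geometric_lt (R : realType) (q C e : R) : `|q| < 1 -> 0 < e ->
  exists N, forall n, (N <= n)%N -> C * q ^+ n < e.
Proof.
move=> q1 e0; have := @cvg_geometric R C q q1.
move/cvgr0Pnorm_lt => /(_ e e0)[N _ HN]; exists N => n Nn.
by rewrite (le_lt_trans (ler_norm _))//; exact: HN.
Qed.

Section ModulusContinuity.
Variable R : realType.
Implicit Types (z w : CC R) (x y : R).

Lemma continuousCP (T : topologicalType) (g : T -> CC R) (t : T) :
  {for t, continuous g} <->
  forall e : R, 0 < e -> \forall u \near t, absC (g u - g t) < e.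
Proof.
split=> [H e e0|H]; first by apply: (H [set w | absC (w - g t) < e]); apply/nbhsCP; exists e.
by move=> A /nbhsCP[e e0 HA]; apply: filterS (H e e0) => u; exact: HA.
Qed.

Lemma continuousRP (T : topologicalType) (g : T -> R) (t : T) :
  {for t, continuous g} <->
  forall e : R, 0 < e -> \forall u \near t, `|g u - g t| < e.
Proof.
split=> [/cvgrPdist_lt H e e0|H].
  by apply: filterS (H e e0) => u; rewrite distrC.
by apply/cvgrPdist_lt => e e0; apply: filterS (H e e0) => u; rewrite distrC.
Qed.

Lemma continuous_Re z : {for z, continuous (fun w : CC R => complex.Re (w : R[i]))}.
Proof.
apply/continuousRP => e e0; apply/nbhsCP; exists e => // w.
by apply: le_lt_trans; rewrite -raddfB; exact: absC_Re.
Qed.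

Lemma continuous_Im z : {for z, continuous (fun w : CC R => complex.Im (w : R[i]))}.
Proof.
apply/continuousRP => e e0; apply/nbhsCP; exists e => // w.
by apply: le_lt_trans; rewrite -raddfB; exact: absC_Im.
Qed.

Lemma continuous_Complex (T : topologicalType) (u v : T -> R) (t : T) :
  {for t, continuous u} -> {for t, continuous v} ->
  {for t, continuous (fun t => Complex (u t) (v t) : CC R)}.
Proof.
move=> /continuousRP cu /continuousRP cv; apply/continuousCP => e e0.
have e2 : 0 < e / 2 by rewrite divr_gt0.
apply: filterS2 (cu _ e2) (cv _ e2) => t' h1 h2.
by rewrite (le_lt_trans (absC_sum_le _))//= (splitr e) ltrD.
Qed.

Lemma derivableC_continuous (f : CC R -> CC R) z :
  derivable f z 1 -> {for z, continuous f}.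
Proof. by move=> /derivable1_diffP/differentiable_continuous. Qed.

Lemma is_derive_dist (f : R -> R) x l : is_derive x 1 f l ->
  forall e, 0 < e -> exists2 d, 0 < d & forall h, `|h| < d ->
    `|f (x + h) - f x - l * h| <= e * `|h|.
Proof.
case=> /cvg_ex[l' H] E e e0.
have ll : l' = l by rewrite -E; apply/esym/cvg_lim.
rewrite {}ll {l' E} in H.
move/cvgrPdist_le: H => /(_ _ e0); rewrite near_withinE => /nbhs_ballP[d /= d0 Hd].
exists d => // h hd; have [->|h0] := eqVneq h 0.
  by rewrite addr0 subrr mulr0 subrr normr0 mulr0.
have := Hd h; rewrite /ball /= sub0r normrN => /(_ hd h0).
have -> : l - h^-1 *: ((f \o shift x) (h *: 1) - f x) = - ((f (x + h) - f x - l * h) / h).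
  by rewrite /= /GRing.scale /= mulr1 (addrC h); field.
by rewrite normrN normrM normfV ler_pdivrMr ?normr_gt0.
Qed.

End ModulusContinuity.

Section DerivC.
Variable R : realType.
Implicit Types (z w : CC R) (f g : CC R -> CC R).

Lemma derivableC_cst (c : CC R) z : derivable (fun _ : CC R => c) z 1.
Proof. exact: derivable_cst. Qed.

Lemma derivableC_id z : derivable (fun w : CC R => w) z 1.
Proof. exact: derivable_id. Qed.

Lemma derivableCD f g z : derivable f z 1 -> derivable g z 1 ->
  derivable (fun w => f w + g w) z 1.
Proof. exact: derivableD. Qed.

Lemma derivableCB f g z : derivable f z 1 -> derivable g z 1 ->
  derivable (fun w => f w - g w) z 1.
Proof. exact: derivableB. Qed.

Lemma derivableCM f g z : derivable f z 1 -> derivable g z 1 ->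
  derivable (fun w => f w * g w) z 1.
Proof. exact: (@derivableM R[i] (CC R)). Qed.

Lemma derivableCV f z : f z != 0 -> derivable f z 1 ->
  derivable (fun w => (f w)^-1) z 1.
Proof. exact: (@derivableV R[i] (CC R)). Qed.

Lemma derivableCX f n z : derivable f z 1 -> derivable (fun w => f w ^+ n) z 1.
Proof.
move=> df; elim: n => [|n ih]; first exact: derivableC_cst.
have -> : (fun w => f w ^+ n.+1) = (fun w => f w * f w ^+ n).
  by apply/funext => w; rewrite exprS.
exact: derivableCM.
Qed.

Lemma continuousCM f g z : {for z, continuous f} -> {for z, continuous g} ->
  {for z, continuous (fun w => f w * g w)}.
Proof.
by move=> cf cg; have := @cvgM R[i] (CC R) (nbhs z) _ f g (f z) (g z) cf cg; apply.
Qed.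

Lemma cderiv_comp f g z l m : is_cderiv f z l -> is_cderiv g (f z) m ->
  is_cderiv (fun w => g (f w)) z (m * l).
Proof.
move=> Hf Hg e e0; have L0 := absC_ge0 l; have M0 := absC_ge0 m.
(* The outer error is at most [e1 * (absC l + 1) * absC k] and the inner error, multiplied by [m],
   at most [absC m * e1 * absC k]; the sum is [e1 * q * absC k]. *)
set q := absC l + absC m + 1; have q0 : 0 < q by rewrite /q; lra.
have [e1 [e10 e11 e12]] : exists e1, [/\ 0 < e1, e1 <= 1 & e1 * q <= e].
  exists (Num.min 1 (e / q)); split.
  - by rewrite lt_min ltr01 divr_gt0.
  - by rewrite ge_min lexx.
  - by rewrite -ler_pdivlMr// ge_min lexx orbT.
have [d1 d10 H1] := Hf _ e10; have [d2 d20 H2] := Hg _ e10.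
have l1 : 0 < absC l + 1 by lra.
exists (Num.min d1 (d2 / (absC l + 1))); first by rewrite lt_min d10 divr_gt0.
move=> k; rewrite lt_min => /andP[k1 k2]; have k0 := absC_ge0 k.
have {}H1 := H1 k k1.
have F : absC (f (z + k) - f z) <= (absC l + 1) * absC k.
  have := absCD (f (z + k) - f z - l * k) (l * k); rewrite subrK absCM.
  have : e1 * absC k <= 1 * absC k by rewrite ler_wpM2r.
  by lra.
have := H2 (f (z + k) - f z); rewrite addrCA subrr addr0 => {}H2.
have {}H2 := H2 (le_lt_trans F (_ : _ < d2)).
rewrite mulrC -ltr_pdivlMr// in H2; have {}H2 := H2 k2.
set a := f (z + k) - f z in H1 F H2.
have -> : g (f (z + k)) - g (f z) - m * l * k =
   (g (f (z + k)) - g (f z) - m * a) + m * (a - l * k) by ring.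
apply: le_trans (absCD _ _) _; rewrite absCM.
have A : e1 * absC a <= e1 * ((absC l + 1) * absC k) by rewrite ler_wpM2l// ltW.
have B : absC m * absC (a - l * k) <= absC m * (e1 * absC k) by rewrite ler_wpM2l.
have C : e1 * q * absC k <= e * absC k by rewrite ler_wpM2r.
by move: H2 A B C; rewrite /q; lra.
Qed.

Lemma derivableC_comp f g z : derivable f z 1 -> derivable g (f z) 1 ->
  derivable (fun w => g (f w)) z 1.
Proof.
move=> /derivable_cderiv[l Hl] /derivable_cderiv[m Hm]; apply/derivable_cderiv.
by exists (m * l); exact: cderiv_comp.
Qed.

Lemma near_eq_derivableC f g z : (\forall w \near z, f w = g w) ->
  derivable f z 1 -> derivable g z 1.
Proof. exact: near_eq_derivable. Qed.

End DerivC.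

(** * Goursat's theorem on rectangles *)

Section Goursat.
Variable R : realType.
Implicit Types (a b c d x y : R) (f g : R -> R).

Definition is_prim (f P : R -> R) a b :=
  forall x, a <= x <= b -> is_derive x 1 P (f x).

(** An integral defined through antiderivatives, so that additivity, linearity and the mean value
    theorem reduce to statements about primitives. By [Int_prim] the choice of primitive is
    immaterial; the default 0 only occurs when there is none. *)
Definition Int (f : R -> R) a b : R :=
  xget 0 [set v | exists2 P, is_prim f P a b & v = P b - P a].

Lemma is_prim_MVT f P a b : a <= b -> is_prim f P a b ->
  exists2 x, a <= x <= b & P b - P a = f x * (b - a).
Proof.
move=> ab H; have [||x xab E] := @MVT_segment R P f a b ab.
- by move=> x; rewrite in_itv /= => /andP[/ltW ? /ltW ?]; apply: H; apply/andP.
- apply: derivable_within_continuous => x; rewrite in_itv /= => /H h.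
  exact: ex_derive.
by exists x => //; rewrite in_itv in xab.
Qed.

Lemma Int_prim f P a b : a <= b -> is_prim f P a b -> Int f a b = P b - P a.
Proof.
move=> ab H; rewrite /Int; case: xgetP => [v _ [Q HQ ->]|/(_ (P b - P a))[]].
  have HD : is_prim (fun x => f x - f x) (Q - P) a b.
    by move=> x xab; apply: is_deriveB; [exact: HQ|exact: H].
  have [x _] := is_prim_MVT ab HD; rewrite subrr mul0r => /eqP.
  by rewrite !fctE subr_eq0 => /eqP; lra.
by exists P.
Qed.

Lemma prim_exists f a b : continuous f -> exists P, is_prim f P a b.
Proof.
(* Starting the integral at [a - 1] makes every point of [[a, b]] interior, so the derivative is
   two-sided even at [a], as [is_prim] demands. *)
move=> cf; exists (fun x => \int[lebesgue_measure]_(t in [set` `[a - 1, x]]) (f t))%R.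
move=> x /andP[ax xb].
have [||||D E] := @continuous_FTC1_closed R f (a - 1) x (x + 1).
- by rewrite ltrDl.
- apply: continuous_compact_integrable; first exact: segment_compact.
  move=> z; apply: continuous_subspaceT; exact: cf.
- by lra.
- exact: cf.
rewrite -E derive1E; exact: derivableP.
Qed.

Lemma Int_MVT f a b : a <= b -> continuous f ->
  exists2 x, a <= x <= b & Int f a b = f x * (b - a).
Proof.
move=> ab cf; have [P HP] := prim_exists a b cf.
by rewrite (Int_prim ab HP); exact: is_prim_MVT.
Qed.

Lemma Int_split f c a b : a <= c -> c <= b -> continuous f ->
  Int f a b = Int f a c + Int f c b.
Proof.
move=> ac cb cf; have [P HP] := prim_exists a b cf.
rewrite (Int_prim (le_trans ac cb) HP) (@Int_prim f P a c)// ?(@Int_prim f P c b)//.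
- by ring.
- by move=> x /andP[cx xb]; apply: HP; rewrite xb (le_trans ac).
- by move=> x /andP[cx xb]; apply: HP; rewrite cx (le_trans xb).
Qed.

Lemma IntD f g a b : a <= b -> continuous f -> continuous g ->
  Int (fun x => f x + g x) a b = Int f a b + Int g a b.
Proof.
move=> ab cf cg.
have [P HP] := prim_exists a b cf; have [Q HQ] := prim_exists a b cg.
rewrite (Int_prim ab HP) (Int_prim ab HQ).
rewrite (@Int_prim _ (P + Q) a b ab) ?fctE; first by ring.
by move=> x xab; apply: is_deriveD; [exact: HP|exact: HQ].
Qed.

Lemma IntZ f k a b : a <= b -> continuous f ->
  Int (fun x => k * f x) a b = k * Int f a b.
Proof.
move=> ab cf; have [P HP] := prim_exists a b cf.
rewrite (Int_prim ab HP) (@Int_prim _ (k *: P) a b ab) ?fctE.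
  by rewrite /GRing.scale /=; ring.
by move=> x xab; apply: is_deriveZ; exact: HP.
Qed.

Lemma IntB f g a b : a <= b -> continuous f -> continuous g ->
  Int (fun x => f x - g x) a b = Int f a b - Int g a b.
Proof.
move=> ab cf cg.
have [P HP] := prim_exists a b cf; have [Q HQ] := prim_exists a b cg.
rewrite (Int_prim ab HP) (Int_prim ab HQ).
rewrite (@Int_prim _ (P - Q) a b ab) ?fctE; first by ring.
by move=> x xab; apply: is_deriveB; [exact: HP|exact: HQ].
Qed.

Lemma dist_in_itv a h x y : a <= x <= a + h -> a <= y <= a + h -> `|x - y| <= h.
Proof. by move=> /andP[? ?] /andP[? ?]; apply/ler_normlP; split; lra. Qed.

(* Imaginary part of the integral of U + iV along the boundary of a rectangle. *)
Definition rect_int (U V : R -> R -> R) x1 x2 y1 y2 : R :=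
  Int (U x2) y1 y2 - Int (U x1) y1 y2 + (Int (V^~ y1) x1 x2 - Int (V^~ y2) x1 x2).

Variables (U V : R -> R -> R).
Hypothesis cU : forall x, continuous (U x).
Hypothesis cV : forall y, continuous (V^~ y).
Local Notation J := (rect_int U V).

Lemma rect_int_split4 x1 xm x2 y1 ym y2 :
  x1 <= xm -> xm <= x2 -> y1 <= ym -> ym <= y2 ->
  J x1 x2 y1 y2 = J x1 xm y1 ym + J xm x2 y1 ym + J x1 xm ym y2 + J xm x2 ym y2.
Proof.
move=> h1 h2 h3 h4; rewrite /rect_int.
rewrite (Int_split h3 h4 (@cU x2)) (Int_split h3 h4 (@cU x1)).
rewrite (Int_split h1 h2 (@cV y1)) (Int_split h1 h2 (@cV y2)).
by ring.
Qed.

(** By the mean value theorem, each pair of opposite sides contributes one increment times a side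
    length. The linear parts are [A * (x2 - x1) * (y2 - y1)] with opposite signs and cancel; each
    increment leaves an error of at most [2 * e]. *)
Lemma rect_int_approx x1 x2 y1 y2 x0 y0 A B e :
  x1 <= x2 -> y1 <= y2 ->
  (forall x y, x1 <= x <= x2 -> y1 <= y <= y2 ->
    `|U x y - U x0 y0 - (A * (x - x0) - B * (y - y0))| <= e /\
    `|V x y - V x0 y0 - (B * (x - x0) + A * (y - y0))| <= e) ->
  `|J x1 x2 y1 y2| <= 2 * e * ((x2 - x1) + (y2 - y1)).
Proof.
move=> h1 h2 H; rewrite /rect_int -!IntB//.
have [|y yy ->] := @Int_MVT (fun y => U x2 y - U x1 y) y1 y2 h2.
  by move=> z; apply: continuousB; exact: cU.
have [|x xx ->] := @Int_MVT (fun x => V x y1 - V x y2) x1 x2 h1.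
  by move=> z; apply: continuousB; exact: cV.
have [/ler_normlP[a1 a2] _] := H x2 y (introT andP (conj h1 (lexx _))) yy.
have [/ler_normlP[a3 a4] _] := H x1 y (introT andP (conj (lexx _) h1)) yy.
have [_ /ler_normlP[a5 a6]] := H x y1 xx (introT andP (conj (lexx _) h2)).
have [_ /ler_normlP[a7 a8]] := H x y2 xx (introT andP (conj h2 (lexx _))).
have -> : (U x2 y - U x1 y) * (y2 - y1) + (V x y1 - V x y2) * (x2 - x1) =
  (U x2 y - U x1 y - A * (x2 - x1)) * (y2 - y1)
  + (V x y1 - V x y2 - A * (y1 - y2)) * (x2 - x1) by ring.
rewrite (le_trans (ler_normD _ _))// !normrM (ger0_norm (_ : 0 <= y2 - y1)) ?subr_ge0//.
rewrite (ger0_norm (_ : 0 <= x2 - x1)) ?subr_ge0// [leRHS]mulrDr [leRHS]addrC lerD//.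
  rewrite ler_wpM2r ?subr_ge0//; apply/ler_normlP; split; lra.
rewrite ler_wpM2r ?subr_ge0//; apply/ler_normlP; split; lra.
Qed.

Variables (a b c d : R).
Hypotheses (le_ab : a <= b) (le_cd : c <= d).
(* Cauchy-Riemann equations with differentiability relative to the rectangle. *)
Hypothesis cauchy_riemann : forall x y, a <= x <= b -> c <= y <= d -> exists A B,
  forall e, 0 < e -> exists2 t, 0 < t & forall x' y',
    a <= x' <= b -> c <= y' <= d -> `|x' - x| < t -> `|y' - y| < t ->
    `|U x' y' - U x y - (A * (x' - x) - B * (y' - y))| <= e * (`|x' - x| + `|y' - y|) /\
    `|V x' y' - V x y - (B * (x' - x) + A * (y' - y))| <= e * (`|x' - x| + `|y' - y|).

Let hx n := (b - a) / 2 ^+ n.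
Let hy n := (d - c) / 2 ^+ n.
Let Jn n (p : R * R) := J p.1 (p.1 + hx n) p.2 (p.2 + hy n).

Let hxS n : hx n = hx n.+1 + hx n.+1.
Proof.
rewrite /hx exprS invfM mulrA [_ / 2 * _]mulrAC.
by have := splitr ((b - a) * (2 ^+ n)^-1); lra.
Qed.
Let hyS n : hy n = hy n.+1 + hy n.+1.
Proof.
rewrite /hy exprS invfM mulrA [_ / 2 * _]mulrAC.
by have := splitr ((d - c) * (2 ^+ n)^-1); lra.
Qed.
Let hx0 n : 0 <= hx n.
Proof. by rewrite divr_ge0 ?exprn_ge0// subr_ge0. Qed.
Let hy0 n : 0 <= hy n.
Proof. by rewrite divr_ge0 ?exprn_ge0// subr_ge0. Qed.

(** Here [p] and [q] are lower left corners of rectangles of levels [n] and [n.+1]. The bounds on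
    [q] only say that the small rectangle lies in the large one, which is all that nesting needs. *)
Let quarter n (p q : R * R) : Prop :=
  [/\ p.1 <= q.1 <= p.1 + hx n.+1, p.2 <= q.2 <= p.2 + hy n.+1 &
      `|Jn n p| <= 4 * `|Jn n.+1 q|].

(** Pigeonhole: the integral is the sum over the four quarters, so they cannot all be smaller than a
    quarter of it in absolute value. *)
Let quarter_ex n p : exists q, quarter n p q.
Proof.
have X : p.1 + hx n = p.1 + hx n.+1 + hx n.+1 by rewrite hxS; ring.
have Y : p.2 + hy n = p.2 + hy n.+1 + hy n.+1 by rewrite hyS; ring.
have E : Jn n p = Jn n.+1 p + Jn n.+1 (p.1 + hx n.+1, p.2)
   + Jn n.+1 (p.1, p.2 + hy n.+1) + Jn n.+1 (p.1 + hx n.+1, p.2 + hy n.+1).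
  rewrite /Jn /= X Y; apply: rect_int_split4; rewrite lerDl//.
have x0 := hx0 n.+1; have y0 := hy0 n.+1.
apply: contrapT => /forallNP H.
have G q : p.1 <= q.1 <= p.1 + hx n.+1 -> p.2 <= q.2 <= p.2 + hy n.+1 ->
    4 * `|Jn n.+1 q| < `|Jn n p|.
  by move=> h1 h2; rewrite ltNge; apply/negP => h3; apply: (H q); split.
have g1 := G p; have g2 := G (p.1 + hx n.+1, p.2).
have g3 := G (p.1, p.2 + hy n.+1); have g4 := G (p.1 + hx n.+1, p.2 + hy n.+1).
rewrite /= !lexx !lerDl x0 y0 /= in g1 g2 g3 g4.
have := le_trans (ler_normD _ _) (lerD (le_trans (ler_normD _ _) (lerD (ler_normD (Jn n.+1 p) (Jn n.+1 (p.1 + hx n.+1, p.2))) (lexx `|Jn n.+1 (p.1, p.2 + hy n.+1)|))) (lexx `|Jn n.+1 (p.1 + hx n.+1, p.2 + hy n.+1)|)).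
rewrite -E; move: (g1 isT isT) (g2 isT isT) (g3 isT isT) (g4 isT isT).
by lra.
Qed.

Let corner := fix F n := if n is m.+1 then xget (0, 0) (quarter m (F m)) else (a, c).

Let cornerS n : quarter n (corner n) (corner n.+1).
Proof. exact: (@xgetPex _ (0, 0) (quarter n (corner n)) (quarter_ex n (corner n))). Qed.

Let corner_mono n k : (corner n).1 <= (corner (n + k)).1
    /\ (corner (n + k)).1 + hx (n + k) <= (corner n).1 + hx n
    /\ (corner n).2 <= (corner (n + k)).2
    /\ (corner (n + k)).2 + hy (n + k) <= (corner n).2 + hy n.
Proof.
elim: k => [|k [h1 [h2 [h3 h4]]]]; first by rewrite addn0.
rewrite addnS; have [/andP[g1 g2] /andP[g3 g4] _] := cornerS (n + k).
have x := hxS (n + k); have y := hyS (n + k).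
by split; [lra|split; [lra|split; lra]].
Qed.

Let nested (u h : nat -> R) : (forall n k, u n <= u (n + k)%N) ->
  (forall n k, u (n + k)%N + h (n + k)%N <= u n + h n) -> (forall n, 0 <= h n) ->
  exists X, forall n, u n <= X <= u n + h n.
Proof.
move=> m1 m2 h0; exists (sup (range u)) => n.
have ub m : u m <= u n + h n.
  rewrite (le_trans (m1 m n))// addnC (le_trans _ (m2 n m))//.
  by rewrite lerDl h0.
apply/andP; split.
  apply: ub_le_sup; last by exists n.
  by exists (u n + h n) => _ [m _ <-].
apply: ge_sup; first by exists (u n), n.
by move=> _ [m _ <-].
Qed.

Lemma goursat : J a b c d = 0.
Proof.
have [X HX] : exists X, forall n, (corner n).1 <= X <= (corner n).1 + hx n.
  apply: nested => //.
  - by move=> n k; have [] := corner_mono n k.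
  - by move=> n k; have [_ []] := corner_mono n k.
have [Y HY] : exists Y, forall n, (corner n).2 <= Y <= (corner n).2 + hy n.
  apply: nested => //.
  - by move=> n k; have [_ [_ []]] := corner_mono n k.
  - by move=> n k; have [_ [_ []]] := corner_mono n k.
have J0 n : `|J a b c d| <= 4 ^+ n * `|Jn n (corner n)|.
  elim: n => [|n ih].
    by rewrite /Jn /hx /hy /= !expr0 !divr1 mul1r (addrC a) (addrC c) !subrK.
  rewrite (le_trans ih)// exprS (mulrC 4) -mulrA ler_wpM2l ?exprn_ge0//.
  by have [] := cornerS n.
have e0 : hx 0 = b - a by rewrite /hx expr0 divr1.
have e1 : hy 0 = d - c by rewrite /hy expr0 divr1.
have HX0 := HX 0; have HY0 := HY 0; rewrite /= e0 e1 in HX0 HY0.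
(* The linear approximation is taken at [(X, Y)], the common point of all nested rectangles. *)
have [||A [B HAB]] := cauchy_riemann (x := X) (y := Y); [lra|lra|].
set S := (b - a) + (d - c).
have S0 : 0 <= S by rewrite addr_ge0// subr_ge0.
(* [S] is half the perimeter. At level [n] it has become [s = S / 2 ^+ n], and the local bound
   [2 * (e * s) * s] multiplied by [4 ^+ n] is [2 * e * S ^+ 2], whatever [n] is. *)
suff H e : 0 < e -> `|J a b c d| <= 2 * e * S ^+ 2.
  apply/eqP; rewrite -normr_le0; apply/ler_addgt0Pr => e e0'; rewrite add0r.
  have q0 : 0 < 2 * S ^+ 2 + 1 by rewrite ltr_wpDl// mulr_ge0// sqr_ge0.
  have := H (e / (2 * S ^+ 2 + 1)) (divr_gt0 e0' q0).
  move=> /le_trans; apply.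
  have -> : 2 * (e / (2 * S ^+ 2 + 1)) * S ^+ 2 = e * (2 * S ^+ 2 / (2 * S ^+ 2 + 1)) by ring.
  by rewrite ler_piMr ?(ltW e0')// ler_pdivrMr// mul1r lerDl.
move=> {}e0'.
have [t t0 Ht] := HAB e e0'.
have [n Hn] : exists n, S / 2 ^+ n < t.
  have [|n /(_ n (leqnn _)) Hn] := @geometric_lt R 2^-1 S t _ t0.
    by rewrite ger0_norm// invf_lt1//; lra.
  by exists n; rewrite -exprVn.
have := J0 n; rewrite /Jn; set q := corner n.
have /andP[hX1 hX2] := HX n; have /andP[hY1 hY2] := HY n; rewrite -/q in hX1 hX2 hY1 hY2.
have [k1 [k2 [k3 k4]]] := corner_mono 0 n; rewrite add0n /= -/q e0 e1 in k1 k2 k3 k4.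
have hS : hx n + hy n = S / 2 ^+ n by rewrite /hx /hy -mulrDl.
set s := S / 2 ^+ n in hS Hn.
have s0 : 0 <= s by rewrite divr_ge0// exprn_ge0.
have xn := hx0 n; have yn := hy0 n.
have := @rect_int_approx q.1 (q.1 + hx n) q.2 (q.2 + hy n) X Y A B (e * s).
rewrite !lerDl xn yn => /(_ isT isT) H.
move=> /le_trans; apply.
have -> : 2 * e * S ^+ 2 = 4 ^+ n * (2 * (e * s) * s).
  have -> : (4 : R) = 2 ^+ 2 by rewrite -natrX.
  rewrite /s -exprM mulnC exprM [RHS]mulrC.
  field; exact: expf_neq0.
rewrite ler_wpM2l ?exprn_ge0//.
move: H; have -> : q.1 + hx n - q.1 + (q.2 + hy n - q.2) = s by rewrite -hS; ring.
apply=> x y /andP[x1 x2] /andP[y1 y2].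
have dx : `|x - X| <= hx n by apply: (@dist_in_itv q.1); rewrite ?x1 ?hX1.
have dy : `|y - Y| <= hy n by apply: (@dist_in_itv q.2); rewrite ?y1 ?hY1.
rewrite (addrC a) subrK in k2; rewrite (addrC c) subrK in k4.
have xab : a <= x <= b by rewrite (le_trans k1 x1) (le_trans x2 k2).
have ycd : c <= y <= d by rewrite (le_trans k3 y1) (le_trans y2 k4).
have st : hx n + hy n < t by rewrite hS.
have [||E1 E2] := Ht x y xab ycd.
- by apply: le_lt_trans st; apply: le_trans dx _; rewrite lerDl.
- by apply: le_lt_trans st; apply: le_trans dy _; rewrite lerDr.
have F : e * (`|x - X| + `|y - Y|) <= e * s.
  by rewrite ler_wpM2l ?(ltW e0')// -hS lerD.
by split; apply: (le_trans _ F).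
Qed.
End Goursat.

(** * Circle means and power series of holomorphic functions *)

Section CircleMean.
Variable R : realType.
Implicit Types (z w : CC R) (s t x y : R) (f g : CC R -> CC R).

Definition circ s t : CC R := Complex (s * cos t) (s * sin t).

Lemma absC_circ s t : 0 <= s -> absC (circ s t) = s.
Proof.
move=> s0; rewrite /absC /circ /= !exprMn -mulrDr cos2Dsin2 mulr1 sqrtr_sqr.
exact: ger0_norm.
Qed.

Lemma continuous_circ s : continuous (circ s).
Proof.
move=> t; apply: (@continuous_Complex _ _ (fun t => s * cos t) (fun t => s * sin t)).
  by apply: continuousM; [exact: cst_continuous|exact: continuous_cos].
by apply: continuousM; [exact: cst_continuous|exact: continuous_sin].
Qed.

(** [circ (expR x) y] is exp(x + iy): an increment in logarithmic polar coordinates becomes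
    multiplication by a factor close to 1. *)
Lemma circ_expRD x y h k :
  circ (expR (x + h)) (y + k) = circ (expR x) y * circ (expR h) k.
Proof.
rewrite /circ expRD cosD sinD; apply/eqP; rewrite eq_complex /=.
by apply/andP; split; apply/eqP; ring.
Qed.

Lemma expR_circ_approx (e : R) : 0 < e -> exists2 d : R, 0 < d &
  forall h k : R, `|h| < d -> `|k| < d ->
    absC (circ (expR h) k - 1 - Complex h k) <= e * (`|h| + `|k|).
Proof.
(* The errors below add up to [e1] times |h| plus [7 * e1] times |k|. *)
move=> e0; pose e1 := Num.min (e / 8) 1.
have e10 : 0 < e1 by rewrite lt_min ltr01 divr_gt0.
have e11 : e1 <= 1 by rewrite ge_min lexx orbT.
have e1e : e1 <= e / 8 by rewrite ge_min lexx. clearbody e1.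
have [d1 d10 H1] := is_derive_dist (is_derive_expR (0 : R)) e10.
have [d2 d20 H2] := is_derive_dist (is_derive_cos (0 : R)) e10.
have [d3 d30 H3] := is_derive_dist (is_derive_sin (0 : R)) e10.
exists (Num.min (Num.min d1 d2) (Num.min d3 e1)).
  by rewrite !lt_min d10 d20 d30 e10.
move=> h k; rewrite !lt_min => /andP[/andP[hd1 _] /andP[_ he]].
move=> /andP[/andP[_ kd2] /andP[kd3 ke]].
have := H1 h hd1; rewrite expR0 add0r mul1r => {}H1.
have := H2 k kd2; rewrite cos0 sin0 add0r oppr0 mul0r subr0 => {}H2.
have := H3 k kd3; rewrite cos0 sin0 add0r mul1r subr0 => {}H3.
have A1 : `|expR h - 1| <= 2 * `|h|.
  have := ler_normD (expR h - 1 - h) h; rewrite subrK.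
  have : e1 * `|h| <= 1 * `|h| by rewrite ler_wpM2r.
  by lra.
have A2 : `|sin k| <= 2 * `|k|.
  have := ler_normD (sin k - k) k; rewrite subrK.
  have : e1 * `|k| <= 1 * `|k| by rewrite ler_wpM2r.
  by lra.
have h0 := normr_ge0 h; have k0 := normr_ge0 k.
apply: le_trans (absC_sum_le _) _; rewrite /circ /=.
have E1 : `|expR h * cos k - 1 - h| <= e1 * `|h| + 2 * (e1 * `|k|).
  have -> : expR h * cos k - 1 - h = (expR h - 1 - h) * cos k + (1 + h) * (cos k - 1) by ring.
  apply: le_trans (ler_normD _ _) _; rewrite !normrM lerD//.
    rewrite -[leRHS]mulr1 ler_pM//; apply/ler_normlP.
    have := cos_le1 k; have := cos_geN1 k; split; lra.
  rewrite ler_pM//; apply: le_trans (ler_normD _ _) _; rewrite normr1; lra.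
have E2 : `|expR h * sin k - 0 - k| <= 4 * e1 * `|k| + e1 * `|k|.
  have -> : expR h * sin k - 0 - k = (expR h - 1) * sin k + (sin k - k) by ring.
  apply: le_trans (ler_normD _ _) _; rewrite normrM lerD//.
  apply: le_trans (ler_pM _ _ A1 A2) _ => //.
  have : `|h| * `|k| <= e1 * `|k| by rewrite ler_wpM2r// ltW.
  by lra.
have : e1 * `|h| <= e / 8 * `|h| by rewrite ler_wpM2r.
have : e1 * `|k| <= e / 8 * `|k| by rewrite ler_wpM2r.
have := mulr_ge0 (ltW e0) h0; have := mulr_ge0 (ltW e0) k0.
move: E1 E2; rewrite subr0; lra.
Qed.

(** This is [2 * pi] times the mean of f on the circle, that is, the integral of f(w) dw / (iw).
    With this weight, Cauchy's theorem on an annulus says that [cint f s] does not depend on [s]. *)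
Definition cint f s : CC R :=
  Complex (Int (fun t => complex.Re (f (circ s t) : R[i])) 0 (2 * pi))
          (Int (fun t => complex.Im (f (circ s t) : R[i])) 0 (2 * pi)).

Definition circ_continuous f s :=
  forall z, absC z = s -> {for z, continuous f}.

Lemma circ_continuous_comp f s : 0 <= s -> circ_continuous f s ->
  continuous (fun t => f (circ s t)).
Proof.
move=> s0 cf t; apply: continuous_comp; first exact: continuous_circ.
exact/cf/absC_circ.
Qed.

Lemma circ_continuous_Re f s : 0 <= s -> circ_continuous f s ->
  continuous (fun t => complex.Re (f (circ s t) : R[i])).
Proof.
move=> s0 cf t; apply: (@continuous_comp _ _ _ (fun t => f (circ s t)) (fun w : CC R => complex.Re (w : R[i]))).
  exact: circ_continuous_comp.
exact: continuous_Re.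
Qed.

Lemma circ_continuous_Im f s : 0 <= s -> circ_continuous f s ->
  continuous (fun t => complex.Im (f (circ s t) : R[i])).
Proof.
move=> s0 cf t; apply: (@continuous_comp _ _ _ (fun t => f (circ s t)) (fun w : CC R => complex.Im (w : R[i]))).
  exact: circ_continuous_comp.
exact: continuous_Im.
Qed.

Let pi2 : 0 <= 2 * pi :> R.
Proof. by rewrite mulr_ge0// pi_ge0. Qed.

Lemma eq_cint f g s : 0 <= s -> (forall z, absC z = s -> f z = g z) -> cint f s = cint g s.
Proof.
move=> s0 H; rewrite /cint; congr (Complex (Int _ _ _) (Int _ _ _));
  by apply/funext => t; rewrite H// absC_circ.
Qed.

Lemma cintB f g s : 0 <= s -> circ_continuous f s -> circ_continuous g s ->
  cint (fun z => f z - g z) s = cint f s - cint g s.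
Proof.
move=> s0 cf cg; rewrite /cint; apply/eqP; rewrite eq_complex /=; apply/andP; split; apply/eqP.
- rewrite -IntB//; first by congr Int; apply/funext => t; rewrite raddfB.
  + exact: circ_continuous_Re.
  + exact: circ_continuous_Re.
- rewrite -IntB//; first by congr Int; apply/funext => t; rewrite raddfB.
  + exact: circ_continuous_Im.
  + exact: circ_continuous_Im.
Qed.

Lemma cintZ (c : CC R) f s : 0 <= s -> circ_continuous f s ->
  cint (fun z => c * f z) s = c * cint f s.
Proof.
move=> s0 cf; rewrite /cint; case: c => a b; apply/eqP; rewrite eq_complex /=.
have c1 := circ_continuous_Re s0 cf; have c2 := circ_continuous_Im s0 cf.
have k1 (k : R) : continuous (fun t => k * complex.Re (f (circ s t) : R[i])).
  by move=> t; apply: cvgM; [exact: cvg_cst|exact: c1].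
have k2 (k : R) : continuous (fun t => k * complex.Im (f (circ s t) : R[i])).
  by move=> t; apply: cvgM; [exact: cvg_cst|exact: c2].
apply/andP; split; apply/eqP; rewrite -!IntZ//.
- rewrite -IntB//; congr Int; apply/funext => t; by case: (f (circ s t)).
- rewrite -IntD//; congr Int; apply/funext => t; by case: (f (circ s t)).
Qed.

Lemma cint_cst (c : CC R) s : cint (fun=> c) s = c * reC (2 * pi).
Proof.
have H (k : R) : Int (fun=> k) 0 (2 * pi) = k * (2 * pi).
  have [|x _ ->] := @Int_MVT R (fun=> k) 0 (2 * pi) pi2.
    by move=> ?; exact: cst_continuous.
  by rewrite subr0.
rewrite /cint !H; case: c => a b; apply/eqP; rewrite eq_complex /=.
by apply/andP; split; apply/eqP; ring.
Qed.

(** The constant is [4 * pi] because real and imaginary parts are estimated separately by the mean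
    value theorem, each contributing [2 * pi * B]. *)
Lemma absC_cint f s (B : R) : 0 <= s -> circ_continuous f s ->
  (forall t, 0 <= t <= 2 * pi -> absC (f (circ s t)) <= B) ->
  absC (cint f s) <= 4 * pi * B.
Proof.
move=> s0 cf H; apply: le_trans (absC_sum_le _) _ => /=.
have [t1 h1 ->] := Int_MVT pi2 (circ_continuous_Re s0 cf).
have [t2 h2 ->] := Int_MVT pi2 (circ_continuous_Im s0 cf).
rewrite subr0 !(normrM _ (2 * pi)) (ger0_norm pi2) -mulrDl.
have -> : 4 * pi * B = (B + B) * (2 * pi) by ring.
rewrite ler_wpM2r// lerD//.
  exact: le_trans (absC_Re _) (H _ h1).
exact: le_trans (absC_Im _) (H _ h2).
Qed.

Lemma absC_cint_le f s (B : R) : 0 <= s -> circ_continuous f s ->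
  (forall z, absC z = s -> absC (f z) <= B) -> absC (cint f s) <= 4 * pi * B.
Proof. by move=> s0 cf H; apply: absC_cint => // t _; apply: H; exact: absC_circ. Qed.

(** Compactness of [[0, 2 * pi]], in the form of a near-covering, makes f at radius [s'] close to f
    at radius [s] uniformly in the angle. *)
Lemma cint_continuous f s d : 0 < s -> 0 < d ->
  (forall z, s - d < absC z < s + d -> {for z, continuous f}) ->
  forall e, 0 < e -> exists2 d', 0 < d' & forall s', `|s' - s| < d' ->
    absC (cint f s' - cint f s) <= 4 * pi * e.
Proof.
move=> s0 d0 cf e e0.
have : near_covering (`[0, 2 * pi] : set R).
  by apply/compact_near_coveringP; exact: segment_compact.
move=> /(_ R (nbhs s) (fun s' t => absC (f (circ s' t) - f (circ s t)) < e)).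
have cs t : {for (s, t), continuous (fun p : R * R => circ p.1 p.2)}.
  have c1 : {for (s, t), continuous (fun p : R * R => p.1)} by exact: cvg_fst.
  have c2 : {for (s, t), continuous (fun p : R * R => cos p.2)}.
    by apply: (@continuous_comp _ _ _ snd cos); [exact: cvg_snd|exact: continuous_cos].
  have c3 : {for (s, t), continuous (fun p : R * R => sin p.2)}.
    by apply: (@continuous_comp _ _ _ snd sin); [exact: cvg_snd|exact: continuous_sin].
  exact: (continuous_Complex (cvgM c1 c2) (cvgM c1 c3)).
have H t : \forall t' \near t & s' \near s, absC (f (circ s' t') - f (circ s t')) < e.
  have e2 : 0 < e / 2 by rewrite divr_gt0.
  have /continuousCP/(_ _ e2) : {for (s, t), continuous (fun p : R * R => f (circ p.1 p.2))}.
    apply: (@continuous_comp _ _ _ (fun p : R * R => circ p.1 p.2) f); first exact: cs.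
    by apply: cf; rewrite absC_circ ?(ltW s0)//= ltrBlDr !ltrDl d0.
  case=> -[A1 A2] /= [N1 N2] HA.
  exists (A2, A1) => /=; first by split.
  move=> [t' s'] /= [h1 h2].
  have N1s : A1 s by exact: nbhs_singleton N1.
  have {}h2 := HA (s', t') (conj h2 h1); have h3 := HA (s, t') (conj N1s h1).
  rewrite /= in h2 h3.
  apply: le_lt_trans (absC_triangle (f (circ s t)) _ _) _.
  by rewrite (splitr e) ltrD// absCBC.
move=> /(_ _ (fun t _ => H t)) /nbhs_ballP[d1 /= d10 H1].
exists (Num.min (Num.min d1 d) s); first by rewrite !lt_min d10 d0.
move=> s'; rewrite !lt_min => /andP[/andP[h1 h2] h3].
have s'0 : 0 <= s' by move: h3 => /ltr_normlP[]; lra.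
have c1 : circ_continuous f s'.
  by move=> z zs; apply: cf; rewrite zs; move: h2 => /ltr_normlP[]; lra.
have c2 : circ_continuous f s.
  by move=> z zs; apply: cf; rewrite zs; lra.
have key t : 0 <= t <= 2 * pi -> absC (f (circ s' t) - f (circ s t)) <= e.
  move=> ht; apply: ltW; apply: H1; first by rewrite /ball /= distrC.
  by rewrite /= in_itv.
apply: le_trans (absC_sum_le _) _ => /=.
rewrite -!IntB//.
- have [|t1 k1 ->] := @Int_MVT R (fun t => complex.Re (f (circ s' t) : R[i]) - complex.Re (f (circ s t) : R[i])) _ _ pi2.
    by move=> t; apply: cvgB; [exact: circ_continuous_Re|apply: circ_continuous_Re => //; exact: ltW].
  have [|t2 k2 ->] := @Int_MVT R (fun t => complex.Im (f (circ s' t) : R[i]) - complex.Im (f (circ s t) : R[i])) _ _ pi2.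
    by move=> t; apply: cvgB; [exact: circ_continuous_Im|apply: circ_continuous_Im => //; exact: ltW].
  rewrite -!raddfB subr0 !(normrM _ (2 * pi)) (ger0_norm pi2) -mulrDl.
  have -> : 4 * pi * e = (e + e) * (2 * pi) by ring.
  rewrite ler_wpM2r// lerD//.
    exact: le_trans (absC_Re _) (key _ k1).
  exact: le_trans (absC_Im _) (key _ k2).
- exact: circ_continuous_Im.
- by apply: circ_continuous_Im => //; exact: ltW.
- exact: circ_continuous_Re.
- by apply: circ_continuous_Re => //; exact: ltW.
Qed.

End CircleMean.

(** * Cauchy's theorem for circle means *)

Section CirclePath.
Variable R : realType.
Implicit Types (z w : CC R) (s t x y : R) (f g : CC R -> CC R).

(** Chain rule for f(exp(x + iy)): the derivative is [l] times the point of the circle, and its real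
    and imaginary parts will be the Cauchy-Riemann coefficients. *)
Lemma polar_approx f x y l : is_cderiv f (circ (expR x) y) l ->
  forall e, 0 < e -> exists2 d, 0 < d & forall h k, `|h| < d -> `|k| < d ->
    absC (f (circ (expR (x + h)) (y + k)) - f (circ (expR x) y)
          - l * circ (expR x) y * Complex h k) <= e * (`|h| + `|k|).
Proof.
set z := circ (expR x) y => H e e0.
have Z0 := absC_ge0 z; have L0 := absC_ge0 l.
set q := absC z + absC l * absC z + 1.
have LZ : 0 <= absC l * absC z by rewrite mulr_ge0.
have q0 : 0 < q by rewrite /q; lra.
have [e1 [e10 e11 e12]] : exists e1, [/\ 0 < e1, e1 <= 1 & 2 * e1 * q <= e].
  exists (Num.min 1 (e / (2 * q))); split.
  - by rewrite lt_min ltr01 divr_gt0// mulr_gt0.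
  - by rewrite ge_min lexx.
  - rewrite mulrAC -ler_pdivlMl ?mulr_gt0// [leRHS]mulrC.
    by rewrite ge_min lexx orbT.
have [d1 d10 H1] := H _ e10.
have [d2 d20 H2] := expR_circ_approx e10.
pose d3 := d1 / (4 * (absC z + 1)).
have d30 : 0 < d3 by rewrite divr_gt0// mulr_gt0// ltr_wpDl.
exists (Num.min d2 d3); first by rewrite lt_min d20.
move=> h k; rewrite !lt_min => /andP[hd2 hd3] /andP[kd2 kd3].
have {}H2 := H2 h k hd2 kd2.
rewrite circ_expRD -/z; set E := circ (expR h) k in H2 *.
set v := Complex h k in H2 *.
have V : absC v <= `|h| + `|k| by exact: absC_sum_le.
have h0 := normr_ge0 h; have k0 := normr_ge0 k; set n := `|h| + `|k| in V H2 *.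
have n0 : 0 <= n by rewrite addr_ge0.
have E1 : absC (E - 1) <= 2 * n.
  have := absCD (E - 1 - v) v; rewrite subrK.
  have : e1 * n <= 1 * n by rewrite ler_wpM2r.
  by lra.
have nd : n < 2 * d3 by rewrite /n; lra.
have D : absC (z * (E - 1)) < d1.
  rewrite absCM.
  apply: le_lt_trans (_ : absC z * (2 * n) < _); first by rewrite ler_wpM2l.
  apply: le_lt_trans (_ : (absC z + 1) * (2 * n) < _).
    by rewrite ler_wpM2r ?mulr_ge0// lerDl.
  have -> : d1 = (absC z + 1) * (4 * d3).
    by rewrite /d3; field; lra.
  by rewrite ltr_pM2l; lra.
have {H1 D} := H1 _ D; have -> : z + z * (E - 1) = z * E by ring.
rewrite absCM => H1.
have -> : f (z * E) - f z - l * z * v =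
    (f (z * E) - f z - l * (z * (E - 1))) + l * z * (E - 1 - v) by ring.
apply: le_trans (absCD _ _) _; rewrite !absCM.
apply: le_trans (lerD H1 (_ : _ <= absC l * absC z * (e1 * n))) _.
  by rewrite ler_wpM2l.
have : e1 * (absC z * absC (E - 1)) <= e1 * (absC z * (2 * n)).
  by rewrite ler_wpM2l ?(ltW e10)// ler_wpM2l.
have : 2 * e1 * q * n <= e * n by rewrite ler_wpM2r.
have := mulr_ge0 (mulr_ge0 LZ (ltW e10)) n0.
have := mulr_ge0 (ltW e10) n0.
by rewrite /q; lra.
Qed.

Lemma cint_const_Re f s1 s2 : 0 < s1 -> s1 <= s2 ->
  (forall z, s1 <= absC z <= s2 -> derivable f z 1) ->
  complex.Re (cint f s1 : R[i]) = complex.Re (cint f s2 : R[i]).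
Proof.
move=> s10 s12 df.
have s20 : 0 < s2 by rewrite (lt_le_trans s10).
pose a := ln s1; pose b := ln s2.
have ea : expR a = s1 by rewrite lnK.
have eb : expR b = s2 by rewrite lnK.
have ab : a <= b by rewrite -ler_expR ea eb.
(* Clamping to [[a, b]] makes [U] and [V] continuous everywhere, as [goursat] requires, while f is
   only controlled on the annulus. *)
pose cl x := Num.max a (Num.min x b).
have cl_in x : a <= cl x <= b.
  by rewrite /cl le_max lexx /= ge_max ab ge_min lexx orbT.
have clE x : a <= x <= b -> cl x = x.
  move=> /andP[h1 h2]; rewrite /cl; apply/eqP; rewrite eq_le le_max ge_max h1.
  by rewrite le_min lexx h2 ge_min lexx orbT.
have eE x : 0 <= expR x by exact: expR_ge0.
have dcl x z : absC z = expR (cl x) -> derivable f z 1.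
  by move=> E; apply: df; rewrite E -ea -eb !ler_expR.
have ccl x : circ_continuous f (expR (cl x)).
  by move=> z /dcl/derivableC_continuous.
pose U x y := complex.Re (f (circ (expR (cl x)) y) : R[i]).
pose V x y := complex.Im (f (circ (expR (cl x)) y) : R[i]).
have cU x : continuous (U x) by exact: circ_continuous_Re.
have ccont : continuous cl.
  move=> x; apply: (@continuous_max _ _ (fun=> a) (fun x => Num.min x b)).
    exact: cst_continuous.
  by apply: (@continuous_min _ _ id (fun=> b)) => //; exact: cst_continuous.
have cV y : continuous (V^~ y).
  move=> x; rewrite /V.
  apply: (@continuous_comp _ _ _ (fun x => f (circ (expR (cl x)) y)) (fun w : CC R => complex.Im (w : R[i]))); last exact: continuous_Im.
  apply: (@continuous_comp _ _ _ (fun x => circ (expR (cl x)) y) f); last first.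
    by apply: ccl; rewrite absC_circ.
  have ce : {for x, continuous (fun x => expR (cl x))}.
    by apply: continuous_comp; [exact: ccont|exact: continuous_expR].
  apply: (@continuous_Complex _ _ (fun x => expR (cl x) * cos y) (fun x => expR (cl x) * sin y));
    by apply: cvgM; [exact: ce|exact: cvg_cst].
have pi2 : 0 <= 2 * pi :> R by rewrite mulr_ge0// pi_ge0.
have := @goursat R U V cU cV a b 0 (2 * pi) ab pi2.
rewrite /rect_int.
have -> : V^~ (2 * pi) = V^~ 0.
  apply/funext => x; rewrite /V; congr (complex.Im (f _ : R[i])).
  by rewrite /circ mulr_natl cos2pi sin2pi cos0 sin0.
rewrite subrr addr0 /U !clE ?lexx ?ab// ea eb => G; apply/esym/eqP.
rewrite -subr_eq0; apply/eqP/G => x y xab _.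
have dz : derivable f (circ (expR x) y) 1.
  by apply: (dcl x); rewrite clE// absC_circ.
have [l Hl] := (derivable_cderiv f _).1 dz.
case E : (l * circ (expR x) y) => [A B]; exists A, B => e e0.
have [d d0 Hd] := polar_approx Hl e0; exists d => // x' y' x'ab _ hx hy.
have := Hd _ _ hx hy; rewrite E /V !clE// addrCA subrr addr0 addrCA subrr addr0.
set D := (X in absC X) => HD; split.
  by apply: le_trans HD; apply: le_trans (absC_Re _); rewrite /D !raddfB.
by apply: le_trans HD; apply: le_trans (absC_Im _); rewrite /D !raddfB /= (addrC (B * _)).
Qed.

Lemma cint_const f s1 s2 : 0 < s1 -> s1 <= s2 ->
  (forall z, s1 <= absC z <= s2 -> derivable f z 1) ->
  cint f s1 = cint f s2.
Proof.
move=> s10 s12 df.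
have s20 : 0 < s2 by rewrite (lt_le_trans s10).
have cf s : s1 <= s <= s2 -> circ_continuous f s.
  by move=> h z zs; apply: derivableC_continuous; apply: df; rewrite zs.
apply/eqP; rewrite eq_complex; apply/andP; split; apply/eqP.
  exact: cint_const_Re.
(* The real part of -i f is the imaginary part of f. *)
have := @cint_const_Re (fun z => - imC R * f z) s1 s2 s10 s12.
rewrite !cintZ ?(ltW s10) ?(ltW s20)//; try by apply: cf; rewrite ?lexx ?s12.
case: (cint f s1) => a1 b1; case: (cint f s2) => a2 b2 /=.
rewrite !oppr0 !mul0r !sub0r !mulN1r !opprK => H.
by apply: H => z /df h; apply: derivableCM; [exact: derivableC_cst|exact: h].
Qed.

(** The mean is constant on the punctured disc, and on small circles it is bounded by values of f
    near [f 0 = 0]. *)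
Lemma cint_punctured f rho : {for 0, continuous f} -> f 0 = 0 ->
  (forall z, 0 < absC z < rho -> derivable f z 1) ->
  forall s, 0 < s < rho -> cint f s = 0.
Proof.
move=> /continuousCP c0 f0 df s /andP[s0 sr].
have cf s' : 0 < s' <= s -> circ_continuous f s'.
  move=> /andP[h1 h2] z zs; apply: derivableC_continuous; apply: df.
  by rewrite zs h1 (le_lt_trans h2).
apply/eqP; rewrite -absC_eq0 -normr_le0 ger0_norm ?absC_ge0//.
apply/ler_addgt0Pr => e e0; rewrite add0r.
have p0 : 0 < 4 * pi :> R by rewrite mulr_gt0// pi_gt0.
have /nbhsCP[d d0 Hd] := c0 _ (divr_gt0 e0 p0).
pose s' := Num.min s (d / 2).
have s'0 : 0 < s' by rewrite lt_min s0 divr_gt0.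
have s's : s' <= s by rewrite ge_min lexx.
have s'd : s' < d.
  by rewrite (@le_lt_trans _ _ (d / 2))// ?ge_min ?lexx ?orbT//; lra.
rewrite -(@cint_const f s' s)//; last first.
  by move=> z /andP[h1 h2]; apply: df; rewrite (lt_le_trans s'0)// (le_lt_trans h2).
have -> : e = 4 * pi * (e / (4 * pi)) by rewrite [RHS]mulrC divfK// gt_eqF.
apply: absC_cint_le; [exact: ltW|by apply: cf; rewrite s'0|].
by move=> z zs; have := Hd z; rewrite f0 !subr0 zs => /(_ s'd)/ltW.
Qed.

Definition quot f z (l : CC R) w : CC R :=
  if w == z then l else (f w - f z) / (w - z).

Lemma quot_continuous f z l : is_cderiv f z l -> {for z, continuous (quot f z l)}.
Proof.
move=> H; apply/continuousCP => e e0; apply/nbhsCP.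
have [d d0 Hd] := H (e / 2) (divr_gt0 e0 (ltr0Sn _ _)).
exists d => // w wd; rewrite /quot eqxx; case: (eqVneq w z) => [|wz].
  by rewrite subrr absC0.
have := Hd _ wd; rewrite addrCA subrr addr0.
rewrite -ler_pdivrMr ?absC_gt0 ?subr_eq0// -absCf => h.
have -> : (f w - f z) / (w - z) - l = (f w - f z - l * (w - z)) / (w - z).
  by rewrite [RHS]mulrBl mulfK// subr_eq0.
by apply: le_lt_trans h _; lra.
Qed.

Lemma near_neqC z w : w != z -> \forall u \near w, u != z.
Proof.
move=> wz; apply/nbhsCP; exists (absC (w - z)); first by rewrite absC_gt0 subr_eq0.
by move=> u; apply: contraTneq => ->; rewrite absCBC ltxx.
Qed.

Lemma quot_derivable f z l w : w != z -> derivable f w 1 ->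
  derivable (quot f z l) w 1.
Proof.
move=> wz df.
have : derivable (fun u => (f u - f z) / (u - z)) w 1.
  apply: derivableCM; first by apply: derivableCB; [exact: df|exact: derivableC_cst].
  apply: derivableCV; first by rewrite subr_eq0.
  by apply: derivableCB; [exact: derivableC_id|exact: derivableC_cst].
apply: near_eq_derivableC.
by apply: filterS (near_neqC wz) => u uz; rewrite /quot (negbTE uz).
Qed.

(* No removable singularity theorem is needed: the mean over |w| = s is constant
   for s on either side of |z|, continuous at s = |z|, and tends to 0 with s. *)
Lemma cauchy_quot f rho z l : (forall w, absC w < rho -> derivable f w 1) ->
  is_cderiv f z l -> forall s, absC z < s < rho ->
  cint (fun w => w * quot f z l w) s = 0.
Proof.
move=> df dz s /andP[zs sr].
set G := fun w => _.
have dG w : absC w < rho -> w != z -> derivable G w 1.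
  move=> wr wz; apply: derivableCM; first exact: derivableC_id.
  by apply: quot_derivable => //; exact: df.
have cG w : absC w < rho -> {for w, continuous G}.
  move=> wr; have [->|wz] := eqVneq w z; last exact/derivableC_continuous/dG.
  by apply: continuousCM; [exact: cvg_id|exact: quot_continuous].
have r0 : 0 < rho by rewrite (le_lt_trans (absC_ge0 z))// (lt_trans zs).
have G0 : G 0 = 0 by rewrite /G mul0r.
have c0 : {for 0, continuous G} by apply: cG; rewrite absC0.
have nz w : absC w != absC z -> w != z by apply: contraNneq => ->.
(* When the exceptional point is the centre there is no inner annulus, and [cint_punctured] applies
   directly. *)
have [z0|z0] := eqVneq z 0.
  apply: (@cint_punctured G rho c0 G0); last by rewrite sr andbT (le_lt_trans (absC_ge0 z)).
  by move=> w /andP[h1 h2]; apply: dG; [exact: h2|rewrite z0 -absC_gt0].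
have z0' : 0 < absC z by rewrite absC_gt0.
have H1 t : 0 < t < absC z -> cint G t = 0.
  apply: (cint_punctured c0 G0) => w /andP[h1 h2].
  by apply: dG; [exact: lt_trans h2 (lt_trans zs sr)|apply: nz; rewrite lt_eqF].
have H2 t : absC z < t < s -> cint G t = cint G s.
  move=> /andP[h1 h2]; apply: cint_const; [exact: lt_trans h1|exact: ltW|].
  move=> w /andP[h3 h4]; apply: dG; first exact: le_lt_trans sr.
  by apply: nz; rewrite gt_eqF// (lt_le_trans h1).
have p0 : 0 < 4 * pi :> R by rewrite mulr_gt0// pi_gt0.
have z1 : 0 < s - absC z by lra.
have cG' w : absC z - (s - absC z) < absC w < absC z + (s - absC z) ->
    {for w, continuous G}.
  by move=> /andP[_ h]; apply: cG; lra.
have cnt := @cint_continuous R G (absC z) (s - absC z) z0' z1 cG'.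
apply/eqP; rewrite -absC_eq0 -normr_le0 ger0_norm ?absC_ge0//.
apply/ler_addgt0Pr => e e0; rewrite add0r.
(* The value at radius |z| is compared once with a smaller and once with a larger radius; each
   comparison costs [4 * pi * (e / (8 * pi)) = e / 2]. *)
have [|d d0 Hd] := cnt (e / (8 * pi)).
  by rewrite divr_gt0// mulr_gt0// pi_gt0.
pose k := Num.min (d / 2) (Num.min (absC z / 2) ((s - absC z) / 2)).
have k0 : 0 < k by rewrite !lt_min !divr_gt0.
have kd : k < d.
  by rewrite (@le_lt_trans _ _ (d / 2))// ?ge_min ?lexx ?orbT//; lra.
have kz : k < absC z.
  by rewrite (@le_lt_trans _ _ (absC z / 2))// ?ge_min ?lexx ?orbT//; lra.
have ks : k < s - absC z.
  by rewrite (@le_lt_trans _ _ ((s - absC z) / 2))// ?ge_min ?lexx ?orbT//; lra.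
have a1 := Hd (absC z - k); have a2 := Hd (absC z + k).
rewrite addrAC subrr add0r normrN gtr0_norm// in a1.
rewrite addrAC subrr add0r gtr0_norm// in a2.
move: (a1 kd) (a2 kd); rewrite (H1 (absC z - k)); last by lra.
rewrite (H2 (absC z + k)); last by lra.
have -> : 4 * pi * (e / (8 * pi)) = e / 2.
  by have := pi_gt0 R; move: (pi : R) => P P0; field; rewrite gt_eqF.
move=> b1 b2; have := absC_triangle (cint G (absC z)) (cint G s) 0; rewrite subr0 => h.
by rewrite absCBC in b1; lra.
Qed.

End CirclePath.

(** * Cauchy's formula and the remainder of the power series *)

Section CauchyFormula.
Variable R : realType.
Implicit Types (z w : CC R) (s t x y : R) (f g : CC R -> CC R).

Lemma absC_sub_neq z w : absC z < absC w -> w - z != 0.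
Proof. by rewrite subr_eq0; apply: contraTneq => ->; rewrite ltxx. Qed.

Lemma derivable_kernel z w : absC z < absC w ->
  derivable (fun w => w / (w - z)) w 1.
Proof.
move=> zw; apply: derivableCM; first exact: derivableC_id.
apply: derivableCV; first exact: absC_sub_neq.
by apply: derivableCB; [exact: derivableC_id|exact: derivableC_cst].
Qed.

(** The kernel is holomorphic outside the closed disc of radius |z|, so its mean can be computed on
    arbitrarily large circles, where the kernel tends to 1. *)
Lemma cint_kernel z s : absC z < s -> cint (fun w => w / (w - z)) s = reC (2 * pi).
Proof.
move=> zs; have z0 := absC_ge0 z.
have s0 : 0 < s by exact: le_lt_trans zs.
have p0 : 0 < pi :> R by exact: pi_gt0.
have cK t : s <= t -> circ_continuous (fun w => w / (w - z)) t.
  move=> st w wt; apply/derivableC_continuous/derivable_kernel.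
  by rewrite wt (lt_le_trans zs).
apply/eqP; rewrite -subr_eq0 -absC_eq0 -normr_le0 ger0_norm ?absC_ge0//.
apply/ler_addgt0Pr => e e0; rewrite add0r.
(* On the circle of radius [t], |w - z| is at least [4 * pi * absC z / e], so the kernel differs
   from 1 by at most [e / (4 * pi)]. *)
set t := s + 4 * pi * absC z / e.
have q0 : 0 <= 4 * pi * absC z / e by rewrite divr_ge0 ?(ltW e0)// !mulr_ge0// ltW.
have st : s <= t by rewrite lerDl.
have t0 : 0 <= t by rewrite (le_trans _ st)// ltW.
rewrite (@cint_const _ _ s t s0 st); last first.
  by move=> w /andP[h _]; apply: derivable_kernel; rewrite (lt_le_trans zs).
have -> : reC (2 * pi) = cint (fun=> 1) t :> CC R by rewrite cint_cst mul1r.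
have c1 : circ_continuous (fun _ : CC R => 1) t by move=> w _; exact: cst_continuous.
rewrite -(cintB t0 (cK t st) c1).
have -> : e = 4 * pi * (e / (4 * pi)).
  by move: p0; move: (pi : R) => P P0; field; rewrite gt_eqF.
apply: (absC_cint_le t0).
  move=> w wt; apply: derivableC_continuous; apply: derivableCB; last exact: derivableC_cst.
  by apply: derivable_kernel; rewrite wt (lt_le_trans zs).
move=> w wt; have wz : absC z < absC w by rewrite wt (lt_le_trans zs).
have wz0 := absC_sub_neq wz.
have -> : w / (w - z) - 1 = z / (w - z).
  by rewrite -(divff wz0) -mulrBl opprB addrCA subrr addr0.
rewrite absCf ler_pdivrMr ?absC_gt0//.
have := absC_lB w z; rewrite wt => h.
have h2 : 4 * pi * absC z / e <= absC (w - z) by rewrite (le_trans _ h)// /t; lra.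
rewrite mulrAC ler_pdivlMr ?mulr_gt0//; rewrite ler_pdivrMr// in h2.
by rewrite mulrC (mulrC e).
Qed.

(** On the circle, the integrand of [cauchy_quot] is the difference of f(w) and f(z), each times the
    kernel; [cint_kernel] evaluates the second term. *)
Lemma cauchy_formula f rho z s : (forall w, absC w < rho -> derivable f w 1) ->
  absC z < s < rho ->
  f z * reC (2 * pi) = cint (fun w => f w * (w / (w - z))) s.
Proof.
move=> df /andP[zs sr].
have s0 : 0 <= s by rewrite (le_trans (absC_ge0 z))// ltW.
have [l Hl] := (derivable_cderiv f z).1 (df z (lt_trans zs sr)).
have := cauchy_quot df Hl (introT andP (conj zs sr)).
have zw w : absC w = s -> absC z < absC w by move=> ->.
have dF w : absC w = s -> derivable (fun w => f w * (w / (w - z))) w 1.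
  move=> ws; apply: derivableCM; first by apply: df; rewrite ws.
  by apply: derivable_kernel; exact: zw.
have cF : circ_continuous (fun w => f w * (w / (w - z))) s.
  by move=> w ws; apply: derivableC_continuous; exact: dF.
have cK : circ_continuous (fun w => w / (w - z)) s.
  by move=> w ws; apply: derivableC_continuous; apply: derivable_kernel; exact: zw.
have cK' : circ_continuous (fun w => f z * (w / (w - z))) s.
  move=> w ws; apply: derivableC_continuous; apply: derivableCM.
    exact: derivableC_cst.
  by apply: derivable_kernel; exact: zw.
rewrite (@eq_cint _ _ (fun w => f w * (w / (w - z)) - f z * (w / (w - z))) _ s0).
  rewrite (cintB s0 cF cK') (cintZ _ s0 cK) (cint_kernel zs).
  by move/eqP; rewrite subr_eq0 => /eqP.
move=> w ws; rewrite /quot; have := absC_sub_neq (zw _ ws); rewrite subr_eq0 => /negbTE ->.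
by ring.
Qed.

(** The coefficient [a n] is the mean of f(w) / w^n. Expanding the kernel by a finite geometric sum
    leaves as exact remainder the mean of f(w) (w / (w - z)) (z / w)^N. The factor 2 is the ratio of
    the [4 * pi] of [absC_cint] to [2 * pi]. *)
Lemma cauchy_series f rho s (B : R) :
  (forall w, absC w < rho -> derivable f w 1) -> 0 < s < rho ->
  (forall t, 0 <= t <= 2 * pi -> absC (f (circ s t)) <= B) ->
  exists a : nat -> CC R, (forall n, absC (a n) <= 2 * B / s ^+ n) /\
    forall z, absC z < s -> forall N,
      absC (f z - \sum_(n < N) a n * z ^+ n)
        <= 2 * B * (s / (s - absC z)) * (absC z / s) ^+ N.
Proof.
move=> df /andP[s0 sr] HB; have s0' := ltW s0.
have p0 : 0 < pi :> R by exact: pi_gt0.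
have dfs w : absC w = s -> derivable f w 1 by move=> ws; apply: df; rewrite ws.
have w0 w : absC w = s -> w != 0 by move=> ws; rewrite -absC_gt0 ws.
have B0 : 0 <= B.
  by rewrite (le_trans (absC_ge0 (f (circ s 0))))// HB// lexx mulr_ge0// ltW.
pose c : CC R := reC (2 * pi).
have cE : absC c = 2 * pi by rewrite absC_reC ger0_norm// mulr_ge0// ltW.
have c0 : c != 0 by rewrite -absC_gt0 cE mulr_gt0.
pose b n w := f w * (w^-1) ^+ n.
have db n w : absC w = s -> derivable (b n) w 1.
  move=> ws; apply: derivableCM; first exact: dfs.
  apply: derivableCX; apply: derivableCV; first exact: w0.
  exact: derivableC_id.
have cb n : circ_continuous (b n) s.
  by move=> w ws; apply: derivableC_continuous; exact: db.
have mean_le h (D : R) : circ_continuous h s -> (forall t, 0 <= t <= 2 * pi -> absC (h (circ s t)) <= D) ->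
    absC (c^-1 * cint h s) <= 2 * D.
  move=> ch hD; rewrite absCM absCV cE ler_pdivrMl ?mulr_gt0//.
  have -> : 2 * pi * (2 * D) = 4 * pi * D by ring.
  exact: absC_cint.
exists (fun n => c^-1 * cint (b n) s); split=> [n|z zs N].
  rewrite -mulrA; apply: (mean_le _ _ (cb n)) => t ht.
  have ws := absC_circ t s0'; have {ht} := HB t ht; move: (circ s t) ws => w ws fw.
  by rewrite /b absCM absCX absCV ws exprVn ler_wpM2r// invr_ge0 exprn_ge0.
have zw w : absC w = s -> absC z < absC w by move=> ->.
pose h N w := f w * (w / (w - z)) * (z * w^-1) ^+ N.
have dh M w : absC w = s -> derivable (h M) w 1.
  move=> ws; apply: derivableCM.
    apply: derivableCM; first exact: dfs.
    by apply: derivable_kernel; exact: zw.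
  apply: derivableCX; apply: derivableCM; first exact: derivableC_cst.
  by apply: derivableCV; [exact: w0|exact: derivableC_id].
have ch M : circ_continuous (h M) s.
  by move=> w ws; apply: derivableC_continuous; exact: dh.
have -> : f z - \sum_(n < N) c^-1 * cint (b n) s * z ^+ n = c^-1 * cint (h N) s.
  elim: N => [|N ih].
    rewrite big_ord0 subr0 -[LHS](mulfK c0) (@cauchy_formula f rho z s df) ?zs//.
    rewrite mulrC; congr (_ * _); apply: (eq_cint s0') => w _.
    by rewrite /h expr0 mulr1.
  rewrite big_ord_recr /= opprD addrA ih -mulrA -mulrBr; congr (_ * _).
  have cZ : circ_continuous (fun w => z ^+ N * b N w) s.
    move=> w ws; apply: derivableC_continuous; apply: derivableCM; first exact: derivableC_cst.
    exact: db.
  rewrite mulrC -(cintZ (z ^+ N) s0' (cb N)) -(cintB s0' (ch N) cZ).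
  apply: (eq_cint s0') => w ws; rewrite /h /b exprS exprMn.
    have := absC_sub_neq (zw _ ws); have := w0 _ ws; set v := w^-1 => v0 vz.
    have wv : w * v = 1 by rewrite divff.
    have -> : f w * (w / (w - z)) * (z ^+ N * v ^+ N) - z ^+ N * (f w * v ^+ N) =
       f w * v ^+ N * z ^+ N * (w / (w - z) - 1) by ring.
    have -> : w / (w - z) - 1 = z / (w - z).
      by rewrite -(divff vz) -mulrBl opprB addrCA subrr addr0.
    transitivity (f w * v ^+ N * z ^+ N * z * (w * v) / (w - z)); last by ring.
    by rewrite wv; ring.
have -> : 2 * B * (s / (s - absC z)) * (absC z / s) ^+ N =
  2 * (B * (s / (s - absC z)) * (absC z / s) ^+ N) by ring.
apply: (mean_le _ _ (ch N)) => t ht.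
have ws := absC_circ t s0'; have {ht} := HB t ht; move: (circ s t) ws => w ws fw.
rewrite /h !absCM absCX absCM !absCV ws ler_wpM2r ?exprn_ge0 ?divr_ge0 ?absC_ge0//.
rewrite ler_pM ?divr_ge0 ?absC_ge0//.
rewrite ler_wpM2l// lef_pV2 ?posrE ?subr_gt0//; first by rewrite -ws; exact: absC_lB.
by rewrite absC_gt0; exact/absC_sub_neq/zw.
Qed.

End CauchyFormula.

(** * Power series: tails, uniqueness of the sum, termwise differentiation *)

Section PowerSeries.
Variable R : realType.
Implicit Types (z w k : CC R) (s t x y C : R) (a u : nat -> CC R).

Lemma le_geometric x b C (q : R) : 0 <= q < 1 ->
  (forall N, x <= b + C * q ^+ N) -> x <= b.
Proof.
move=> /andP[q0 q1] H; apply/ler_addgt0Pr => e e0.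
have [|N /(_ N (leqnn _)) h] := @geometric_lt R q C e _ e0; first by rewrite ger0_norm.
by rewrite (le_trans (H N))// lerD2l ltW.
Qed.

Lemma sum_geometric_le C (q : R) (v : nat -> R) m n : 0 <= q < 1 -> 0 <= C ->
  (forall n, `|v n| <= C * q ^+ n) ->
  `|\sum_(m <= i < n) v i| <= C / (1 - q) * q ^+ m.
Proof.
move=> /andP[q0 q1] C0 H.
have q' : 0 < 1 - q by rewrite subr_gt0.
have K0 : 0 <= C / (1 - q) by rewrite divr_ge0// ltW.
have [mn|/ltnW nm] := leqP m n; last by rewrite big_geq// normr0 mulr_ge0// exprn_ge0.
(* Keeping the term [- q ^+ n] makes the induction on [n] close with an equality. *)
suff : `|\sum_(m <= i < n) v i| <= C / (1 - q) * (q ^+ m - q ^+ n).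
  by move=> /le_trans; apply; rewrite ler_wpM2l// lerBlDr lerDl exprn_ge0.
elim: n mn => [|n ih]; first by rewrite leqn0 => /eqP ->; rewrite big_geq// normr0 subrr mulr0.
rewrite leq_eqVlt ltnS => /predU1P[->|mn]; first by rewrite big_geq// normr0 subrr mulr0.
rewrite big_nat_recr//= (le_trans (ler_normD _ _))//.
apply: le_trans (lerD (ih mn) (H n)) _; rewrite le_eqVlt; apply/orP; left; apply/eqP.
by rewrite exprS; field; rewrite gt_eqF.
Qed.

Lemma lim_geometric C (q : R) (v : nat -> R) N : 0 <= q < 1 -> 0 <= C ->
  (forall n, `|v n| <= C * q ^+ n) ->
  `|limn (series v) - \sum_(n < N) v n| <= C / (1 - q) * q ^+ N.
Proof.
move=> q01 C0 H; have /andP[q0 q1] := q01.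
have cv : cvgn (series v).
  apply: normed_cvg; apply: (series_le_cvg _ _ H).
  - by move=> n; rewrite normr_ge0.
  - by move=> n; rewrite mulr_ge0// exprn_ge0.
  - by apply/cvg_ex; eexists; apply: cvg_geometric_series; rewrite ger0_norm.
have cN : (fun n => `|series v n - \sum_(n < N) v n|) @ \oo -->
    `|limn (series v) - \sum_(n < N) v n|.
  by apply: cvg_norm; apply: cvgB; [exact: cv|exact: cvg_cst].
rewrite -(cvg_lim _ cN)//; apply: limr_le; first by apply/cvg_ex; eexists; exact: cN.
near=> n; rewrite /series /= -(big_mkord xpredT).
rewrite (@big_cat_nat _ _ _ N 0 n)//=; last by near: n; exists N.
by rewrite addrAC subrr add0r; exact: sum_geometric_le.
Unshelve. all: by end_near. Qed.

(* Only meaningful for convergent series: otherwise [lim] is a junk value. *)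
Definition csum u : CC R :=
  Complex (limn (series (fun n => complex.Re (u n : R[i]))))
          (limn (series (fun n => complex.Im (u n : R[i])))).

Lemma csum_tail u C (q : R) N : 0 <= q < 1 -> 0 <= C ->
  (forall n, absC (u n) <= C * q ^+ n) ->
  absC (csum u - \sum_(n < N) u n) <= 2 * C / (1 - q) * q ^+ N.
Proof.
move=> q01 C0 H; apply: le_trans (absC_sum_le _) _.
rewrite !raddfB !raddf_sum /= !sumrN.
have -> : 2 * C / (1 - q) * q ^+ N = C / (1 - q) * q ^+ N + C / (1 - q) * q ^+ N by ring.
apply: lerD.
  apply: (@lim_geometric C q (fun n => complex.Re (u n : R[i])) N q01 C0) => n.
  exact: le_trans (absC_Re _) (H n).
apply: (@lim_geometric C q (fun n => complex.Im (u n : R[i])) N q01 C0) => n.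
exact: le_trans (absC_Im _) (H n).
Qed.

Definition psum a z : CC R := csum (fun n => a n * z ^+ n).

Lemma psum_tail a C t z : 0 <= C -> absC z < t ->
  (forall n, absC (a n) <= C / t ^+ n) -> forall N,
  absC (psum a z - \sum_(n < N) a n * z ^+ n)
    <= 2 * C * (t / (t - absC z)) * (absC z / t) ^+ N.
Proof.
move=> C0 zt H N; have z0 := absC_ge0 z.
have t0 : 0 < t by exact: le_lt_trans zt.
have q01 : 0 <= absC z / t < 1 by rewrite divr_ge0 ?(ltW t0)// ltr_pdivrMr// mul1r.
apply: le_trans (csum_tail N q01 C0 _) _.
  move=> n; rewrite absCM absCX exprMn exprVn [leRHS]mulrCA [leRHS]mulrC.
  by rewrite ler_wpM2r ?exprn_ge0.
rewrite le_eqVlt; apply/orP; left; apply/eqP; congr (_ * _).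
by field; rewrite subr_eq0 !gt_eqF.
Qed.

(** A tail bound uniform in |z| <= r, so that the values at [z] and at [z + k] can be truncated
    together. *)
Lemma psum_tail_le a C t r z : 0 <= C -> absC z <= r -> r < t ->
  (forall n, absC (a n) <= C / t ^+ n) -> forall N,
  absC (psum a z - \sum_(n < N) a n * z ^+ n) <= 2 * C * (t / (t - r)) * (r / t) ^+ N.
Proof.
move=> C0 zr rt H N; have z0 := absC_ge0 z.
have r0 : 0 <= r by exact: le_trans zr.
have t0 : 0 < t by exact: le_lt_trans rt.
have zt : absC z < t by exact: le_lt_trans rt.
apply: le_trans (psum_tail C0 zt H N) _.
have ti : 0 <= t^-1 by rewrite invr_ge0 ltW.
rewrite -!mulrA ler_wpM2l// ler_wpM2l// ler_wpM2l ?(ltW t0)//.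
apply: ler_pM.
- by rewrite invr_ge0 subr_ge0 ltW.
- by rewrite exprn_ge0// mulr_ge0.
- by rewrite lef_pV2 ?posrE ?subr_gt0// lerD2l lerN2.
- by rewrite lerXn2r ?nnegrE ?mulr_ge0// ler_wpM2r.
Qed.

Lemma psum_unique a z (l : CC R) C (q : R) C' t : 0 <= q < 1 -> 0 <= C' -> absC z < t ->
  (forall n, absC (a n) <= C' / t ^+ n) ->
  (forall N, absC (l - \sum_(n < N) a n * z ^+ n) <= C * q ^+ N) -> l = psum a z.
Proof.
move=> /andP[q0 q1] C0 zt H HN; have z0 := absC_ge0 z.
have t0 : 0 < t by exact: le_lt_trans zt.
set q' := absC z / t.
have q'0 : 0 <= q' by rewrite divr_ge0 ?(ltW t0).
have q'1 : q' < 1 by rewrite ltr_pdivrMr// mul1r.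
set m := Num.max q q'.
have m01 : 0 <= m < 1 by rewrite le_max q0 gt_max q1.
have D0 : 0 <= 2 * C' * (t / (t - absC z)).
  by rewrite !mulr_ge0 ?invr_ge0 ?subr_ge0 ?(ltW zt) ?(ltW t0).
apply/eqP; rewrite -subr_eq0 -absC_eq0 -normr_le0 ger0_norm ?absC_ge0//.
apply: (@le_geometric _ _ (`|C| + 2 * C' * (t / (t - absC z))) _ m01) => N.
rewrite add0r mulrDl; apply: le_trans (absC_triangle (\sum_(n < N) a n * z ^+ n) _ _) _.
apply: lerD.
  apply: le_trans (HN N) _; apply: le_trans (_ : `|C| * q ^+ N <= _).
    by rewrite ler_wpM2r ?exprn_ge0// ler_norm.
  by rewrite ler_wpM2l// lerXn2r ?nnegrE// le_max ?lexx// q0.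
rewrite absCBC; apply: le_trans (psum_tail C0 zt H N) _; rewrite ler_wpM2l//.
by rewrite lerXn2r ?nnegrE// le_max ?lexx ?orbT// q0.
Qed.

(* The radius of convergence of the power series is at least s. *)
Definition ps_bound a s := forall t, 0 < t < s ->
  exists2 C, 0 <= C & forall n, absC (a n) <= C / t ^+ n.

Definition dcoef a n : CC R := n.+1%:R * a n.+1.

Lemma absC_nat n : absC (n%:R : CC R) = n%:R.
Proof.
rewrite -[RHS](@normr_nat R) -absC_reC; congr absC.
by elim: n => [|n ih] //; rewrite -addn1 natrD ih natrD; apply/eqP; rewrite eq_complex /= !addr0 !eqxx.
Qed.

(** The factor n + 1 is absorbed by a slightly larger radius [t'], since (n + 1) t^n (t' - t) <=
    t'^(n+1) - t^(n+1). *)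
Lemma ps_bound_dcoef a s : ps_bound a s -> ps_bound (dcoef a) s.
Proof.
move=> H t /andP[t0 ts]; pose t' := (t + s) / 2.
have t't : t < t' by rewrite /t'; lra.
have t's : t' < s by rewrite /t'; lra.
have t'0 : 0 < t' by exact: lt_trans t't.
have [C C0 HC] := H t' (introT andP (conj t'0 t's)).
have d0 : 0 < t' - t by rewrite subr_gt0.
exists (C / (t' - t)); first by rewrite divr_ge0// ltW.
move=> n; rewrite /dcoef absCM absC_nat.
have key : n.+1%:R * t ^+ n * (t' - t) <= t' ^+ n.+1.
  suff : n.+1%:R * t ^+ n * (t' - t) <= t' ^+ n.+1 - t ^+ n.+1.
    by move=> /le_trans; apply; rewrite lerBlDr lerDl exprn_ge0// ltW.
  elim: n => [|n ih]; first by rewrite !expr1 expr0 !mul1r.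
  have -> : t' ^+ n.+2 - t ^+ n.+2 = t * (t' ^+ n.+1 - t ^+ n.+1) + t' ^+ n.+1 * (t' - t).
    by rewrite (exprS _ n.+1) (exprS t n.+1); ring.
  have -> : n.+2%:R * t ^+ n.+1 * (t' - t) =
     t * (n.+1%:R * t ^+ n * (t' - t)) + t ^+ n.+1 * (t' - t).
    by rewrite -(addn1 n.+1) natrD exprS; ring.
  apply: lerD; first by rewrite ler_wpM2l// ltW.
  rewrite ler_wpM2r ?(ltW d0)// lerXn2r ?nnegrE//; exact: ltW.
have tn : 0 < t ^+ n by rewrite exprn_gt0.
have t'n : 0 < t' ^+ n.+1 by rewrite exprn_gt0.
rewrite ler_pdivlMr//.
apply: le_trans (_ : n.+1%:R * (C / t' ^+ n.+1) * t ^+ n <= _).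
  by rewrite ler_wpM2r ?(ltW tn)// ler_wpM2l.
have -> : n.+1%:R * (C / t' ^+ n.+1) * t ^+ n = C * (n.+1%:R * t ^+ n / t' ^+ n.+1) by ring.
by rewrite ler_wpM2l// ler_pdivrMr// ler_pdivlMl// mulrC.
Qed.

(** Expanded, the remainder is a polynomial in z and k with nonnegative coefficients, and every
    monomial contains k at least twice. Passing to moduli and replacing [e] by [c * e] with [c <= 1]
    therefore gains [c ^+ 2]. *)
Lemma binomial_remainder z k (e c : R) n : 0 <= e -> 0 <= c <= 1 -> absC k = c * e ->
  absC ((z + k) ^+ n - z ^+ n - n%:R * k * z ^+ n.-1)
    <= c ^+ 2 * ((absC z + e) ^+ n - absC z ^+ n - n%:R * e * absC z ^+ n.-1).
Proof.
move=> e0 /andP[c0 c1] kE; have z0 := absC_ge0 z.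
elim: n => [|n ih]; first by rewrite !expr0 !mul0r !subrr absC0 mulr0.
set r := absC z in z0 ih *.
have -> : (z + k) ^+ n.+1 - z ^+ n.+1 - n.+1%:R * k * z ^+ n =
  (z + k) * ((z + k) ^+ n - z ^+ n - n%:R * k * z ^+ n.-1) + n%:R * k ^+ 2 * z ^+ n.-1.
  by case: n {ih} => [|n] /=; rewrite ?expr0 ?expr1 ?(exprS _ n.+1) ?(exprS z n) -1?(addn1 n.+1) ?natrD; ring.
have -> : (r + e) ^+ n.+1 - r ^+ n.+1 - n.+1%:R * e * r ^+ n =
  (r + e) * ((r + e) ^+ n - r ^+ n - n%:R * e * r ^+ n.-1) + n%:R * e ^+ 2 * r ^+ n.-1.
  by case: n {ih} => [|n] /=; rewrite ?expr0 ?expr1 ?(exprS _ n.+1) ?(exprS r n) -1?(addn1 n.+1) ?natrD; ring.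
apply: le_trans (absCD _ _) _; rewrite [leRHS]mulrDr; apply: lerD.
  rewrite absCM mulrCA; apply: ler_pM; rewrite ?absC_ge0//.
  by apply: le_trans (absCD _ _) _; rewrite lerD2l kE ler_piMl.
by rewrite !absCM !absCX absC_nat kE -/r le_eqVlt; apply/orP; left; apply/eqP; ring.
Qed.

(** All three series are truncated. [binomial_remainder], with the fixed step [e], bounds the
    polynomial part by a multiple of |k|^2 that does not depend on [N]; [le_geometric] then removes
    the truncation errors. *)
Lemma psum_cderiv a s z : ps_bound a s -> absC z < s ->
  is_cderiv (psum a) z (psum (dcoef a) z).
Proof.
move=> H zs; have z0 := absC_ge0 z; pose t := (absC z + s) / 2.
have split (k A B E S1 S2 S3 : CC R) : A - B - E * k =
    (S1 - S2 - S3 * k) + ((A - S1) - (B - S2) - (E - S3) * k) by ring.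
have zt : absC z < t by rewrite /t; lra.
have ts : t < s by rewrite /t; lra.
have t0 : 0 < t by exact: le_lt_trans zt.
have t0s : 0 < t < s by rewrite t0.
have [C C0 HC] := H t t0s; have [C1 C10 HC1] := ps_bound_dcoef H t0s.
pose e := (t - absC z) / 2; have e0 : 0 < e by rewrite /e; lra.
pose r := absC z + e; have rt : r < t by rewrite /r /e; lra.
have r0 : 0 <= r by rewrite /r; lra.
have zr : absC z <= r by rewrite /r; lra.
pose q := r / t.
have q0 : 0 <= q by rewrite divr_ge0 ?(ltW t0).
have q1 : q < 1 by rewrite ltr_pdivrMr// mul1r.
have q01 : 0 <= q < 1 by rewrite q0.
have key k : absC k <= e -> absC (psum a (z + k) - psum a z - psum (dcoef a) z * k)
    <= (absC k / e) ^+ 2 * (C / (1 - q)).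
  move=> ke; have k0 := absC_ge0 k.
  pose D := 2 * C * (t / (t - r)); pose D1 := 2 * C1 * (t / (t - r)).
  have D0 : 0 <= D by apply: mulr_ge0; [exact: mulr_ge0|apply: divr_ge0; rewrite ?subr_ge0 ltW].
  apply: (@le_geometric _ _ (D + D + absC k * D1) _ q01) => N.
  have zkr : absC (z + k) <= r by rewrite /r (le_trans (absCD _ _))// lerD2l.
  (* The derivative series is cut one term earlier: its first [N] terms are the derivative of the
     first [N.+1] terms. *)
  have T1 := psum_tail_le C0 zkr rt HC N.+1.
  have T2 := psum_tail_le C0 zr rt HC N.+1.
  have T3 := psum_tail_le C10 zr rt HC1 N.
  rewrite -/q -/D in T1 T2; rewrite -/q -/D1 in T3.
  have qN : D * q ^+ N.+1 <= D * q ^+ N.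
    by rewrite ler_wpM2l// exprS ler_piMl ?exprn_ge0// ltW.
  set S1 := \sum_(n < N.+1) a n * (z + k) ^+ n in T1.
  set S2 := \sum_(n < N.+1) a n * z ^+ n in T2.
  set S3 := \sum_(n < N) dcoef a n * z ^+ n in T3.
  have F : absC (S1 - S2 - S3 * k) <= (absC k / e) ^+ 2 * (C / (1 - q)).
    have -> : S1 - S2 - S3 * k =
        \sum_(n < N.+1) a n * ((z + k) ^+ n - z ^+ n - n%:R * k * z ^+ n.-1).
      rewrite /S1 /S2 -sumrB big_ord_recl [RHS]big_ord_recl /= !expr0 !mul0r !subrr mulr0 !add0r.
      rewrite /S3 mulr_suml -sumrB; apply: eq_bigr => i _.
      by rewrite /dcoef /bump /= add1n; ring.
    apply: le_trans (absC_sum _ (fun n => a n * ((z + k) ^+ n - z ^+ n - n%:R * k * z ^+ n.-1))) _.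
    apply: le_trans (_ : \sum_(n < N.+1) (absC k / e) ^+ 2 * (C * q ^+ n) <= _).
      apply: ler_sum => n _; rewrite absCM.
      have ce : 0 <= absC k / e <= 1.
        by rewrite divr_ge0 ?(ltW e0)//= ler_pdivrMr// mul1r.
      have kE : absC k = absC k / e * e by rewrite divfK// gt_eqF.
      have B := binomial_remainder z n (ltW e0) ce kE.
      have -> : (absC k / e) ^+ 2 * (C * q ^+ n) = C / t ^+ n * ((absC k / e) ^+ 2 * r ^+ n).
        by have -> : q ^+ n = r ^+ n / t ^+ n; [rewrite /q exprMn exprVn|ring].
      apply: ler_pM; rewrite ?absC_ge0//; apply: le_trans B _.
      have h1 : 0 <= absC z ^+ n by rewrite exprn_ge0.
      have h2 : 0 <= n%:R * e * absC z ^+ n.-1 by exact: (mulr_ge0 (mulr_ge0 (ler0n _ _) (ltW e0)) (exprn_ge0 _ z0)).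
      apply: ler_wpM2l; first exact: sqr_ge0.
      by rewrite -/r -addrA -opprD gerDl oppr_le0; exact: addr_ge0.
    rewrite -mulr_sumr ler_wpM2l ?sqr_ge0//.
    have := @sum_geometric_le C q (fun n => C * q ^+ n) 0 N.+1 q01 C0.
    rewrite expr0 mulr1 big_mkord => G; apply: le_trans (ler_norm _) (G _) => n.
    by rewrite ger0_norm// mulr_ge0// exprn_ge0.
  rewrite (split k _ _ _ S1 S2 S3).
  apply: le_trans (absCD _ _) _; apply: (lerD F).
  apply: le_trans (absCB _ _) _; rewrite [leRHS]mulrDl; apply: lerD.
    apply: le_trans (absCB _ _) _; rewrite [leRHS]mulrDl; apply: lerD.
      exact: le_trans T1 qN.
    exact: le_trans T2 qN.
  by rewrite absCM mulrC -mulrA; apply: ler_wpM2l.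
move=> x x0; pose K := C / (1 - q) / e ^+ 2.
have K0 : 0 <= K by rewrite !divr_ge0 ?sqr_ge0// subr_ge0 ltW.
have K1 : 0 < K + 1 by rewrite ltr_wpDl.
exists (Num.min e (x / (K + 1))); first by rewrite lt_min e0 divr_gt0.
move=> k; rewrite lt_min => /andP[/ltW ke kx]; have k0 := absC_ge0 k.
apply: le_trans (key k ke) _.
have -> : (absC k / e) ^+ 2 * (C / (1 - q)) = K * absC k * absC k.
  by rewrite /K exprMn exprVn; ring.
rewrite ler_wpM2r//; rewrite ltr_pdivlMr// in kx.
by have := mulr_ge0 K0 k0; lra.
Qed.

End PowerSeries.

(** * Holomorphic functions of one and two variables *)

Section Holomorphic.
Variable R : realType.
Implicit Types (z w k : CC R) (s t x y C rho : R) (f g : CC R -> CC R).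

Lemma circ_continuous_bounded f s : 0 <= s -> circ_continuous f s ->
  exists2 B : R, 0 <= B & forall t, 0 <= t <= 2 * pi -> absC (f (circ s t)) <= B.
Proof.
move=> s0 cf; have p0 : 0 <= 2 * pi :> R by rewrite mulr_ge0// pi_ge0.
have cg : continuous (fun t => absC (f (circ s t))).
  move=> t; apply/continuousRP => e e0.
  have /continuousCP/(_ _ e0) : {for t, continuous (fun t => f (circ s t))}.
    exact: circ_continuous_comp.
  apply: filterS => u; apply: le_lt_trans; apply/ler_normlP; split.
    by rewrite opprB absCBC; exact: absC_lB.
  exact: absC_lB.
have [||t _ Ht] := @EVT_max R (fun t => absC (f (circ s t))) 0 (2 * pi).
- exact: p0.
- exact: continuous_subspaceT cg.
exists (absC (f (circ s t))); first exact: absC_ge0.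
by move=> u hu; apply: Ht; rewrite in_itv.
Qed.

Lemma holo_power_series f rho s : (forall w, absC w < rho -> derivable f w 1) ->
  0 < s < rho ->
  exists2 a, ps_bound a s & forall z, absC z < s -> f z = psum a z.
Proof.
move=> df ssr; have /andP[s0 sr] := ssr; have s0' := ltW s0.
have [||B B0 HB] := @circ_continuous_bounded f s.
- exact: s0'.
- by move=> w ws; apply: derivableC_continuous; apply: df; rewrite ws.
have [a [Ha1 Ha2]] := cauchy_series df ssr HB.
have B2 : 0 <= 2 * B by rewrite mulr_ge0.
exists a.
  move=> t /andP[t0 ts]; exists (2 * B); first exact: B2.
  move=> n; apply: le_trans (Ha1 n) _; apply: ler_wpM2l => //.
  rewrite lef_pV2 ?posrE ?exprn_gt0//; apply: lerXn2r; rewrite ?nnegrE; exact: ltW.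
move=> z zs; have z0 := absC_ge0 z.
apply: (@psum_unique R a z (f z) (2 * B * (s / (s - absC z))) (absC z / s) (2 * B) s).
- by rewrite divr_ge0//= ltr_pdivrMr// mul1r.
- exact: B2.
- exact: zs.
- exact: Ha1.
- exact: Ha2 zs.
Qed.

(** Locally the derivative is the differentiated power series, which is again differentiable;
    iterating this makes real parts of holomorphic functions smooth. *)
Lemma derivable_cder f rho : (forall w, absC w < rho -> derivable f w 1) ->
  forall w, absC w < rho -> derivable (cder f) w 1.
Proof.
move=> df w wr; pose s := (absC w + rho) / 2.
have w0 := absC_ge0 w.
have ws : absC w < s by rewrite /s; lra.
have ssr : 0 < s < rho by rewrite /s; apply/andP; split; lra.
have [a Ha fa] := holo_power_series df ssr.
have near_s u : absC u < s -> \forall v \near u, absC v < s.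
  move=> us; apply/nbhsCP; exists (s - absC u); first by rewrite subr_gt0.
  by move=> v vu; have := absCD (v - u) u; rewrite subrK; lra.
have E u : absC u < s -> cder f u = psum (dcoef a) u.
  move=> us; have /cderiv_is_derive D := psum_cderiv Ha us.
  have -> : cder f u = 'D_1 (psum a) u.
    apply: near_eq_derive.
    by apply: filterS (near_s u us) => v; exact: fa.
  by case: D.
apply: near_eq_derivableC (_ : derivable (psum (dcoef a)) w 1).
  by apply: filterS (near_s w ws) => v /E.
apply/derivable_cderiv; exists (psum (dcoef (dcoef a)) w).
exact: (psum_cderiv (ps_bound_dcoef Ha) ws).
Qed.

Lemma derivable_iter_cder f rho n : (forall w, absC w < rho -> derivable f w 1) ->
  forall w, absC w < rho -> derivable (iter n (@cder R) f) w 1.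
Proof. by move=> df; elim: n => [//|n ih]; exact: derivable_cder. Qed.

Lemma derivableC_shift f z w : derivable f (z + w) 1 ->
  derivable (fun u => f (z + u)) w 1.
Proof.
move=> df; apply: (@derivableC_comp R (fun u => z + u) f); last exact: df.
by apply: derivableCD; [exact: derivableC_cst|exact: derivableC_id].
Qed.

(** The remainder estimate of [cauchy_series] with one term kept. For |z - z0| <= s / 2 the
    denominator [s - absC k] is at least s / 2, which turns [2 * B] into [4 * B]. Only a bound on
    the circle enters. *)
Lemma schwarz_lipschitz f z0 rho s (B : R) :
  (forall w, absC (w - z0) < rho -> derivable f w 1) -> 0 < s < rho ->
  (forall t, 0 <= t <= 2 * pi -> absC (f (z0 + circ s t)) <= B) ->
  forall z, absC (z - z0) <= s / 2 -> absC (f z - f z0) <= 4 * B / s * absC (z - z0).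
Proof.
move=> df ssr HB z hz; have /andP[s0 sr] := ssr.
have K w : z0 + w - z0 = w by rewrite addrAC subrr add0r.
have [||a [_ Ha]] := @cauchy_series R (fun u => f (z0 + u)) rho s B _ ssr.
- by move=> w wr; apply: derivableC_shift; apply: df; rewrite K.
- exact: HB.
have B0 : 0 <= B.
  apply: le_trans (absC_ge0 (f (z0 + circ s 0))) (HB _ _).
  by rewrite lexx mulr_ge0// pi_ge0.
set k := z - z0 in hz *; have k0 := absC_ge0 k.
have ks : absC k < s by lra.
(* The constant coefficients cancel; the second bracket is a remainder at the centre, where the
   bound is 0. *)
have -> : f z - f z0 = (f (z0 + k) - \sum_(n < 1) a n * k ^+ n) - (f (z0 + 0) - \sum_(n < 1) a n * 0 ^+ n).
  rewrite !big_ord_recl !big_ord0 !expr0 !addr0 /k addrCA subrr !addr0.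
  by ring.
have a0 := Ha 0; rewrite absC0 in a0; have {}a0 := a0 s0 1%N.
rewrite mul0r expr1 mulr0 in a0.
apply: le_trans (absCB _ _) _; rewrite -[leRHS]addr0; apply: lerD; last exact: a0.
apply: le_trans (Ha k ks 1%N) _; rewrite expr1.
have -> : 2 * B * (s / (s - absC k)) * (absC k / s) = 2 * B / (s - absC k) * absC k.
  by field; rewrite subr_eq0 !gt_eqF.
apply: ler_wpM2r => //; rewrite ler_pdivrMr ?subr_gt0//.
have -> : 4 * B / s * (s - absC k) = 2 * B * (2 * (s - absC k) / s) by ring.
by apply: ler_peMr; rewrite ?mulr_ge0// ler_pdivlMr// mul1r; lra.
Qed.

(** [schwarz_lipschitz] recentred at [z2] on a circle of radius s / 2: the circle stays within s / 2
    + s / 8 of [z0], and |z1 - z2| <= s / 4 is half its radius. *)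
Lemma holo_lipschitz f z0 s (B : R) : 0 < s ->
  (forall w, absC (w - z0) < s -> derivable f w 1) ->
  (forall w, absC (w - z0) < s -> absC (f w) <= B) ->
  forall z1 z2, absC (z1 - z0) <= s / 8 -> absC (z2 - z0) <= s / 8 ->
    absC (f z1 - f z2) <= 8 * B / s * absC (z1 - z2).
Proof.
move=> s0 df HB z1 z2 h1 h2.
have D r w : absC (w - z2) <= r -> absC (w - z0) <= r + s / 8.
  by move=> h; have := absC_triangle z2 w z0; lra.
have -> : 8 * B / s = 4 * B / (s / 2) by field; rewrite gt_eqF.
apply: (@schwarz_lipschitz f z2 (s / 2 + s / 8)).
- by move=> w hw; apply: df; have := D _ _ (lexx (absC (w - z2))); lra.
- by apply/andP; split; lra.
- move=> t _; apply: HB; set w := z2 + _.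
  have ws : absC (w - z2) = s / 2 by rewrite /w addrAC subrr add0r absC_circ; lra.
  by have := D _ _ (lexx (absC (w - z2))); lra.
- by have := absC_triangle z0 z1 z2; rewrite (absCBC z0 z2); lra.
Qed.

End Holomorphic.

(** * Local inversion of a holomorphic function *)

Section LocalInverse.
Variable R : realType.
Implicit Types (z w k t : CC R) (s x y C rho : R) (f g : CC R -> CC R).

(** The deviation of f from its linear part is at most [e / 8 * s] on the disc of radius [s], so
    [holo_lipschitz] gives it the Lipschitz constant [8 * (e / 8 * s) / s = e]. *)
Lemma strict_derivable f rho a : 0 < rho ->
  (forall w, absC w < rho -> derivable f w 1) -> is_cderiv f 0 a ->
  forall e, 0 < e -> exists2 d, 0 < d < rho & forall t1 t2, absC t1 <= d -> absC t2 <= d ->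
    absC (f t1 - f t2 - a * (t1 - t2)) <= e * absC (t1 - t2).
Proof.
move=> rho0 df Ha e e0.
have [d d0 Hd] := Ha (e / 8) (divr_gt0 e0 (ltr0Sn _ _)).
pose s := Num.min d rho; have s0 : 0 < s by rewrite lt_min d0.
have sd : s <= d by rewrite ge_min lexx.
have sr : s <= rho by rewrite ge_min lexx orbT.
clearbody s.
exists (s / 8); first by apply/andP; split; lra.
move=> t1 t2 h1 h2.
pose g w := f w - f 0 - a * w.
have dg w : absC (w - 0) < s -> derivable g w 1.
  rewrite subr0 => ws; apply: derivableCB.
    apply: derivableCB; last exact: derivableC_cst.
    by apply: df; exact: lt_le_trans sr.
  by apply: derivableCM; [exact: derivableC_cst|exact: derivableC_id].
have bg w : absC (w - 0) < s -> absC (g w) <= e / 8 * s.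
  rewrite subr0 => ws; have := Hd w (lt_le_trans ws sd); rewrite add0r => h.
  apply: le_trans h _; apply: ler_wpM2l; last exact: ltW.
  by rewrite divr_ge0// ltW.
have := holo_lipschitz s0 dg bg (z1 := t1) (z2 := t2); rewrite !subr0 => /(_ h1 h2).
have -> : g t1 - g t2 = f t1 - f t2 - a * (t1 - t2) by rewrite /g; ring.
by have -> : 8 * (e / 8 * s) / s = e by field; rewrite gt_eqF.
Qed.

(* g z is the fixed point of the contraction t |-> (z - (f t - a t)) / a. *)
Lemma local_inverse f rho a : 0 < rho ->
  (forall w, absC w < rho -> derivable f w 1) -> is_cderiv f 0 a -> f 0 = 0 -> a != 0 ->
  exists (d K : R) (g : CC R -> CC R), 0 < d /\ 0 <= K /\
    forall z, absC z < d -> [/\ derivable g z 1, f (g z) = z,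
      absC (g z) < rho & absC (g z) <= K * absC z].
Proof.
move=> rho0 df Ha f0 a0.
have A0 : 0 < absC a by rewrite absC_gt0.
(* Error |a| / 2 makes the map [T z] below contract by 1/2 on the disc of radius [eta]. *)
have [eta /andP[eta0 etar] H] := strict_derivable rho0 df Ha (divr_gt0 A0 (ltr0Sn _ 1)).
pose e t := f t - a * t.
pose T z t := (z - e t) / a.
have T_lip z1 z2 t1 t2 : absC t1 <= eta -> absC t2 <= eta ->
    absC (T z1 t1 - T z2 t2) <= absC (z1 - z2) / absC a + 2^-1 * absC (t1 - t2).
  move=> h1 h2; have -> : T z1 t1 - T z2 t2 = (z1 - z2) / a - (f t1 - f t2 - a * (t1 - t2)) / a.
    by rewrite /T /e; ring.
  apply: le_trans (absCB _ _) _; rewrite !absCf lerD2l ler_pdivrMr//.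
  apply: le_trans (H _ _ h1 h2) _; rewrite le_eqVlt; apply/orP; left; apply/eqP.
  by ring.
have T0 : T 0 0 = 0 by rewrite /T /e f0 mulr0 subrr subr0 mul0r.
(* Then |z| / |a| <= eta / 4, and the iterates stay within eta / 2 because eta / 4 + (1/2)(eta / 2)
   = eta / 2. *)
pose d := absC a * eta / 4.
have d0 : 0 < d by rewrite divr_gt0// mulr_gt0.
pose it z n := iter n (T z) 0.
have zle z : absC z < d -> absC z / absC a <= eta / 4.
  by move=> zd; rewrite ler_pdivrMr//; move: zd; rewrite /d; lra.
have it_in z : absC z < d -> forall n, absC (it z n) <= eta / 2.
  move=> zd; elim=> [|n ih]; first by rewrite absC0; lra.
  have := T_lip z 0 (it z n) 0; rewrite T0 absC0 !subr0 => /(_ _ _)/le_trans; apply.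
  - by move: ih; lra.
  - exact: ltW.
  - by have := zle z zd; lra.
pose u z n := it z n.+1 - it z n.
have u_le z : absC z < d -> forall n, absC (u z n) <= absC z / absC a * 2^-1 ^+ n.
  move=> zd; elim=> [|n ih].
    have := T_lip z 0 0 0; rewrite T0 absC0 !subr0 absC0 mulr0 addr0 expr0 mulr1.
    by rewrite /u /it /= subr0; apply; exact: ltW.
  have := T_lip z z (it z n.+1) (it z n); rewrite subrr absC0 mul0r add0r => h.
  have i1 := it_in z zd n; have i2 := it_in z zd n.+1.
  have {}h : absC (u z n.+1) <= 2^-1 * absC (u z n).
    by apply: h; [move: i2|move: i1]; move: (absC _) => X; lra.
  rewrite exprS; move: h ih; move: (absC _) (absC _) (absC z / _) (2^-1 ^+ n) => X Y Z V; lra.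
(* The limit of the iterates as a telescoping series of their increments, so that [csum_tail] gives
   the rate of convergence. *)
pose g z := csum (u z).
have q01 : 0 <= (2^-1 : R) < 1 by apply/andP; split; lra.
have g_it z : absC z < d -> forall n, absC (g z - it z n) <= 2 * (absC z / absC a) / (1 - 2^-1) * 2^-1 ^+ n.
  move=> zd n; have D0 : 0 <= absC z / absC a by rewrite divr_ge0// absC_ge0.
  have := csum_tail n q01 D0 (u_le z zd).
  suff -> : \sum_(i < n) u z i = it z n by [].
  elim: n => [|n ih]; first by rewrite big_ord0.
  by rewrite big_ord_recr /= ih /u addrCA subrr addr0.
have g_in z : absC z < d -> absC (g z) <= eta / 2.
  move=> zd; apply: (@le_geometric _ _ _ (2 * (absC z / absC a) / (1 - 2^-1)) 2^-1 q01) => n.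
  have := g_it z zd n; have := it_in z zd n; have := absC_lB (g z) (it z n).
  move: (absC (g z - it z n)) (absC (g z)) (absC (it z n)) => X Y Z; move: (_ * _ ^+ n) => W; lra.
have fix_g z : absC z < d -> T z (g z) = g z.
  move=> zd; apply/eqP; rewrite -subr_eq0 -absC_eq0 -normr_le0 ger0_norm ?absC_ge0//.
  apply: (@le_geometric _ _ _ (2 * (absC z / absC a) / (1 - 2^-1)) 2^-1 q01) => n; rewrite add0r.
  apply: le_trans (absC_triangle (it z n.+1) _ _) _.
  have := T_lip z z (g z) (it z n); rewrite subrr absC0 mul0r add0r => h.
  have i1 := it_in z zd n; have i2 := g_in z zd.
  have {}h : absC (T z (g z) - it z n.+1) <= 2^-1 * absC (g z - it z n).
    by apply: h; [move: i2|move: i1]; move: (absC _) => X; lra.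
  have g1 := g_it z zd n; have := g_it z zd n.+1; rewrite absCBC exprS => g2.
  set W := 2 * (absC z / absC a) / (1 - 2^-1) in g1 g2 *.
  move: h g1 g2; move: (absC _) (absC _) (absC _) (2^-1 ^+ n) => X Y Z V.
  by lra.
have fg z : absC z < d -> f (g z) = z.
  move=> zd; have := fix_g z zd; rewrite /T /e => E.
  have := congr1 (fun v => v * a) E; rewrite /= divfK// => E'.
  apply/eqP; rewrite -subr_eq0; apply/eqP.
  have -> : f (g z) - z = g z * a - (z - (f (g z) - a * g z)) by ring.
  by rewrite E' subrr.
have g_lip z1 z2 : absC z1 < d -> absC z2 < d -> absC (g z1 - g z2) <= 2 / absC a * absC (z1 - z2).
  move=> h1 h2; have i1 := g_in z1 h1; have i2 := g_in z2 h2.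
  have := T_lip z1 z2 (g z1) (g z2); rewrite !fix_g// => h.
  have {}h : absC (g z1 - g z2) <= absC (z1 - z2) / absC a + 2^-1 * absC (g z1 - g z2).
    by apply: h; [move: i1|move: i2]; move: (absC _) => X; lra.
  rewrite mulrAC -mulrA; move: h; move: (absC (g _ - _)) (absC _ / _) => X Y; lra.
have g0 : g 0 = 0.
  have := g_it 0; rewrite absC0 => /(_ d0 0%N).
  rewrite mul0r mulr0 mul0r mul0r subr0 => h; apply/eqP; rewrite -absC_eq0.
  by rewrite eq_le h absC_ge0.
exists d, (2 / absC a), g; split=> //; split=> [|z zd].
  by rewrite divr_ge0// ltW.
have gz := g_in z zd; split; last first.
- by have := g_lip z 0 zd; rewrite g0 absC0 !subr0; apply.
- by apply: le_lt_trans gz _; lra.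
- exact: fg.
have dgz : derivable f (g z) 1 by apply: df; apply: le_lt_trans gz _; lra.
have [b Hb] := (derivable_cderiv f (g z)).1 dgz.
(* Distances to [g z] are shrunk at most by the factor |a| / 2, so the derivative [b] of f at [g z]
   cannot vanish. *)
have expand t : absC t <= eta -> absC (g z - t) * (absC a / 2) <= absC (f (g z) - f t).
  move=> ht; have gz' : absC (g z) <= eta by move: gz; move: (absC _) => X; lra.
  have := H _ _ gz' ht; have := absC_lB (a * (g z - t)) (a * (g z - t) - (f (g z) - f t)).
  have -> : a * (g z - t) - (a * (g z - t) - (f (g z) - f t)) = f (g z) - f t by ring.
  rewrite -(absCBC (f (g z) - f t)) absCM.
  move: (absC (g z - t)) (absC (_ - _)) (absC (_ - _)) (absC a) => X Y Z A; lra.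
have b0 : b != 0.
  apply/eqP => b0; have [d1 d10 Hd1] := Hb (absC a / 4) (divr_gt0 A0 (ltr0Sn _ _)).
  pose x := Num.min (d1 / 2) (eta / 2).
  have x0 : 0 < x by rewrite lt_min !divr_gt0.
  have xd : x < d1 by apply: (@le_lt_trans _ _ (d1 / 2)); [rewrite ge_min lexx|lra].
  have xe : x <= eta / 2 by rewrite ge_min lexx orbT.
  have xE : absC (reC x) = x by rewrite absC_reC gtr0_norm.
  have := Hd1 (reC x); rewrite xE b0 mul0r subr0 => /(_ xd).
  have := expand (g z + reC x); rewrite opprD addrA subrr add0r absCN xE.
  rewrite (absCBC (f (g z))) => h1 h2.
  have : x * (absC a / 2) <= absC a / 4 * x.
    apply: le_trans (h1 _) h2; apply: le_trans (absCD _ _) _; rewrite xE.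
    by move: gz; move: (absC _) => X; lra.
  have : 0 < x * absC a by rewrite mulr_gt0.
  by move: (absC a) => X; lra.
apply/derivable_cderiv; exists b^-1 => c c0.
have B0 : 0 < absC b by rewrite absC_gt0.
(* The tolerance pays for the Lipschitz constant [2 / absC a] of [g] and for the division by [b]. *)
have ce0 : 0 < c * absC b * absC a / 2 by rewrite !divr_gt0 ?mulr_gt0.
have [d1 d10 Hd1] := Hb _ ce0.
pose d2 := Num.min (d - absC z) (d1 * absC a / 2).
have d20 : 0 < d2 by rewrite lt_min subr_gt0 zd divr_gt0// mulr_gt0.
exists d2; first exact: d20.
move=> h; rewrite lt_min => /andP[h1 h2].
have zhd : absC (z + h) < d by have := absCD z h; lra.
set k := g (z + h) - g z.
have k_le : absC k <= 2 / absC a * absC h.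
  by have := g_lip _ _ zhd zd; rewrite -/k addrAC subrr add0r.
have kd : absC k < d1.
  apply: le_lt_trans k_le _; rewrite mulrAC ltr_pdivrMr//.
  by move: h2; move: (absC h) (absC a) => X Y; lra.
have := Hd1 k kd; have -> : g z + k = g (z + h) by rewrite /k addrCA subrr addr0.
rewrite !fg// (addrAC z) subrr add0r => hk.
have -> : k - b^-1 * h = - ((h - b * k) / b) by field.
rewrite absCN absCf ler_pdivrMr//; apply: le_trans hk _.
apply: le_trans (_ : c * absC b * absC a / 2 * (2 / absC a * absC h) <= _).
  by apply: ler_wpM2l => //; exact: ltW.
rewrite le_eqVlt; apply/orP; left; apply/eqP; field.
by rewrite gt_eqF.
Qed.

End LocalInverse.

(** * Chain rule and Lipschitz bounds in two variables *)

Section TwoVariables.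
Variable R : realType.
Implicit Types (z w k : CC R) (s x y C rho : R) (f g : CC R * CC R -> CC R)
  (q : CC R * CC R) (U : set (CC R * CC R)).

Lemma open_box U q : open U -> U q -> exists2 d : R, 0 < d &
  forall q' : CC R * CC R, absC (q'.1 - q.1) < d -> absC (q'.2 - q.2) < d -> U q'.
Proof. by move=> oU Uq; apply/nbhsC2P; exact: open_nbhs_nbhs. Qed.

Lemma within_open_continuous (T V : topologicalType) (A : set T) (h : T -> V) (t : T) :
  open A -> {within A, continuous h} -> A t -> {for t, continuous h}.
Proof. by move=> oA; rewrite continuous_open_subspace// => H At; apply: H; rewrite inE. Qed.

Lemma holo2c_box U f q e : open U -> {within U, continuous f} -> U q -> 0 < e ->
  exists2 d : R, 0 < d &
  forall q' : CC R * CC R, absC (q'.1 - q.1) < d -> absC (q'.2 - q.2) < d ->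
    absC (f q' - f q) < e.
Proof.
move=> oU cf Uq e0; apply/nbhsC2P.
by have /continuousCP := within_open_continuous oU cf Uq; apply.
Qed.

(* f(., w) - f(., w0) is holomorphic and, for w close to w0, uniformly small on a
   circle around z0, hence has a small Lipschitz constant. *)
Lemma holo2c_increment U f z0 w0 : open U -> holo2c_on U f -> U (z0, w0) ->
  forall e, 0 < e -> exists2 d, 0 < d & forall z w, absC (z - z0) < d -> absC (w - w0) < d ->
    absC (f (z, w) - f (z, w0) - (f (z0, w) - f (z0, w0))) <= e * absC (z - z0).
Proof.
move=> oU [cf df] Uq e e0.
have [rho rho0 Hrho] := open_box oU Uq; rewrite /= in Hrho.
pose s := rho / 2; have s0 : 0 < s by rewrite divr_gt0.
have sr : s < rho by rewrite /s; lra.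
(* [schwarz_lipschitz] turns a bound [e1] on the circle of radius [s] into the Lipschitz constant
   [4 * e1 / s = e]. *)
pose e1 := e * s / 4; have e10 : 0 < e1 by rewrite divr_gt0// mulr_gt0.
have near_cov : near_covering (`[0, 2 * pi] : set R).
  by apply/compact_near_coveringP; exact: segment_compact.
have NC := near_cov (CC R) (nbhs w0)
  (fun w (t : R) => absC (f (z0 + circ s t, w) - f (z0 + circ s t, w0)) < e1)
  (nbhs_filter w0).
have H (t : R) : \forall t' \near t & w \near w0,
    absC (f (z0 + circ s t', w) - f (z0 + circ s t', w0)) < e1.
  have Ut : U (z0 + circ s t, w0).
    apply: Hrho; last by rewrite /= subrr absC0.
    by rewrite /= addrAC subrr add0r absC_circ// ltW.
  have [d d0 Hd] := holo2c_box oU cf Ut (divr_gt0 e10 (ltr0Sn _ 1)).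
  exists ([set t' | absC (circ s t' - circ s t) < d], [set w | absC (w - w0) < d]).
    split; last by apply/nbhsCP; exists d.
    have /continuousCP := @continuous_circ R s t; exact.
  move=> [t' w] [/= h1 h2].
  have E : z0 + circ s t' - (z0 + circ s t) = circ s t' - circ s t by ring.
  have g1 := Hd (z0 + circ s t', w); have g2 := Hd (z0 + circ s t', w0).
  rewrite /= E in g1 g2; have {}g1 := g1 h1 h2.
  have {}g2 := g2 h1; rewrite subrr absC0 in g2; have {}g2 := g2 d0.
  apply: le_lt_trans (absC_triangle (f (z0 + circ s t, w0)) _ _) _.
  rewrite (absCBC (f (z0 + circ s t, w0))); lra.
have /nbhsCP[d d0 Hd] := NC (fun t _ => H t).
pose d' := Num.min (Num.min d rho) (s / 2).
have d'0 : 0 < d' by rewrite !lt_min d0 rho0 divr_gt0.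
exists d'; first exact: d'0.
move=> z w; rewrite !lt_min => /andP[/andP[_ zr] zs] /andP[/andP[wd wr] _].
pose G u := f (u, w) - f (u, w0).
have dG u : absC (u - z0) < rho -> derivable G u 1.
  move=> ur; have w0r : absC (w0 - w0) < rho by rewrite subrr absC0.
  apply: derivableCB.
    exact: (df (u, w) (Hrho (u, w) ur wr)).1.
  exact: (df (u, w0) (Hrho (u, w0) ur w0r)).1.
have ssr : 0 < s < rho by rewrite s0.
have BG (t : R) : 0 <= t <= 2 * pi -> absC (G (z0 + circ s t)) <= e1.
  by move=> ht; apply: ltW; apply: Hd => //; rewrite /= in_itv.
have := schwarz_lipschitz dG ssr BG (ltW zs).
by have -> : 4 * e1 / s = e by rewrite /e1; field; rewrite gt_eqF.
Qed.

(** The increment of f is the sum of its two partial increments and a mixed second difference. The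
    partial increments obey the one-variable chain rule, and [holo2c_increment] makes the mixed
    difference negligible. *)
Lemma holo2c_comp U f (a b : CC R -> CC R) (t : CC R) : open U -> holo2c_on U f ->
  U (a t, b t) -> derivable a t 1 -> derivable b t 1 ->
  derivable (fun u => f (a u, b u)) t 1.
Proof.
move=> oU hf Uq /derivable_cderiv[la Ha] /derivable_cderiv[lb Hb].
have [cf df] := hf; have [/= df1 df2] := df _ Uq.
move/derivable_cderiv: df1 => [l1 H1]; move/derivable_cderiv: df2 => [l2 H2].
apply/derivable_cderiv; exists (l1 * la + l2 * lb) => e e0.
have C1 := cderiv_comp Ha H1; have C2 := cderiv_comp Hb H2.
have A0 : 0 < absC la + 1 by rewrite ltr_wpDl// absC_ge0.
have B0 : 0 < absC lb + 1 by rewrite ltr_wpDl// absC_ge0.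
have e3 : 0 < e / 3 by rewrite divr_gt0.
have [d1 d10 D1] := C1 _ e3; have [d2 d20 D2] := C2 _ e3.
have [d3 d30 D3] := holo2c_increment oU hf Uq (divr_gt0 e3 A0).
have [d4 d40 D4] := Ha 1 ltr01; have [d5 d50 D5] := Hb 1 ltr01.
exists (Num.min (Num.min (Num.min d1 d2) (Num.min d4 d5))
   (Num.min (d3 / (absC la + 1)) (d3 / (absC lb + 1)))).
  by rewrite !lt_min d10 d20 d40 d50 !divr_gt0.
move=> k; rewrite !lt_min => /andP[/andP[/andP[k1 k2] /andP[k4 k5]] /andP[k6 k7]].
rewrite ltr_pdivlMr// in k6; rewrite ltr_pdivlMr// in k7.
have {}D1 := D1 k k1; have {}D2 := D2 k k2; have {}D4 := D4 k k4; have {}D5 := D5 k k5.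
have Ka : absC (a (t + k) - a t) <= absC k * (absC la + 1).
  have := absCD (a (t + k) - a t - la * k) (la * k); rewrite subrK absCM; lra.
have Kb : absC (b (t + k) - b t) <= absC k * (absC lb + 1).
  have := absCD (b (t + k) - b t - lb * k) (lb * k); rewrite subrK absCM; lra.
have {}D3 := D3 _ _ (le_lt_trans Ka k6) (le_lt_trans Kb k7).
have {D3} D3 : absC (f (a (t + k), b (t + k)) - f (a (t + k), b t)
    - (f (a t, b (t + k)) - f (a t, b t))) <= e / 3 * absC k.
  apply: le_trans D3 _.
  have -> : e / 3 * absC k = e / 3 / (absC la + 1) * (absC k * (absC la + 1)).
    by field; rewrite gt_eqF.
  by apply: ler_wpM2l => //; rewrite divr_ge0 ?(ltW e3) ?(ltW A0).
have split (X1 X2 X3 X4 m1 m2 v : CC R) : X1 - X4 - (m1 + m2) * v =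
   (X2 - X4 - m1 * v) + (X3 - X4 - m2 * v) + (X1 - X2 - (X3 - X4)) by ring.
rewrite (split _ (f (a (t + k), b t)) (f (a t, b (t + k)))).
apply: le_trans (absCD _ _) _.
have := absCD (f (a (t + k), b t) - f (a t, b t) - l1 * la * k)
  (f (a t, b (t + k)) - f (a t, b t) - l2 * lb * k).
by move: D1 D2 D3; move: (absC _) (absC _) (absC _) (absC _) (absC k) => X Y Z W V; lra.
Qed.

Lemma holo2c_lipschitz U f q : open U -> holo2c_on U f -> U q ->
  exists L d : R, [/\ 0 <= L, 0 < d & forall q1 q2 : CC R * CC R,
    absC (q1.1 - q.1) <= d -> absC (q1.2 - q.2) <= d ->
    absC (q2.1 - q.1) <= d -> absC (q2.2 - q.2) <= d ->
    absC (f q1 - f q2) <= L * (absC (q1.1 - q2.1) + absC (q1.2 - q2.2))].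
Proof.
move=> oU [cf df] Uq.
have [rho rho0 Hrho] := open_box oU Uq.
have [d d0 Hd] := holo2c_box oU cf Uq ltr01.
pose s := Num.min rho d; have s0 : 0 < s by rewrite lt_min rho0.
have sr : s <= rho by rewrite ge_min lexx.
have sd : s <= d by rewrite ge_min lexx orbT.
clearbody s.
pose B := absC (f q) + 1.
have HB q' : absC (q'.1 - q.1) < s -> absC (q'.2 - q.2) < s -> absC (f q') <= B.
  move=> h1 h2; have := Hd q' (lt_le_trans h1 sd) (lt_le_trans h2 sd).
  by have := absC_lB (f q') (f q); rewrite /B; lra.
have B0 : 0 <= B by rewrite /B addr_ge0// absC_ge0.
exists (8 * B / s), (s / 8); split.
- by rewrite divr_ge0 ?(ltW s0)// mulr_ge0.
- by rewrite divr_gt0.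
clearbody B.
case: q Uq Hrho HB {Hd} => z0 w0 Uq Hrho HB [z1 w1] [z2 w2] /= h1 h2 h3 h4.
have lt8 (v : CC R) : absC v <= s / 8 -> absC v < s by move: (absC v) => X; lra.
apply: le_trans (absC_triangle (f (z2, w1)) _ _) _; rewrite mulrDr; apply: lerD.
  apply: (@holo_lipschitz R (fun z => f (z, w1)) z0 s _ s0).
  - move=> z zs.
    exact: (df (z, w1) (Hrho (z, w1) (lt_le_trans zs sr) (lt_le_trans (lt8 _ h2) sr))).1.
  - by move=> z zs; apply: HB; [exact: zs|exact: lt8].
  - exact: h1.
  - exact: h3.
apply: (@holo_lipschitz R (fun w => f (z2, w)) w0 s _ s0).
- move=> w ws.
  exact: (df (z2, w) (Hrho (z2, w) (lt_le_trans (lt8 _ h3) sr) (lt_le_trans ws sr))).2.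
- by move=> w ws; apply: HB; [exact: lt8|exact: ws].
- exact: h2.
- exact: h4.
Qed.

End TwoVariables.

(** * Taylor expansions of smooth real functions *)

Section RealTaylor.
Variable R : realType.
Implicit Types (z w d : CC R) (s x y K : R) (F G : CC R -> R) (ds : seq (CC R)).

Lemma MVT_abs (g g' : R -> R) y :
  (forall x, `|x| <= `|y| -> is_derive x 1 g (g' x)) ->
  exists2 x, `|x| <= `|y| & g y - g 0 = g' x * y.
Proof.
move=> H; have [y0|y0] := leP 0 y.
  have [|x /andP[x0 xy] E] := @is_prim_MVT R g' g 0 y y0.
    by move=> x /andP[x0 xy]; apply: H; rewrite !ger0_norm.
  by exists x; [rewrite !ger0_norm|rewrite E subr0].
have [|x /andP[yx x0] E] := @is_prim_MVT R g' g y 0 (ltW y0).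
  by move=> x /andP[yx x0]; apply: H; rewrite (ltr0_norm y0) ler0_norm// lerN2.
exists x; first by rewrite (ltr0_norm y0) ler0_norm// lerN2.
by rewrite -opprB E sub0r mulrN opprK.
Qed.

Lemma is_derive_taylor_sum (c : nat -> R) N y :
  is_derive y 1 (fun y => \sum_(b < N.+1) c b / b`!%:R * y ^+ b)
    (\sum_(b < N) c b.+1 / b`!%:R * y ^+ b).
Proof.
elim: N => [|N ih].
  rewrite big_ord0; have -> : (fun y => \sum_(b < 1) c b / b`!%:R * y ^+ b) = cst (c 0 / 0`!%:R).
    by apply/funext => u; rewrite big_ord_recl big_ord0 expr0 addr0 mulr1.
  exact: is_derive_cst.
have -> : (fun y => \sum_(b < N.+2) c b / b`!%:R * y ^+ b) =
  (fun y => \sum_(b < N.+1) c b / b`!%:R * y ^+ b) + (c N.+1 / N.+1`!%:R *: (fun y => y ^+ N.+1)).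
  by apply/funext => u; rewrite big_ord_recr.
rewrite big_ord_recr /=; apply: is_deriveD.
have h : is_derive y 1 (fun y : R => y ^+ N.+1) (N.+1%:R * y ^+ N).
  have := derivableP (@exprn_derivable R N.+1 y 1); rewrite exp_derive.
  by rewrite /GRing.scale /= mulr1.
have -> : c N.+1 / N`!%:R * y ^+ N = c N.+1 / N.+1`!%:R *: (N.+1%:R * y ^+ N).
  rewrite /GRing.scale /= factS natrM; field.
  by rewrite pnatr_eq0 -lt0n fact_gt0 /= addrC natr1 pnatr_eq0.
exact: is_deriveZ.
Qed.

(** Induction through the mean value theorem: the derivative of the remainder of [phi 0] is the
    remainder of [phi 1]. This loses the factor 1/N!, which is harmless for an O bound. *)
Lemma taylor_line N (phi : nat -> R -> R) eta K : 0 <= K ->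
  (forall n y, (n < N)%N -> `|y| < eta -> is_derive y 1 (phi n) (phi n.+1 y)) ->
  (forall y, `|y| < eta -> `|phi N y| <= K) ->
  forall y, `|y| < eta ->
    `|phi 0 y - \sum_(b < N) phi b 0 / b`!%:R * y ^+ b| <= K * `|y| ^+ N.
Proof.
move=> K0; elim: N phi => [|N ih] phi Hd HK y yeta.
  by rewrite big_ord0 subr0 expr0 mulr1; exact: HK.
have Hd' n y' : (n < N)%N -> `|y'| < eta -> is_derive y' 1 (phi n.+1) (phi n.+2 y').
  by move=> nN; exact: Hd.
have {}ih := ih (fun n => phi n.+1) Hd' HK.
pose g y := phi 0 y - \sum_(b < N.+1) phi b 0 / b`!%:R * y ^+ b.
have [|x xy E] := @MVT_abs g (fun y => phi 1 y - \sum_(b < N) phi b.+1 0 / b`!%:R * y ^+ b) y.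
  move=> x xy; apply: is_deriveB; first by apply: Hd => //; exact: le_lt_trans yeta.
  exact: (is_derive_taylor_sum (fun b => phi b 0)).
have g0 : g 0 = 0.
  rewrite /g big_ord_recl big1 => [|i _]; last by rewrite expr0n /= mulr0.
  by rewrite expr0 fact0 divr1 mulr1 addr0 subrr.
rewrite -/(g y) -[g y]subr0 -{1}g0 E normrM exprSr mulrA ler_wpM2r//.
apply: le_trans (ih x (le_lt_trans xy yeta)) _; rewrite ler_wpM2l//.
by rewrite lerXn2r ?nnegrE.
Qed.

Lemma is_derive_shifted (g : R -> R) (t l : R) :
  is_derive (0 : R) 1 (fun u => g (u + t)) l -> is_derive t 1 g l.
Proof.
move=> H; have -> : g = (fun u => g (u + t)) \o (fun u => u - t).
  by apply/funext => u /=; rewrite subrK.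
have -> : l = l * 1 by rewrite mulr1.
apply: is_derive1_comp; last exact: is_derive_shift.
by rewrite subrr.
Qed.

Lemma lineD z d (u t : R) : z + reC (u + t) * d = z + reC t * d + reC u * d.
Proof.
rewrite -addrA -mulrDl; congr (_ + _ * _).
by apply/eqP; rewrite eq_complex /= addr0 addrC !eqxx.
Qed.

Lemma is_derive_on_line (F : CC R -> R) z d (t l : R) :
  is_derive (0 : R) 1 (fun u => F (z + reC t * d + reC u * d)) l ->
  is_derive t 1 (fun u => F (z + reC u * d)) l.
Proof.
move=> H; apply: is_derive_shifted.
by under eq_fun do rewrite lineD.
Qed.

Lemma is_derive_line F U ds z d t : smooth1_on U F -> U (z + reC t * d) ->
  is_derive t 1 (fun t => iterD1 F ds (z + reC t * d)) (iterD1 F (d :: ds) (z + reC t * d)).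
Proof.
move=> sF Uz; have [/(_ _ d Uz) D _] := sF ds; apply: is_derive_on_line.
by rewrite /= /rD1 derive1E; exact: derivableP.
Qed.

Lemma iterD1_bounded F rho (L : seq (seq (CC R))) : 0 < rho ->
  smooth1_on (fun z => absC z < rho) F ->
  exists K eta : R, [/\ 0 <= K, 0 < eta, eta <= rho &
    forall ds z, ds \in L -> absC z < eta -> `|iterD1 F ds z| <= K].
Proof.
move=> rho0 sF; elim: L => [|ds L [K [eta [K0 eta0 er H]]]].
  by exists 0, rho; split.
have [_ cF] := sF ds.
have c0 : {for 0, continuous (iterD1 F ds)}.
  by apply: (within_open_continuous (@open_disc R rho) cF); rewrite /= absC0.
move/continuousRP: c0 => /(_ 1 ltr01)/nbhsCP[d d0 Hd].
exists (Num.max K (`|iterD1 F ds 0| + 1)), (Num.min eta d); split.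
- by rewrite le_max K0.
- by rewrite lt_min eta0.
- by rewrite ge_min er.
move=> ds' z; rewrite in_cons lt_min le_max => /orP[/eqP ->|dL] /andP[z1 z2].
  apply/orP; right; have := Hd z; rewrite subr0 => /(_ z2).
  have := ler_normD (iterD1 F ds z - iterD1 F ds 0) (iterD1 F ds 0).
  by rewrite subrK; lra.
by rewrite H.
Qed.

Lemma sum_triangle (V : nmodType) N (f : nat -> nat -> V) :
  \sum_(b < N) \sum_(a < N - b) f a b = \sum_(j < N) \sum_(a < j.+1) f a (j - a)%N.
Proof.
elim: N => [|N ih]; first by rewrite !big_ord0.
rewrite [RHS]big_ord_recr /= -ih.
have -> : \sum_(b < N.+1) \sum_(a < N.+1 - b) f a b =
    \sum_(b < N.+1) (\sum_(a < N - b) f a b + f (N - b)%N b).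
  by apply: eq_bigr => b _; rewrite subSn ?leq_ord// big_ord_recr.
rewrite big_split /=; congr (_ + _).
  by rewrite big_ord_recr /= subnn big_ord0 addr0.
rewrite (reindex_inj rev_ord_inj) /=; apply: eq_bigr => i _.
by rewrite subSS subKn ?leq_ord.
Qed.

Lemma Complex_line x y : (Complex x y : CC R) = reC x + reC y * imC R.
Proof. by apply/eqP; rewrite eq_complex /=; apply/andP; split; apply/eqP; ring. Qed.

Lemma absC_line x y : absC (reC x + reC y * imC R) <= `|x| + `|y|.
Proof. by rewrite (le_trans (absCD _ _))// absCM !absC_reC absC_imC mulr1. Qed.

(* Expanding along the imaginary direction first produces exactly the derivatives
   [pxy F a b], so symmetry of mixed derivatives is not needed. *)
Lemma taylor_bound F rho N : 0 < rho -> smooth1_on (fun z => absC z < rho) F ->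
  exists K eta : R, [/\ 0 <= K, 0 < eta & forall z, absC z < eta ->
    `|F z - \sum_(j < N) taylor_hom F j z| <= K * absC z ^+ N].
Proof.
move=> rho0 sF; pose dl a b := nseq a (1 : CC R) ++ nseq b (imC R).
have [K [eta [K0 eta0 er HK]]] := iterD1_bounded [seq dl (N - b)%N b | b <- iota 0 N.+1] rho0 sF.
have {}HK b z : (b <= N)%N -> absC z < eta -> `|iterD1 F (dl (N - b)%N b) z| <= K.
  by move=> bN; apply: HK; apply/mapP; exists b => //; rewrite mem_iota.
(* One error [K] comes from the expansion in the imaginary direction and one from each of its [N]
   coefficients, expanded in the real direction. With |x| and |y| at most eta / 2, all intermediate
   points stay in the disc of radius [eta]. *)
exists (K * N.+1%:R), (eta / 2); split; [by rewrite mulr_ge0|by rewrite divr_gt0|].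
case=> x y zeta; set z := Complex x y in zeta *.
have xz : `|x| <= absC z by exact: (absC_Re z).
have yz : `|y| <= absC z by exact: (absC_Im z).
have line x' y' : `|x'| <= eta / 2 -> `|y'| < eta / 2 -> absC (reC x' + reC y' * imC R) < eta.
  by move=> h1 h2; have := absC_line x' y'; lra.
have xeta := le_lt_trans xz zeta; have yeta := le_lt_trans yz zeta.
have r0 : reC 0 = 0 :> CC R by [].
have E1 : `|F z - \sum_(b < N) iterD1 F (dl 0 b) (reC x) / b`!%:R * y ^+ b| <= K * `|y| ^+ N.
  have := @taylor_line N (fun n y => iterD1 F (dl 0 n) (reC x + reC y * imC R)) (eta / 2) K K0.
  rewrite /= r0 mul0r addr0 => H; rewrite /z Complex_line; apply: H => //.
    move=> n y' nN y'eta; apply: (@is_derive_line F _ (dl 0 n) (reC x) (imC R) y' sF).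
    apply: lt_le_trans er.
    by apply: line => //; exact: ltW.
  move=> y' y'eta; have := HK N (reC x + reC y' * imC R) (leqnn N); rewrite subnn; apply.
  by apply: line => //; exact: ltW.
have E2 b : (b < N)%N -> `|iterD1 F (dl 0 b) (reC x) -
    \sum_(a < N - b) pxy F a b 0 / a`!%:R * x ^+ a| <= K * `|x| ^+ (N - b).
  move=> bN.
  have := @taylor_line (N - b) (fun n x => iterD1 F (dl n b) (reC x)) (eta / 2) K K0.
  rewrite /= r0 => H; apply: H => //.
    move=> n y' nN y'eta; have := @is_derive_line F _ (dl n b) 0 1 y' sF.
    have -> : (fun t => iterD1 F (dl n b) (0 + reC t * 1)) = (fun t => iterD1 F (dl n b) (reC t)).
      by apply/funext => t; rewrite add0r mulr1.
    by rewrite add0r mulr1 absC_reC; apply; lra.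
  move=> y' y'eta; apply: HK; first exact: ltnW.
  by rewrite absC_reC; lra.
have -> : \sum_(j < N) taylor_hom F j z =
    \sum_(b < N) (\sum_(a < N - b) pxy F a b 0 / a`!%:R * x ^+ a) / b`!%:R * y ^+ b.
  rewrite -(sum_triangle N (fun a b => pxy F a b 0 / (a`! * b`!)%:R * x ^+ a * y ^+ b)).
  apply: eq_bigr => b _; rewrite !mulr_suml; apply: eq_bigr => a _.
  by rewrite natrM invfM; ring.
set S := \sum_(b < N) iterD1 F (dl 0 b) (reC x) / b`!%:R * y ^+ b in E1.
rewrite -[F z](subrK S) -addrA; apply: le_trans (ler_normD _ _) _.
rewrite -natr1 mulrDr mulr1 mulrDl [leLHS]addrC; apply: lerD; last first.
  apply: le_trans E1 _; rewrite ler_wpM2l// lerXn2r ?nnegrE//; exact: absC_ge0.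
rewrite /S -sumrB (le_trans (ler_norm_sum _ _ _))//.
have -> : K * N%:R * absC z ^+ N = \sum_(b < N) K * absC z ^+ N.
  by rewrite sumr_const card_ord -mulrA mulr_natl -mulrnAr.
apply: ler_sum => b _; rewrite -!mulrBl normrM normrM.
have bN : (b <= N)%N by exact: ltnW.
have -> : absC z ^+ N = absC z ^+ (N - b) * absC z ^+ b by rewrite -exprD subnK.
rewrite mulrA; apply: ler_pM; [by rewrite mulr_ge0|by []| |].
  rewrite -[leRHS]mulr1; apply: ler_pM => //.
    apply: le_trans (E2 _ (ltn_ord b)) _; rewrite ler_wpM2l// lerXn2r ?nnegrE//.
    exact: absC_ge0.
  by rewrite ger0_norm ?invr_ge0// invf_le1 ?ler1n ?fact_gt0// ltr0n fact_gt0.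
by rewrite normrX lerXn2r ?nnegrE// absC_ge0.
Qed.

(** Letting s tend to 0 kills the constant coefficient; dividing by s gives the induction. This is
    how bounds along a ray isolate single Taylor terms. *)
Lemma poly_small (h : nat -> R) m N K eta : 0 < eta ->
  (forall s, 0 < s < eta -> `|\sum_(k < m) h k * s ^+ k| <= K * s ^+ N) ->
  forall k, (k < N)%N -> (k < m)%N -> h k = 0.
Proof.
move=> eta0; elim: N h m => [//|N ih] h [//|m] H.
have split s : \sum_(k < m.+1) h k * s ^+ k = h 0 + s * \sum_(k < m) h k.+1 * s ^+ k.
  rewrite big_ord_recl expr0 mulr1 mulr_sumr; congr (_ + _).
  by apply: eq_bigr => i _; rewrite exprS; ring.
have h0 : h 0 = 0.
  pose B := \sum_(k < m) `|h k.+1|.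
  have B0 : 0 <= B by apply: sumr_ge0.
  apply/eqP; rewrite -normr_le0; apply/ler_addgt0Pr => e e0; rewrite add0r.
  have q0 : 0 < `|K| + B + 1 by rewrite ltr_wpDl// addr_ge0.
  pose s := Num.min (eta / 2) (Num.min 1 (e / (`|K| + B + 1))).
  have s0 : 0 < s by rewrite !lt_min !divr_gt0 ?ltr01.
  have s1 : s <= 1 by rewrite !ge_min lexx !orbT.
  have se : s * (`|K| + B + 1) <= e by rewrite -ler_pdivlMr// !ge_min lexx !orbT.
  have seta : s < eta by apply: (@le_lt_trans _ _ (eta / 2)); [rewrite ge_min lexx|lra].
  clearbody s.
  have := H s; rewrite s0 seta split => /(_ isT) Hs.
  have A1 : `|s * \sum_(k < m) h k.+1 * s ^+ k| <= s * B.
    rewrite normrM gtr0_norm// ler_pM2l// (le_trans (ler_norm_sum _ _ _))//.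
    apply: ler_sum => k _; rewrite normrM ler_piMr// normrX (ger0_norm (ltW s0)).
    by rewrite exprn_ile1// ltW.
  have A2 : K * s ^+ N.+1 <= s * `|K|.
    rewrite exprS mulrCA ler_pM2l//; apply: le_trans (ler_norm _) _.
    by rewrite normrM ler_piMr// normrX (ger0_norm (ltW s0)) exprn_ile1// ltW.
  have := ler_normB (h 0 + s * \sum_(k < m) h k.+1 * s ^+ k) (s * \sum_(k < m) h k.+1 * s ^+ k).
  by rewrite addrK; lra.
case=> [//|k] kN km; apply: (ih (fun k => h k.+1) m) => // s s0e.
have := H s s0e; rewrite split h0 add0r normrM.
have /andP[s0 _] := s0e.
by rewrite gtr0_norm// exprS mulrCA ler_pM2l.
Qed.

Lemma taylor_homZ F j s z : taylor_hom F j (reC s * z) = s ^+ j * taylor_hom F j z.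
Proof.
rewrite /taylor_hom mulr_sumr; apply: eq_bigr => a _.
have aj : (a <= j)%N by rewrite -ltnS.
have -> : s ^+ j = s ^+ a * s ^+ (j - a) by rewrite -exprD subnKC.
by case: z => x y /=; rewrite !mul0r subr0 addr0 !exprMn; ring.
Qed.

(** On the ray through z, the Taylor polynomial is a polynomial in s whose coefficients are the
    homogeneous parts at z; it is O(s^(j+1)), so the parts of degree at most j vanish. *)
Lemma flat_of_small F rho : 0 < rho -> smooth1_on (fun z => absC z < rho) F ->
  (forall N, exists K eta : R, 0 < eta /\ forall z, absC z < eta -> `|F z| <= K * absC z ^+ N) ->
  flat_at0 F.
Proof.
move=> rho0 sF HF.
have T0 j z : taylor_hom F j z = 0.
  have [K [eta [K0 eta0 HK]]] := taylor_bound j.+1 rho0 sF.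
  have [K' [eta' [eta'0 HK']]] := HF j.+1.
  have z1 : 0 < absC z + 1 by rewrite ltr_wpDl// absC_ge0.
  pose m := Num.min eta eta' / (absC z + 1).
  have m0 : 0 < m by rewrite divr_gt0// lt_min eta0.
  apply: (@poly_small (fun j => taylor_hom F j z) j.+1 j.+1 ((K + K') * absC z ^+ j.+1) m m0) => //.
  move=> s /andP[s0]; rewrite ltr_pdivlMr// lt_min => /andP[s1 s2].
  have sE : absC (reC s * z) = s * absC z by rewrite absCM absC_reC gtr0_norm.
  have sle : s * absC z <= s * (absC z + 1) by rewrite ler_pM2l// lerDl.
  have := HK (reC s * z); have := HK' (reC s * z); rewrite sE.
  move=> /(_ (le_lt_trans sle s2)) A /(_ (le_lt_trans sle s1)) B.
  have -> : \sum_(k < j.+1) taylor_hom F k z * s ^+ k = \sum_(k < j.+1) taylor_hom F k (reC s * z).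
    by apply: eq_bigr => k _; rewrite taylor_homZ mulrC.
  have := ler_normB (F (reC s * z)) (F (reC s * z) - \sum_(k < j.+1) taylor_hom F k (reC s * z)).
  by rewrite opprB addrCA subrr addr0; rewrite exprMn in A B; lra.
move=> a b.
(* A homogeneous part that vanishes identically is evaluated at s + i, where it is a polynomial in s
   with the normalised derivatives as coefficients. *)
have c0 : pxy F a (a + b - a) 0 / (a`! * (a + b - a)`!)%:R = 0.
  apply: (@poly_small (fun a' => pxy F a' (a + b - a') 0 / (a'`! * (a + b - a')`!)%:R) (a + b).+1 (a + b).+1 0 1 ltr01).
  - move=> s _; rewrite mul0r normr_le0; apply/eqP.
    rewrite -[RHS](T0 (a + b)%N (Complex s 1)) /taylor_hom; apply: eq_bigr => i _.
    by rewrite /= expr1n mulr1.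
  - by rewrite ltnS leq_addr.
  - by rewrite ltnS leq_addr.
rewrite addKn in c0; have f0 : (a`! * b`!)%:R != 0 :> R.
  by rewrite pnatr_eq0 -lt0n muln_gt0 !fact_gt0.
by move/eqP: c0; rewrite mulf_eq0 invr_eq0 (negbTE f0) orbF => /eqP.
Qed.

Lemma small_of_flat F rho : 0 < rho -> smooth1_on (fun z => absC z < rho) F ->
  flat_at0 F -> forall N, exists K eta : R, [/\ 0 <= K, 0 < eta & forall z, absC z < eta -> `|F z| <= K * absC z ^+ N].
Proof.
move=> rho0 sF fF N; have [K [eta [K0 eta0 HK]]] := taylor_bound N rho0 sF.
exists K, eta; split => // z zeta; have := HK z zeta.
rewrite big1 ?subr0// => j _; rewrite /taylor_hom big1// => a _.
by rewrite fF !mul0r.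
Qed.

End RealTaylor.

(** * Closure properties of smooth functions *)

Section Smoothness.
Variable R : realType.
Implicit Types (z w d : CC R) (s x y K : R) (F G : CC R -> R) (ds : seq (CC R))
  (U : set (CC R)).

Lemma dist_is_derive (f : R -> R) x l :
  (forall e, 0 < e -> exists2 d, 0 < d & forall h, `|h| < d ->
    `|f (x + h) - f x - l * h| <= e * `|h|) -> is_derive x 1 f l.
Proof.
move=> H.
have L : (fun h : R => h^-1 *: ((f \o shift x) (h *: 1) - f x)) @ 0^' --> l.
  apply/cvgrPdist_le => e e0; have [d d0 Hd] := H e e0.
  rewrite near_withinE; apply/nbhs_ballP; exists d => //= h.
  rewrite /ball /= sub0r normrN => hd h0.
  have -> : l - h^-1 *: ((f \o shift x) (h *: 1) - f x) = - ((f (x + h) - f x - l * h) / h).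
    by rewrite /= /GRing.scale /= mulr1 (addrC h); field.
  by rewrite normrN normrM normfV ler_pdivrMr ?normr_gt0//; exact: Hd.
by split; [apply/cvg_ex; exists l|apply/cvg_lim].
Qed.

Lemma near_line U z d : open U -> U z -> \forall t \near (0 : R), U (z + reC t * d).
Proof.
move=> oU Uz; have /nbhsCP[e e0 He] : nbhs z U by exact: open_nbhs_nbhs.
have d1 : 0 < absC d + 1 by rewrite ltr_wpDl// absC_ge0.
apply/nbhs_ballP; exists (e / (absC d + 1)); first by rewrite /= divr_gt0.
move=> t; rewrite /ball /= sub0r normrN ltr_pdivlMr// => ht; apply: He.
rewrite addrAC subrr add0r absCM absC_reC; apply: le_lt_trans ht.
by rewrite ler_wpM2l// lerDl.
Qed.

(** Smoothness follows from a guessed formula [A] for all iterated directional derivatives, once the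
    guess is continuous and satisfies the recursion defining [iterD1]. *)
Lemma smooth1_family U F (A : seq (CC R) -> CC R -> R) : open U ->
  (forall z, U z -> F z = A [::] z) ->
  (forall ds z d, U z -> is_derive (0 : R) 1 (fun t => A ds (z + reC t * d)) (A (d :: ds) z)) ->
  (forall ds z, U z -> {for z, continuous (A ds)}) -> smooth1_on U F.
Proof.
move=> oU H0 HD HC.
have E ds : forall z, U z -> iterD1 F ds z = A ds z.
  elim: ds => [|d ds ih] z Uz; first exact: H0.
  rewrite /= /rD1 derive1E.
  have [_ <-] := HD ds z d Uz; apply: near_eq_derive.
  by apply: filterS (near_line d oU Uz) => t; exact: ih.
move=> ds; split.
  move=> z d Uz; have [D _] := HD ds z d Uz; apply: near_eq_derivable D.
  by apply: filterS (near_line d oU Uz) => t /E.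
rewrite continuous_open_subspace// => z; rewrite inE => Uz.
apply/continuousRP => e e0; have /continuousRP/(_ e e0) := HC ds z Uz.
apply: filterS2; last exact: (open_nbhs_nbhs (conj oU Uz)).
by move=> w h Uw; rewrite !E.
Qed.

Lemma smooth1_continuous U F ds z : open U -> smooth1_on U F -> U z ->
  {for z, continuous (iterD1 F ds)}.
Proof. by move=> oU sF Uz; have [_ cF] := sF ds; exact: within_open_continuous cF Uz. Qed.

Lemma smooth1_is_derive U F ds z d : smooth1_on U F -> U z ->
  is_derive (0 : R) 1 (fun t => iterD1 F ds (z + reC t * d)) (iterD1 F (d :: ds) z).
Proof.
move=> sF Uz; have [/(_ z d Uz) D _] := sF ds.
by rewrite /= /rD1 derive1E; exact: derivableP.
Qed.

Lemma smooth1D U F G : open U -> smooth1_on U F -> smooth1_on U G ->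
  smooth1_on U (fun z => F z + G z).
Proof.
move=> oU sF sG.
apply: (@smooth1_family U _ (fun ds z => iterD1 F ds z + iterD1 G ds z)) => //.
- move=> ds z d Uz; have dF := smooth1_is_derive ds d sF Uz.
  have dG := smooth1_is_derive ds d sG Uz.
  exact: (is_deriveD dF dG).
- move=> ds z Uz; have cF := @smooth1_continuous U F ds z oU sF Uz.
  have cG := @smooth1_continuous U G ds z oU sG Uz.
  exact: (cvgD cF cG).
Qed.

Lemma smooth1_subset U (V : set (CC R)) F : open U -> open V -> V `<=` U -> smooth1_on U F -> smooth1_on V F.
Proof.
move=> oU oV VU sF ds; have [D C] := sF ds; split.
  by move=> z d /VU; exact: D.
exact: continuous_subspaceW C.
Qed.

Lemma is_derive_Re_line (H : CC R -> CC R) z l c d : is_cderiv H z l ->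
  is_derive (0 : R) 1 (fun t => complex.Re (c * H (z + reC t * d) : R[i]))
    (complex.Re (c * (l * d) : R[i])).
Proof.
move=> HH; apply: dist_is_derive => e e0.
have C0 : 0 < absC c + 1 by rewrite ltr_wpDl// absC_ge0.
have D0 : 0 < absC d + 1 by rewrite ltr_wpDl// absC_ge0.
have [r r0 Hr] := HH (e / ((absC c + 1) * (absC d + 1))) (divr_gt0 e0 (mulr_gt0 C0 D0)).
exists (r / (absC d + 1)); first exact: divr_gt0.
move=> h; rewrite ltr_pdivlMr// => hr; rewrite add0r.
have h0 : 0 <= `|h| by [].
have kE : absC (reC h * d) = `|h| * absC d by rewrite absCM absC_reC.
have kle : `|h| * absC d <= `|h| * (absC d + 1) by rewrite ler_wpM2l// lerDl.
have := Hr (reC h * d); rewrite kE => /(_ (le_lt_trans kle hr)) X.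
have -> : z + reC 0 * d = z by rewrite (_ : reC 0 = 0)// mul0r addr0.
have -> : complex.Re (c * (l * d) : R[i]) * h = complex.Re (c * (l * (reC h * d)) : R[i]).
  by case: c {C0 X Hr} => c1 c2; case: l {HH} => l1 l2; case: d {D0 hr kE kle} => d1 d2 /=; ring.
rewrite -!raddfB /=.
have -> : c * H (z + reC h * d) - c * H z - c * (l * (reC h * d)) =
   c * (H (z + reC h * d) - H z - l * (reC h * d)) :> CC R by ring.
apply: le_trans (absC_Re _) _; rewrite absCM.
apply: le_trans (ler_wpM2l (absC_ge0 c) X) _.
apply: le_trans (_ : (absC c + 1) * (e / ((absC c + 1) * (absC d + 1)) * (`|h| * (absC d + 1))) <= _).
  have q0 : 0 <= e / ((absC c + 1) * (absC d + 1)) by rewrite ltW// divr_gt0// mulr_gt0.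
  apply: ler_pM; rewrite ?absC_ge0//; last exact: ler_wpM2l.
    by rewrite mulr_ge0// mulr_ge0// absC_ge0.
  by rewrite lerDl.
rewrite le_eqVlt; apply/orP; left; apply/eqP; field.
by rewrite !gt_eqF.
Qed.

(** The derivative of Re h along d1, ..., dn is the real part of d1 ... dn times the n-th complex
    derivative of h; this is the family given to [smooth1_family]. *)
Lemma smooth1_Re_holo rho (h : CC R -> CC R) : (forall z, absC z < rho -> derivable h z 1) ->
  smooth1_on (fun z => absC z < rho) (fun z => complex.Re (h z : R[i])).
Proof.
move=> dh.
have dn n z : absC z < rho -> derivable (iter n (@cder R) h) z 1.
  exact: derivable_iter_cder.
pose prodC (ds : seq (CC R)) : CC R := foldr (fun a b => a * b) 1 ds.
apply: (@smooth1_family _ _ (fun ds z => complex.Re (prodC ds * iter (size ds) (@cder R) h z : R[i]))).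
- exact: open_disc.
- by move=> z _; rewrite /= mul1r.
- move=> ds z d zr; rewrite /=.
  have H : is_cderiv (iter (size ds) (@cder R) h) z (cder (iter (size ds) (@cder R) h) z).
    by apply/cderiv_is_derive/derivableP; exact: dn.
  have -> : d * prodC ds * cder (iter (size ds) (@cder R) h) z =
     prodC ds * (cder (iter (size ds) (@cder R) h) z * d) by ring.
  exact: is_derive_Re_line H.
- move=> ds z zr.
  apply: (@continuous_comp _ _ _ (fun z => prodC ds * iter (size ds) (@cder R) h z)
    (fun w : CC R => complex.Re (w : R[i]))); last exact: continuous_Re.
  apply: continuousCM; first exact: cst_continuous.
  by apply: derivableC_continuous; exact: dn.
Qed.

End Smoothness.

(** * Defining functions and changes of coordinates *)

Section DefiningFunctions.
Variable R : realType.
Implicit Types (z w d : CC R) (s t x y K : R) (F G : CC R -> R) (r : CC R * CC R -> R)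
  (p q : CC R * CC R) (U : set (CC R * CC R)).

(** From [z2] to [z1] by a real and then an imaginary step, with the mean value theorem on each.
    Each step has length at most rho / 3, so the path stays within 5 rho / 6 of [z0]. *)
Lemma lipschitz_C F (D : CC R -> CC R -> R) z0 rho K : 0 < rho -> 0 <= K ->
  (forall z d, absC (z - z0) < rho -> absC d = 1 ->
     is_derive (0 : R) 1 (fun t => F (z + reC t * d)) (D d z)) ->
  (forall z, absC (z - z0) < rho -> `|D 1 z| <= K) ->
  (forall z, absC (z - z0) < rho -> `|D (imC R) z| <= K) ->
  forall z1 z2, absC (z1 - z0) <= rho / 6 -> absC (z2 - z0) <= rho / 6 ->
    `|F z1 - F z2| <= 2 * K * absC (z1 - z2).
Proof.
move=> rho0 K0 HD H1 Hi z1 z2 h1 h2.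
have step z d t : absC d = 1 -> (forall z, absC (z - z0) < rho -> `|D d z| <= K) ->
    absC (z - z0) + `|t| < rho -> `|F (z + reC t * d) - F z| <= K * `|t|.
  move=> d1 Hd ht.
  have inb x : `|x| <= `|t| -> absC (z + reC x * d - z0) < rho.
    move=> xt; rewrite addrAC; apply: le_lt_trans (absCD _ _) _.
    by rewrite absCM d1 absC_reC mulr1; lra.
  have [|x xt E] := @MVT_abs R (fun t => F (z + reC t * d)) (fun t => D d (z + reC t * d)) t.
    move=> x xt; have Hx := HD _ d (inb x xt) d1.
    exact: is_derive_on_line Hx.
  have r0 : reC 0 * d = 0 by rewrite (_ : reC 0 = 0)// mul0r.
  rewrite r0 addr0 in E; rewrite E normrM ler_wpM2r//.
  by apply: Hd; exact: inb.
pose v := z1 - z2; pose x := complex.Re (v : R[i]); pose y := complex.Im (v : R[i]).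
have vE : absC v <= 2 * (rho / 6).
  by have := absC_triangle z0 z1 z2; rewrite (absCBC z0) -/v; lra.
have xv : `|x| <= absC v := absC_Re v; have yv : `|y| <= absC v := absC_Im v.
have E : z1 = z2 + reC x * 1 + reC y * imC R.
  have -> : z2 + reC x * 1 + reC y * imC R = z2 + (reC x + reC y * imC R) by ring.
  rewrite -Complex_line -[LHS](subrK z2) addrC -/v; congr (_ + _).
  by rewrite /x /y; case: (v).
have S1 : `|F (z2 + reC x * 1) - F z2| <= K * `|x|.
  by apply: step H1 _; [exact: absC1|lra].
have S2 : `|F z1 - F (z2 + reC x * 1)| <= K * `|y|.
  rewrite [X in F X - _]E; apply: step Hi _; first exact: absC_imC.
  rewrite addrAC; have := absCD (z2 - z0) (reC x * 1); rewrite mulr1 absC_reC; lra.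
have := ler_normD (F z1 - F (z2 + reC x * 1)) (F (z2 + reC x * 1) - F z2).
have kx : K * `|x| <= K * absC v by rewrite ler_wpM2l.
have ky : K * `|y| <= K * absC v by rewrite ler_wpM2l.
by rewrite addrA subrK -/v; lra.
Qed.

Lemma smooth1_lipschitz F rho : 0 < rho -> smooth1_on (fun z => absC z < rho) F ->
  exists L e : R, [/\ 0 <= L, 0 < e & forall z1 z2, absC z1 <= e -> absC z2 <= e ->
    `|F z1 - F z2| <= L * absC (z1 - z2)].
Proof.
move=> rho0 sF.
have [K [eta [K0 eta0 er HK]]] := iterD1_bounded [:: [:: 1]; [:: imC R]] rho0 sF.
exists (2 * K), (eta / 6); split; [by rewrite mulr_ge0|by rewrite divr_gt0|].
move=> z1 z2 h1 h2.
apply: (@lipschitz_C F (fun d => iterD1 F [:: d]) 0 eta K eta0 K0); rewrite ?subr0//.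
- move=> z d; rewrite subr0 => zeta _.
  exact: (@smooth1_is_derive R _ F [::] z d sF (lt_le_trans zeta er)).
- by move=> z; rewrite subr0; apply: HK; rewrite inE eqxx.
- by move=> z; rewrite subr0; apply: HK; rewrite !inE eqxx orbT.
Qed.

Lemma smooth2_near U r ds p e : open U -> smooth2_on U r -> U p -> 0 < e ->
  exists2 d : R, 0 < d & forall q, absC (q.1 - p.1) < d -> absC (q.2 - p.2) < d ->
    U q /\ `|iterD2 r ds q - iterD2 r ds p| < e.
Proof.
move=> oU sr Up e0; apply/nbhsC2P; apply: filterI.
  exact: open_nbhs_nbhs.
have [_ c] := sr ds.
by have /continuousRP := within_open_continuous oU c Up; apply.
Qed.

Lemma smooth2_dir_bounded U r p (d : CC R * CC R) : open U -> smooth2_on U r -> U p ->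
  exists K e : R, [/\ 0 <= K, 0 < e & forall q, absC (q.1 - p.1) < e -> absC (q.2 - p.2) < e ->
    U q /\ `|iterD2 r [:: d] q| <= K].
Proof.
move=> oU sr Up; have [e e0 He] := smooth2_near [:: d] oU sr Up ltr01.
exists (`|iterD2 r [:: d] p| + 1), e; split; [by rewrite addr_ge0|exact: e0|].
move=> q h1 h2; have [Uq /ltW Hq] := He q h1 h2; split=> //.
have := ler_normD (iterD2 r [:: d] q - iterD2 r [:: d] p) (iterD2 r [:: d] p).
by rewrite subrK => /le_trans; apply; rewrite addrC lerD2l.
Qed.

Lemma smooth2_lipschitz U r p : open U -> smooth2_on U r -> U p ->
  exists L e : R, [/\ 0 <= L, 0 < e & forall q1 q2 : CC R * CC R,
    absC (q1.1 - p.1) <= e -> absC (q1.2 - p.2) <= e ->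
    absC (q2.1 - p.1) <= e -> absC (q2.2 - p.2) <= e ->
    `|r q1 - r q2| <= L * (absC (q1.1 - q2.1) + absC (q1.2 - q2.2))].
Proof.
move=> oU sr Up.
have [K1 [e1 [K10 e10 H1]]] := smooth2_dir_bounded (1, 0) oU sr Up.
have [K2 [e2 [K20 e20 H2]]] := smooth2_dir_bounded (imC R, 0) oU sr Up.
have [K3 [e3 [K30 e30 H3]]] := smooth2_dir_bounded (0, 1) oU sr Up.
have [K4 [e4 [K40 e40 H4]]] := smooth2_dir_bounded (0, imC R) oU sr Up.
have [K [K0 KK1 KK2 KK3 KK4]] : exists K, [/\ 0 <= K, K1 <= K, K2 <= K, K3 <= K & K4 <= K].
  by exists (K1 + K2 + K3 + K4); split; lra.
have [e [e0 ee1 ee2 ee3 ee4]] : exists e, [/\ 0 < e, e <= e1, e <= e2, e <= e3 & e <= e4].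
  exists (Num.min (Num.min e1 e2) (Num.min e3 e4)); split.
  - by rewrite !lt_min e10 e20 e30.
  - by rewrite !ge_min lexx.
  - by rewrite !ge_min lexx !orbT.
  - by rewrite !ge_min lexx !orbT.
  - by rewrite !ge_min lexx !orbT.
have B1 q : absC (q.1 - p.1) < e -> absC (q.2 - p.2) < e -> `|iterD2 r [:: (1, 0)] q| <= K.
  by move=> h h'; have [_ /le_trans] := H1 q (lt_le_trans h ee1) (lt_le_trans h' ee1); apply.
have B2 q : absC (q.1 - p.1) < e -> absC (q.2 - p.2) < e -> `|iterD2 r [:: (imC R, 0)] q| <= K.
  by move=> h h'; have [_ /le_trans] := H2 q (lt_le_trans h ee2) (lt_le_trans h' ee2); apply.
have B3 q : absC (q.1 - p.1) < e -> absC (q.2 - p.2) < e -> `|iterD2 r [:: (0, 1)] q| <= K.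
  by move=> h h'; have [_ /le_trans] := H3 q (lt_le_trans h ee3) (lt_le_trans h' ee3); apply.
have B4 q : absC (q.1 - p.1) < e -> absC (q.2 - p.2) < e -> `|iterD2 r [:: (0, imC R)] q| <= K.
  by move=> h h'; have [_ /le_trans] := H4 q (lt_le_trans h ee4) (lt_le_trans h' ee4); apply.
have UB q : absC (q.1 - p.1) < e -> absC (q.2 - p.2) < e -> U q.
  by move=> h h'; have [] := H1 q (lt_le_trans h ee1) (lt_le_trans h' ee1).
have D q (d : CC R * CC R) : absC (q.1 - p.1) < e -> absC (q.2 - p.2) < e ->
    is_derive (0 : R) 1 (fun t => r (q.1 + reC t * d.1, q.2 + reC t * d.2)) (iterD2 r [:: d] q).
  move=> h h'; have [/(_ q d (UB q h h')) dr _] := sr [::].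
  by rewrite /= /rD2 derive1E; exact: derivableP.
exists (2 * K), (e / 6); split; [by rewrite mulr_ge0|by rewrite divr_gt0|].
have e5 x : x <= e / 6 -> x < e by lra.
move=> [z1 w1] [z2 w2] /= h1 h2 h3 h4.
have D1 z d : absC (z - p.1) < e -> absC d = 1 ->
    is_derive (0 : R) 1 (fun t => r (z + reC t * d, w1)) (iterD2 r [:: (d, 0)] (z, w1)).
  move=> zd _; have := D (z, w1) (d, 0) zd (e5 _ h2).
  have -> // : (fun t => r ((z, w1).1 + reC t * (d, 0 : CC R).1, (z, w1).2 + reC t * (d, 0 : CC R).2)) =
    (fun t => r (z + reC t * d, w1)).
  by apply/funext => t /=; rewrite mulr0 addr0.
have D2 w d : absC (w - p.2) < e -> absC d = 1 ->
    is_derive (0 : R) 1 (fun t => r (z2, w + reC t * d)) (iterD2 r [:: (0, d)] (z2, w)).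
  move=> wd _; have := D (z2, w) (0, d) (e5 _ h3) wd.
  have -> // : (fun t => r ((z2, w).1 + reC t * (0 : CC R, d).1, (z2, w).2 + reC t * (0 : CC R, d).2)) =
    (fun t => r (z2, w + reC t * d)).
  by apply/funext => t /=; rewrite mulr0 addr0.
have A1 := @lipschitz_C (fun z => r (z, w1)) (fun d z => iterD2 r [:: (d, 0)] (z, w1)) p.1 e K e0 K0
  D1 (fun z zd => B1 (z, w1) zd (e5 _ h2)) (fun z zd => B2 (z, w1) zd (e5 _ h2)) z1 z2 h1 h3.
have A2 := @lipschitz_C (fun w => r (z2, w)) (fun d w => iterD2 r [:: (0, d)] (z2, w)) p.2 e K e0 K0
  D2 (fun w wd => B3 (z2, w) (e5 _ h3) wd) (fun w wd => B4 (z2, w) (e5 _ h3) wd) w1 w2 h2 h4.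
rewrite /= in A1 A2.
have := ler_normD (r (z1, w1) - r (z2, w1)) (r (z2, w1) - r (z2, w2)).
by rewrite addrA subrK; lra.
Qed.

(** The slopes [x1] and [x2] have the sign of [a] and size at least |a| / 2, so over the length [T]
    each produces a change of at least |u|, in opposite directions on the two sides. The min/max
    form is the sign hypothesis of [IVT]. *)
Lemma root_bracket (a x1 x2 T u g1 g2 : R) : 0 <= T -> `|a| * T = 2 * `|u| ->
  `|x1 - a| < `|a| / 2 -> `|x2 - a| < `|a| / 2 ->
  g1 - u = x1 * T -> g2 - u = x2 * - T ->
  Num.min g2 g1 <= 0 <= Num.max g2 g1.
Proof.
move=> T0 aT /ltr_normlP[p1 p2] /ltr_normlP[q1 q2] E1 E2.
have un := ler_norm u; have un' := ler_norm (- u); rewrite normrN in un'.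
have [ap|an] := leP 0 a.
  rewrite (ger0_norm ap) in p1 p2 q1 q2 aT.
  have y1 : a / 2 * T <= x1 * T by rewrite ler_wpM2r//; lra.
  have y2 : a / 2 * T <= x2 * T by rewrite ler_wpM2r//; lra.
  by apply/andP; split; rewrite ?ge_min ?le_max; apply/orP; [left|right]; lra.
rewrite (ltr0_norm an) in p1 p2 q1 q2 aT.
have y1 : x1 * T <= a / 2 * T by rewrite ler_wpM2r//; lra.
have y2 : x2 * T <= a / 2 * T by rewrite ler_wpM2r//; lra.
by apply/andP; split; rewrite ?ge_min ?le_max; apply/orP; [right|left]; lra.
Qed.

(* Along a direction in which r has nonzero derivative, r vanishes within
   distance O(|r q|) of q, by the intermediate value theorem. *)
Lemma smooth2_zero_near U r p (d : CC R * CC R) : open U -> smooth2_on U r -> U p -> r p = 0 ->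
  rD2 r d p != 0 -> forall e, 0 < e ->
  exists C e' : R, [/\ 0 <= C, 0 < e' & forall q, absC (q.1 - p.1) < e' -> absC (q.2 - p.2) < e' ->
    exists t, [/\ `|t| <= C * `|r q|, `|t| < e & r (q.1 + reC t * d.1, q.2 + reC t * d.2) = 0]].
Proof.
move=> oU sr Up rp0 rd0 e e0.
pose a := rD2 r d p; have a0 : 0 < `|a| by rewrite normr_gt0.
have [e1 e10 H1] := @smooth2_near U r [:: d] p (`|a| / 2) oU sr Up (divr_gt0 a0 (ltr0Sn _ 1)).
pose D := absC d.1 + absC d.2 + 1.
have D0 : 0 < D by rewrite ltr_wpDl// addr_ge0// absC_ge0.
have d1D : absC d.1 <= D by rewrite /D; have := absC_ge0 d.2; lra.
have d2D : absC d.2 <= D by rewrite /D; have := absC_ge0 d.1; lra.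
pose T0 := Num.min e (e1 / (2 * D)).
have T00 : 0 < T0 by rewrite lt_min e0 divr_gt0// mulr_gt0.
have T0e : T0 <= e by rewrite ge_min lexx.
have T0D : T0 * D <= e1 / 2.
  have : T0 <= e1 / (2 * D) by rewrite ge_min lexx orbT.
  by rewrite invfM mulrA ler_pdivlMr.
clearbody T0.
have [e2 e20 H2] := @smooth2_near U r [::] p (T0 * `|a| / 2) oU sr Up (divr_gt0 (mulr_gt0 T00 a0) (ltr0Sn _ 1)).
exists (2 / `|a|), (Num.min (e1 / 2) e2); split.
- by rewrite divr_ge0.
- by rewrite lt_min divr_gt0.
move=> q; rewrite !lt_min => /andP[q1 q2] /andP[q3 q4].
have [_] := H2 q q2 q4; rewrite /= rp0 subr0 => rq.
(* A slope of size at least |a| / 2 over this length changes [r] by at least its value at [q]. *)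
pose T := 2 / `|a| * `|r q|.
have T_ge0 : 0 <= T by rewrite mulr_ge0// divr_ge0.
have aT : `|a| * T = 2 * `|r q| by rewrite /T; field; rewrite gt_eqF.
have TT : T < T0.
  by rewrite /T mulrAC ltr_pdivrMr// mulrC; lra.
pose g t := r (q.1 + reC t * d.1, q.2 + reC t * d.2).
pose g' t := iterD2 r [:: d] (q.1 + reC t * d.1, q.2 + reC t * d.2).
have inb t : `|t| <= T -> U (q.1 + reC t * d.1, q.2 + reC t * d.2) /\ `|g' t - a| < `|a| / 2.
  move=> tT.
  have tD (c : CC R) : absC c <= D -> absC (reC t * c) <= e1 / 2.
    move=> cD; rewrite absCM absC_reC; apply: le_trans T0D; apply: ler_pM => //.
      exact: absC_ge0.
    by rewrite (le_trans tT)// ltW.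
  apply: H1; rewrite /= addrAC; apply: le_lt_trans (absCD _ _) _.
    by have := tD _ d1D; lra.
  by have := tD _ d2D; lra.
have dg t : `|t| <= T -> is_derive t 1 g (g' t).
  move=> tT; have [Ut _] := inb t tT; apply: is_derive_shifted.
  have [/(_ _ d Ut) dr _] := sr [::].
  rewrite /g; under eq_fun do rewrite !lineD.
  by rewrite /g' /= /rD2 derive1E; exact: derivableP.
have g0 : g 0 = r q.
  by rewrite /g (_ : reC 0 = 0)// !mul0r !addr0; case: (q).
have slope t : `|t| <= T -> exists2 x, `|x - a| < `|a| / 2 & g t - r q = x * t.
  move=> tT; have [|x xt E] := @MVT_abs R g g' t.
    by move=> x xt; apply: dg; exact: le_trans tT.
  by exists (g' x); [have [] := inb x (le_trans xt tT)|rewrite -g0].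
have [|x1 x1a E1] := slope T; first by rewrite ger0_norm.
have [|x2 x2a E2] := slope (- T); first by rewrite normrN ger0_norm.
have cg : {within `[- T, T], continuous g}.
  apply: derivable_within_continuous => t; rewrite in_itv /= => tT.
  have tT' : `|t| <= T by rewrite ler_norml.
  by have [] := dg t tT'.
have TT2 : - T <= T by rewrite ge0_cp.
have sgn : Num.min (g (- T)) (g T) <= 0 <= Num.max (g (- T)) (g T).
  exact: root_bracket T_ge0 aT x1a x2a E1 E2.
have [t tT gt] := IVT TT2 cg sgn.
have tT' : `|t| <= T by rewrite ler_norml; rewrite in_itv in tT.
exists t; split; [exact: tT'|exact: le_lt_trans tT' (lt_le_trans TT T0e)|exact: gt].
Qed.

End DefiningFunctions.

(** * Shearing a good coordinate *)

Section Shear.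
Variable R : realType.
Implicit Types (z w : CC R) (h : CC R -> CC R) (q : CC R * CC R) (U W : set (CC R * CC R)).

Lemma continuous_within (T V : topologicalType) (A : set T) (f : T -> V) :
  open A -> (forall t, A t -> {for t, continuous f}) -> {within A, continuous f}.
Proof.
by move=> oA H; rewrite continuous_open_subspace// => t; rewrite inE; exact: H.
Qed.

Lemma nbhs_shear h q W : {for q.1, continuous h} -> open W -> W (q.1, q.2 + h q.1) ->
  forall A, nbhs (q.1, q.2 + h q.1) A -> \forall v \near q, A (v.1, v.2 + h v.1).
Proof.
move=> /continuousCP ch oW Wq A /nbhsC2P[d d0 Hd].
have /nbhsCP[e e0 He] := ch (d / 2) (divr_gt0 d0 (ltr0Sn _ 1)).
apply/nbhsC2P; exists (Num.min e (d / 2)); first by rewrite lt_min e0 divr_gt0.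
move=> v; rewrite !lt_min => /andP[v1 v2] /andP[_ v4]; apply: Hd => /=; first by lra.
have -> : v.2 + h v.1 - (q.2 + h q.1) = (v.2 - q.2) + (h v.1 - h q.1) by ring.
by have := absCD (v.2 - q.2) (h v.1 - h q.1); have := He v.1 v1; lra.
Qed.

Lemma holo2c_shear W U h (f : CC R * CC R -> CC R) : open W -> open U ->
  (forall q, U q -> W (q.1, q.2 + h q.1) /\ derivable h q.1 1) ->
  holo2c_on W f -> holo2c_on U (fun q => f (q.1, q.2 + h q.1)).
Proof.
move=> oW oU HU hf; have [cf df] := hf; split.
  apply: continuous_within oU _ => q Uq; have [Wq dh] := HU q Uq.
  apply/continuousCP => e e0.
  have /continuousCP/(_ e e0) := within_open_continuous oW cf Wq.
  by move=> /(nbhs_shear (derivableC_continuous dh) oW Wq).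
move=> q Uq; have [Wq dh] := HU q Uq; split.
  apply: (@holo2c_comp R W f (fun z => z) (fun z => q.2 + h z) q.1 oW hf Wq).
    exact: derivableC_id.
  by apply: derivableCD; [exact: derivableC_cst|exact: dh].
apply: (@holo2c_comp R W f (fun=> q.1) (fun w => w + h q.1) q.2 oW hf Wq).
  exact: derivableC_cst.
by apply: derivableCD; [exact: derivableC_id|exact: derivableC_cst].
Qed.

Lemma open_shear W h rho : open W -> (forall z, absC z < rho -> derivable h z 1) ->
  open [set v : CC R * CC R | absC v.1 < rho /\ W (v.1, v.2 + h v.1)].
Proof.
move=> oW dh; rewrite openE => v /= [vr Wv]; apply: filterI.
  apply/nbhsC2P; exists (rho - absC v.1); first by rewrite subr_gt0.
  by move=> u uv _ /=; have := absCD (u.1 - v.1) v.1; rewrite subrK; lra.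
apply: (nbhs_shear (derivableC_continuous (dh _ vr)) oW Wv).
exact: open_nbhs_nbhs.
Qed.

Lemma Re_mul2 (w : CC R) : complex.Re ((2 : CC R) * w : R[i]) = 2 * complex.Re (w : R[i]).
Proof. by case: w => a b /=; rewrite addr0 mul0r subr0. Qed.

Lemma good_coordinate_shear M (p : CC R * CC R) Phi (F : CC R -> R) h (rho : R) :
  good_coordinate M p Phi F -> 0 < rho ->
  (forall z, absC z < rho -> derivable h z 1) -> h 0 = 0 ->
  (forall N, exists K eta : R, 0 < eta /\ forall z, absC z < eta ->
     `|F z + 2 * complex.Re (h z : R[i])| <= K * absC z ^+ N) ->
  exists Phi1 F1, good_coordinate M p Phi1 F1 /\ flat_at0 F1.
Proof.
move=> [U [[oU Up hPhi injPhi] [oW [Psi [hPsi PsiK]] Phip] [del [del0 [sF Udel]]] _ HM]] rho0 dh h0 Hflat.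
pose m := Num.min del rho.
have m0 : 0 < m by rewrite lt_min del0.
have mdel : m <= del by rewrite ge_min lexx.
have mrho : m <= rho by rewrite ge_min lexx orbT.
have dhm z : absC z < m -> derivable h z 1 by move=> zm; apply: dh; exact: lt_le_trans mrho.
pose Phi1 q := ((Phi q).1, (Phi q).2 - h (Phi q).1).
pose F1 z := F z + complex.Re ((2 : CC R) * h z : R[i]).
have sF1 : smooth1_on (fun z => absC z < m) F1.
  apply: smooth1D; first exact: open_disc.
    apply: smooth1_subset sF; [exact: open_disc|exact: open_disc|].
    by move=> z zm; exact: lt_le_trans mdel.
  apply: smooth1_Re_holo => z zm; apply: derivableCM; first exact: derivableC_cst.
  exact: dhm.
have fF1 : flat_at0 F1.
  apply: flat_of_small m0 sF1 _ => N; have [K [eta [eta0 HK]]] := Hflat N.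
  by exists K, eta; split=> // z zeta; rewrite /F1 Re_mul2; exact: HK.
pose W := Phi @` U.
pose U1 := [set q | U q /\ absC (Phi q).1 < m].
(* The image of [U1] under [Phi1], described through [W] and [h] so that [open_shear] shows that it
   is open. *)
pose W1 := [set v : CC R * CC R | absC v.1 < m /\ W (v.1, v.2 + h v.1)].
have [[cP1 dP1] [cP2 dP2]] := hPhi.
have oU1 : open U1.
  rewrite openE => q [Uq qm]; apply: filterI; first exact: open_nbhs_nbhs.
  have /continuousCP c1 := within_open_continuous oU cP1 Uq.
  have qm0 : 0 < m - absC (Phi q).1 by rewrite subr_gt0.
  apply: filterS (c1 _ qm0) => u /= hu.
  by have := absCD ((Phi u).1 - (Phi q).1) (Phi q).1; rewrite subrK; lra.
have oW1 : open W1 by exact: open_shear.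
have W1E : Phi1 @` U1 = W1.
  apply/seteqP; split=> [_ [q [Uq qm] <-]|v [vm [q Uq E]]].
    split=> //=; exists q => //; rewrite subrK; by case: (Phi q).
  have E1 : (Phi q).1 = v.1 by rewrite E.
  have E2 : (Phi q).2 = v.2 + h v.1 by rewrite E.
  exists q; first by split => //; rewrite E1.
  by rewrite /Phi1 E1 E2 addrK; case: (v).
exists Phi1, F1; split; last exact: fF1.
exists U1; split.
- split; first exact: oU1.
  + by split; [exact: Up|rewrite Phip absC0].
  + split; split.
    * apply: continuous_within oU1 _ => q [Uq _]; exact: within_open_continuous cP1 Uq.
    * by move=> q [Uq _]; exact: dP1.
    * apply: continuous_within oU1 _ => q [Uq qm].
      have c1 := within_open_continuous oU cP1 Uq.
      have c2 := within_open_continuous oU cP2 Uq.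
      have c3 : {for q, continuous (fun q => h (Phi q).1)}.
        exact: (continuous_comp c1 (derivableC_continuous (dhm _ qm))).
      exact: (cvgB c2 c3).
    * move=> q [Uq qm]; have [d11 d12] := dP1 q Uq; have [d21 d22] := dP2 q Uq.
      have Eq : Phi q = Phi (q.1, q.2) by case: (q).
      split.
        apply: derivableCB; first exact: d21.
        apply: (@derivableC_comp R (fun z => (Phi (z, q.2)).1) h); first exact: d11.
        by rewrite -Eq; exact: dhm.
      apply: derivableCB; first exact: d22.
      apply: (@derivableC_comp R (fun w => (Phi (q.1, w)).1) h); first exact: d12.
      by rewrite -Eq; exact: dhm.
  + move=> q1 q2 [U1q _] [U2q _] [E1 E2]; apply: (injPhi _ _ U1q U2q).
    rewrite [Phi q1]surjective_pairing [Phi q2]surjective_pairing -E1; congr pair.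
    by move: E2; rewrite E1 => /addIr.
- split.
  + by rewrite W1E.
  + have [hPsi1 hPsi2] := hPsi.
    exists (fun v => Psi (v.1, v.2 + h v.1)); rewrite W1E; split.
      have HW v : W1 v -> W (v.1, v.2 + h v.1) /\ derivable h v.1 1.
        by move=> [vm Wv]; split=> //; exact: dhm.
      split; first exact: (holo2c_shear oW oW1 HW hPsi1).
      exact: (holo2c_shear oW oW1 HW hPsi2).
    move=> q [Uq _]; rewrite /Phi1 /= subrK -[RHS](PsiK q Uq).
    by case: (Phi q).
  + by rewrite /Phi1 Phip /= h0 subr0.
- by exists m; split; [exact: m0|split; [exact: sF1|move=> q []]].
(* The normalisation of [F1] at 0 consists of the cases of order 0 and 1 of its flatness. *)
- split; [exact: (fF1 0 0)|exact: fF1|exact: fF1].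
- move=> q [Uq _]; rewrite (HM q Uq) /Phi1 /F1 /= Re_mul2 raddfB /=.
  have -> : 2 * (complex.Re (Phi q).2 - complex.Re (h (Phi q).1 : R[i])) +
    (F (Phi q).1 + 2 * complex.Re (h (Phi q).1 : R[i])) = 2 * complex.Re (Phi q).2 + F (Phi q).1 by ring.
  by [].
Qed.

End Shear.

(** * Convergent series, and comparison of the two defining functions *)

Section Equivalences.
Variable R : realType.
Implicit Types (z w : CC R) (p q : CC R * CC R) (M U W : set (CC R * CC R))
  (F : CC R -> R) (Phi : CC R * CC R -> CC R * CC R).

Lemma taylor_hom0 F z : F 0 = 0 -> taylor_hom F 0 z = 0.
Proof. by move=> F0; rewrite /taylor_hom big_ord_recl big_ord0 /= /pxy /= F0 !mul0r addr0. Qed.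

Lemma taylor_hom1 F z : pxy F 1 0 0 = 0 -> pxy F 0 1 0 = 0 -> taylor_hom F 1 z = 0.
Proof.
move=> F10 F01; rewrite /taylor_hom !big_ord_recl big_ord0 /=.
by rewrite subn0 subnn F10 F01 !mul0r !addr0.
Qed.

Lemma convergent_of_flat F : flat_at0 F ->
  exists c, S_coefficients F c /\ positive_radius c.
Proof.
move=> fF; exists (fun=> 0); split.
  move=> j _ z; rewrite mul0r /= mulr0 /taylor_hom big1// => a _.
  by rewrite fF !mul0r.
exists 1; split; first exact: oner_neq0.
rewrite (_ : series _ = fun=> 0); first exact: is_cvg_cst.
apply/funext => n; rewrite /series /= big1// => j _.
by rewrite mul0r; case: ifP.
Qed.

Lemma cvg_series_bounded (u : nat -> CC R) : cvgn (series u) ->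
  exists2 C : R, 0 <= C & forall n, absC (u n) <= C.
Proof.
move=> /cvg_series_cvg_0 /(_ [set w : CC R | absC (w - 0) < 1]) H.
have [|N _ HN] := H; first by apply/nbhsCP; exists 1.
exists (1 + \sum_(i < N) absC (u i)).
  by rewrite addr_ge0// sumr_ge0// => i _; exact: absC_ge0.
move=> n; have [Nn|nN] := leqP N n.
  have := HN n Nn; rewrite /= subr0 => /ltW/le_trans; apply.
  by rewrite lerDl sumr_ge0// => i _; exact: absC_ge0.
rewrite (bigD1 (Ordinal nN)) //= addrCA lerDl addr_ge0// sumr_ge0// => i _.
exact: absC_ge0.
Qed.

(** With h = -S, F + 2 Re h is a Taylor remainder of F plus twice the real part of a tail of the
    power series; both are O(|z|^N). *)
Lemma flat_of_convergent M p Phi F c : good_coordinate M p Phi F ->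
  S_coefficients F c -> positive_radius c ->
  exists Phi1 F1, good_coordinate M p Phi1 F1 /\ flat_at0 F1.
Proof.
move=> gM Sc [z0 [z00 /cvg_series_bounded[C C0 HC]]].
have [U [_ _ [del [del0 [sF _]]] [F0 F10 F01] _]] := gM.
(* Degrees 0 and 1 are not constrained by [S_coefficients]; zero is the right value there because F
   and its gradient vanish at 0. *)
pose a j : CC R := if (2 <= j)%N then - c j else 0.
pose rho := absC z0; have rho0 : 0 < rho by rewrite absC_gt0.
(* Abel's argument: the terms of a series converging at [z0] are bounded. *)
have Ha j : absC (a j) <= C / rho ^+ j.
  rewrite ler_pdivlMr ?exprn_gt0// /rho -absCX -absCM.
  have := HC j; rewrite /a; case: ifP => _; last by rewrite mul0r.
  by rewrite mulNr absCN.
have ab : ps_bound a rho.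
  move=> t /andP[t0 tr]; exists C => // n; apply: le_trans (Ha n) _.
  apply: ler_wpM2l => //; rewrite lef_pV2 ?posrE ?exprn_gt0//.
  by apply: lerXn2r; rewrite ?nnegrE; exact: ltW.
apply: (@good_coordinate_shear R M p Phi F (psum a) rho gM rho0).
- by move=> z zr; apply/derivable_cderiv; exists (psum (dcoef a) z); exact: psum_cderiv zr.
- have h : absC (0 : CC R) < rho by rewrite absC0.
  have := psum_tail C0 h Ha 1; rewrite absC0 mul0r expr1 mulr0 big_ord_recl big_ord0.
  rewrite /a /= mul0r addr0 subr0 => h'; apply/eqP; rewrite -absC_eq0.
  by rewrite eq_le h' absC_ge0.
move=> N; have [K [eta [K0 eta0 HK]]] := taylor_bound N del0 sF.
exists (K + 2 * (2 * C * (rho / (rho - rho / 2))) / rho ^+ N), (Num.min eta (rho / 2)); split.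
  by rewrite lt_min eta0 divr_gt0.
move=> z; rewrite lt_min => /andP[z1 z2].
have r2 : rho / 2 < rho by lra.
have zr : absC z < rho by exact: lt_trans r2.
have := psum_tail C0 zr Ha N; set S := \sum_(n < N) a n * z ^+ n => T.
have TS : \sum_(j < N) taylor_hom F j z = - (2 * complex.Re (S : R[i])).
  rewrite /S raddf_sum /= mulr_sumr -sumrN; apply: eq_bigr => j _.
  rewrite /a; case: ifP => [j2|]; first by rewrite (Sc j j2 z) mulNr raddfN /= mulrN opprK.
  rewrite mul0r /= mulr0 oppr0; case: j => [[|[|j]] jN] //= _; first exact: taylor_hom0.
  exact: taylor_hom1.
have := HK z z1; rewrite TS opprK => {}T1.
have -> : F z + 2 * complex.Re (psum a z : R[i]) = (F z + 2 * complex.Re (S : R[i])) + 2 * complex.Re (psum a z - S : R[i]).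
  by rewrite raddfB /=; ring.
apply: le_trans (ler_normD _ _) _; rewrite [leRHS]mulrDl; apply: (lerD T1).
have -> : 2 * (2 * C * (rho / (rho - rho / 2))) / rho ^+ N * absC z ^+ N =
  2 * (2 * C * (rho / (rho - rho / 2)) * (absC z / rho) ^+ N).
  by rewrite exprMn exprVn; ring.
rewrite normrM ger0_norm//; apply: ler_wpM2l => //.
apply: le_trans (absC_Re _) _; apply: le_trans T _.
apply: ler_wpM2r; first by rewrite exprn_ge0// divr_ge0 ?absC_ge0// ltW.
apply: ler_wpM2l; first by rewrite mulr_ge0.
apply: ler_wpM2l; first exact: ltW.
by rewrite lef_pV2 ?posrE ?subr_gt0// lerD2l lerN2 ltW.
Qed.

Lemma holo2_lipschitz U Phi q : open U -> holo2_on U Phi -> U q ->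
  exists L d : R, [/\ 0 <= L, 0 < d & forall q1 q2 : CC R * CC R,
    absC (q1.1 - q.1) <= d -> absC (q1.2 - q.2) <= d ->
    absC (q2.1 - q.1) <= d -> absC (q2.2 - q.2) <= d ->
    absC ((Phi q1).1 - (Phi q2).1) <= L * (absC (q1.1 - q2.1) + absC (q1.2 - q2.2)) /\
    absC ((Phi q1).2 - (Phi q2).2) <= L * (absC (q1.1 - q2.1) + absC (q1.2 - q2.2))].
Proof.
move=> oU [h1 h2] Uq.
have [L1 [d1 [L10 d10 H1]]] := holo2c_lipschitz oU h1 Uq.
have [L2 [d2 [L20 d20 H2]]] := holo2c_lipschitz oU h2 Uq.
exists (L1 + L2), (Num.min d1 d2); split; [exact: addr_ge0|by rewrite lt_min d10|].
move=> q1 q2; rewrite !le_min => /andP[a1 a2] /andP[b1 b2] /andP[c1 c2] /andP[e1 e2].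
have s0 : 0 <= absC (q1.1 - q2.1) + absC (q1.2 - q2.2).
  by apply: addr_ge0; exact: absC_ge0.
split; [apply: le_trans (H1 _ _ a1 b1 c1 e1) _|apply: le_trans (H2 _ _ a2 b2 c2 e2) _].
  by apply: ler_wpM2r => //; rewrite lerDl.
by apply: ler_wpM2r => //; rewrite lerDr.
Qed.

Lemma cderiv_bound (f : CC R -> CC R) z l : is_cderiv f z l ->
  exists2 d : R, 0 < d & forall k, absC k < d -> absC (f (z + k) - f z) <= (absC l + 1) * absC k.
Proof.
move=> H; have [d d0 Hd] := H 1 ltr01; exists d => // k kd.
have := absCD (f (z + k) - f z - l * k) (l * k); rewrite subrK absCM.
by have := Hd k kd; lra.
Qed.

Lemma cder_subr_cst (f : CC R -> CC R) (c l : CC R) z : is_cderiv f z l ->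
  cder (fun t => f t - c) z = l.
Proof.
move=> H; suff /cderiv_is_derive[] : is_cderiv (fun t => f t - c) z l by [].
move=> e e0; have [d d0 Hd] := H e e0; exists d => // k kd.
have -> : f (z + k) - c - (f z - c) = f (z + k) - f z by ring.
exact: Hd.
Qed.

(** Moving q by O(|r q|) along a direction in which [r] has nonzero derivative at p reaches a zero
    [q'] of [r], a point of M. There 2 Re w + F vanishes, and its Lipschitz bound carries the
    estimate back to q. *)
Lemma coordinate_le_defining M p (r : CC R * CC R -> R) Phi F U (del : R) :
  M p -> local_defining_function M p r ->
  open U -> U p -> holo2_on U Phi -> Phi p = (0, 0) ->
  0 < del -> smooth1_on (fun z => absC z < del) F ->
  (forall q, U q -> (M q <-> 2 * complex.Re ((Phi q).2 : R[i]) + F (Phi q).1 = 0)) ->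
  exists C e : R, [/\ 0 <= C, 0 < e & forall q, absC (q.1 - p.1) < e -> absC (q.2 - p.2) < e ->
    U q /\ `|2 * complex.Re ((Phi q).2 : R[i]) + F (Phi q).1| <= C * `|r q|].
Proof.
move=> Mp [V [oV Vp sr HV Hd]] oU Up hPhi Phip del0 sF HM.
have [d rd] := Hd p Vp; have rp0 : r p = 0 by exact/(HV p Vp).
have [eU eU0 HU] := open_box oU Up; have [eV eV0 HVb] := open_box oV Vp.
have [LP [dP [LP0 dP0 HP]]] := holo2_lipschitz oU hPhi Up.
have [LF [eF [LF0 eF0 HF]]] := smooth1_lipschitz del0 sF.
pose D := absC d.1 + absC d.2 + 1.
have D0 : 0 < D by rewrite ltr_wpDl// addr_ge0// absC_ge0.
have d1D : absC d.1 <= D by rewrite /D; have := absC_ge0 d.2; lra.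
have d2D : absC d.2 <= D by rewrite /D; have := absC_ge0 d.1; lra.
have dD : absC d.1 + absC d.2 <= D by rewrite /D lerDl.
clearbody D.
have LP1 : 0 < 2 * (LP + 1) by rewrite mulr_gt0// ltr_wpDl.
(* The last condition keeps the first component of [Phi] inside the disc on which F is Lipschitz. *)
have [e2 [e20 e2U e2V e2P e2F]] : exists e2 : R, [/\ 0 < e2, e2 <= eU, e2 <= eV, e2 <= dP & LP * (e2 + e2) <= eF].
  exists (Num.min (Num.min eU eV) (Num.min dP (eF / (2 * (LP + 1))))); split.
  - by rewrite !lt_min eU0 eV0 dP0 divr_gt0.
  - by rewrite !ge_min lexx.
  - by rewrite !ge_min lexx !orbT.
  - by rewrite !ge_min lexx !orbT.
  - set m := Num.min _ _.
    have m0 : 0 <= m by rewrite !le_min !ltW// divr_gt0.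
    have : m <= eF / (2 * (LP + 1)) by rewrite !ge_min lexx !orbT.
    by rewrite ler_pdivlMr//; lra.
have [C0 [e3 [C00 e30 H3]]] := smooth2_zero_near oV sr Vp rp0 rd (divr_gt0 e20 (mulr_gt0 (ltr0Sn _ 1) D0)).
(* The displacement is at most [D * C0] times |r q|; [Phi] costs [LP], the term 2 Re w costs 2 and F
   costs [LF]. *)
exists ((2 + LF) * LP * D * C0), (Num.min (e2 / 2) e3); split.
- by rewrite !mulr_ge0 ?addr_ge0// ltW.
- by rewrite lt_min divr_gt0.
move=> q; rewrite !lt_min => /andP[a1 a2] /andP[b1 b2].
have [t [tr te rt]] := H3 q a2 b2.
set q' := (q.1 + reC t * d.1, q.2 + reC t * d.2) in rt.
have td (c : CC R) : absC c <= D -> absC (reC t * c) < e2 / 2.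
  move=> cD; rewrite absCM absC_reC.
  apply: le_lt_trans (_ : `|t| * D < _); first by rewrite ler_wpM2l.
  by rewrite -ltr_pdivlMr// -mulrA -invfM.
have c1 : absC (q'.1 - p.1) < e2.
  rewrite /q' /= addrAC; apply: le_lt_trans (absCD _ _) _.
  by rewrite (splitr e2) ltrD// td.
have c2 : absC (q'.2 - p.2) < e2.
  rewrite /q' /= addrAC; apply: le_lt_trans (absCD _ _) _.
  by rewrite (splitr e2) ltrD// td.
have half : e2 / 2 <= e2 by rewrite ler_pdivrMr// ler_peMr ?ler1n// ltW.
have {}a1 : absC (q.1 - p.1) < e2 by exact: lt_le_trans a1 half.
have {}b1 : absC (q.2 - p.2) < e2 by exact: lt_le_trans b1 half.
have Uq := HU q (lt_le_trans a1 e2U) (lt_le_trans b1 e2U).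
have Uq' := HU q' (lt_le_trans c1 e2U) (lt_le_trans c2 e2U).
have Vq' := HVb q' (lt_le_trans c1 e2V) (lt_le_trans c2 e2V).
split; first exact: Uq.
have Mq' : M q' by exact/(HV q' Vq').
move/(HM q' Uq'): Mq' => E.
have inP x : x < e2 -> x <= dP by move=> h; rewrite ltW// (lt_le_trans h).
have pP : absC (p.1 - p.1) <= dP /\ absC (p.2 - p.2) <= dP by rewrite !subrr absC0 ltW.
have [P1 P2] := HP q q' (inP _ a1) (inP _ b1) (inP _ c1) (inP _ c2).
have [P3 _] := HP q p (inP _ a1) (inP _ b1) pP.1 pP.2.
have [P4 _] := HP q' p (inP _ c1) (inP _ c2) pP.1 pP.2.
rewrite Phip /= !subr0 in P3.
rewrite Phip /= !subr0 in P4.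
have F3 : absC (Phi q).1 <= eF.
  by apply: le_trans P3 _; apply: (le_trans _ e2F); apply: ler_wpM2l => //; apply: lerD; exact: ltW.
have F4 : absC (Phi q').1 <= eF.
  by apply: le_trans P4 _; apply: (le_trans _ e2F); apply: ler_wpM2l => //; apply: lerD; exact: ltW.
have := HF _ _ F3 F4.
have Q : LP * (absC (q.1 - q'.1) + absC (q.2 - q'.2)) <= LP * (D * (C0 * `|r q|)).
  apply: ler_wpM2l => //; rewrite /q' /= !opprD !addrA !subrr !add0r !absCN !absCM absC_reC.
  rewrite -mulrDr mulrC; apply: ler_pM => //.
  by apply: addr_ge0; exact: absC_ge0.
have Q1 := le_trans P1 Q; have Q2 := le_trans P2 Q => FF.
have -> : 2 * complex.Re ((Phi q).2 : R[i]) + F (Phi q).1 =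
  2 * complex.Re ((Phi q).2 - (Phi q').2 : R[i]) + (F (Phi q).1 - F (Phi q').1).
  by rewrite raddfB /= -[LHS]subr0 -E; ring.
apply: le_trans (ler_normD _ _) _; rewrite normrM ger0_norm//.
have R2 := le_trans (absC_Re ((Phi q).2 - (Phi q').2)) Q2.
have FQ : LF * absC ((Phi q).1 - (Phi q').1) <= LF * (LP * (D * (C0 * `|r q|))).
  by apply: ler_wpM2l.
have -> : (2 + LF) * LP * D * C0 * `|r q| = 2 * (LP * (D * (C0 * `|r q|))) + LF * (LP * (D * (C0 * `|r q|))) by ring.
by apply: lerD; [apply: ler_wpM2l|exact: le_trans FF FQ].
Qed.

End Equivalences.

(** * From flat coordinates to tangent curves and back *)

Section Curves.
Variable R : realType.
Implicit Types (z w : CC R) (p q : CC R * CC R) (M U W : set (CC R * CC R))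
  (F : CC R -> R) (Phi : CC R * CC R -> CC R * CC R) (r : CC R * CC R -> R)
  (gamma : CC R -> CC R * CC R).

(** The curve is w = 0. Above the same z, the point with w = -F(z)/2 lies on M, so [r] vanishes
    there and the Lipschitz bounds of [r] and [Psi] give r(gamma t) = O(|F t|). *)
Lemma curve_of_flat M p r Phi F : M p -> local_defining_function M p r ->
  good_coordinate M p Phi F -> flat_at0 F ->
  exists gamma, in_Gamma_reg p gamma /\ tangent_infinite_order r gamma.
Proof.
move=> Mp [V [oV Vp sr HV _]].
move=> [U [[oU Up hPhi _] [oW [Psi [hPsi PsiK]] Phip] [del [del0 [sF _]]] _ HM]] fF.
set W := Phi @` U in oW hPsi.
have W0 : W (0, 0) by exists p.
have PhiK v : W v -> U (Psi v) /\ Phi (Psi v) = v.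
  by move=> [q Uq <-]; rewrite PsiK.
have Psi0 : Psi (0, 0) = p by rewrite -Phip PsiK.
have [rho rho0 Hrho] := open_box oW W0.
have {}Hrho z w : absC z < rho -> absC w < rho -> W (z, w).
  by move=> h1 h2; apply: Hrho; rewrite /= subr0.
have a0 : absC (0 : CC R) < rho by rewrite absC0.
pose gamma z := Psi (z, 0).
have [[_ dPsi1] [_ dPsi2]] := hPsi.
have dg1 z : absC z < rho -> derivable (fun z => (gamma z).1) z 1.
  by move=> zr; exact: (dPsi1 (z, 0) (Hrho _ _ zr a0)).1.
have dg2 z : absC z < rho -> derivable (fun z => (gamma z).2) z 1.
  by move=> zr; exact: (dPsi2 (z, 0) (Hrho _ _ zr a0)).1.
have [l1 Hl1] := (derivable_cderiv _ _).1 (dg1 0 a0).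
have [l2 Hl2] := (derivable_cderiv _ _).1 (dg2 0 a0).
have [LP [dP [LP0 dP0 HP]]] := holo2_lipschitz oU hPhi Up.
have [LQ [dQ [LQ0 dQ0 HQ]]] := holo2_lipschitz oW hPsi W0.
exists gamma; split; first split.
- split.
  + by exists rho; split; [exact: rho0|split; [exact: dg1|exact: dg2]].
  + exact: Psi0.
  + move=> /nbhsCP[d d0 Hd].
    pose x := Num.min (d / 2) (rho / 2).
    have x0 : 0 < x by rewrite lt_min !divr_gt0.
    have xd : x < d by apply: (@le_lt_trans _ _ (d / 2)); [rewrite ge_min lexx|lra].
    have xr : x < rho by apply: (@le_lt_trans _ _ (rho / 2)); [rewrite ge_min lexx orbT|lra].
    have xE : absC (reC x) = x by rewrite absC_reC gtr0_norm.
    have := Hd (reC x); rewrite subr0 xE => /(_ xd); rewrite /gamma => E.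
    have xr' : absC (reC x) < rho by rewrite xE.
    have [_ K] := PhiK _ (Hrho _ _ xr' a0); rewrite E Phip in K.
    by have [K1] := congr1 fst K; move: x0; rewrite K1 ltxx.
- split.
    by case=> [|//] _; rewrite /= /gamma Psi0 !subrr.
  rewrite /= (cder_subr_cst p.1 Hl1) (cder_subr_cst p.2 Hl2).
  (* If both derivatives vanished, gamma would be o(t), and the Lipschitz map [Phi] would send it to
     an o(t) curve; but [Phi] of gamma is (t, 0). The constant 4 (LP + 1) leaves at most half of
     |t|. *)
  apply/orP; rewrite -negb_and; apply/negP => /andP[/eqP l10 /eqP l20].
  have LP1 : 0 < 4 * (LP + 1) by rewrite mulr_gt0// ltr_wpDl.
  pose e := Num.min 1 (4 * (LP + 1))^-1.
  have e0 : 0 < e by rewrite lt_min ltr01 invr_gt0.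
  have e1 : e <= 1 by rewrite ge_min lexx.
  have eLP : e * (4 * (LP + 1)) <= 1 by rewrite -ler_pdivlMr// mul1r ge_min lexx orbT.
  clearbody e.
  have [d1 d10 H1] := Hl1 e e0; have [d2 d20 H2] := Hl2 e e0.
  have [|x x0 /= /and5P[x1 x2 x3 x4 _]] := @exists_small R [:: d1; d2; dP; rho].
    by rewrite /= d10 d20 dP0 rho0.
  have xE : absC (reC x) = x by rewrite absC_reC gtr0_norm.
  have := H1 (reC x); have := H2 (reC x); rewrite xE add0r l10 l20 !mul0r !subr0.
  rewrite /gamma Psi0 => /(_ x2) G2 /(_ x1) G1.
  have xr' : absC (reC x) < rho by rewrite xE.
  have [_ K] := PhiK _ (Hrho _ _ xr' a0).
  have ex : e * x <= x by rewrite ler_piMl// ltW.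
  have pP : absC (p.1 - p.1) <= dP /\ absC (p.2 - p.2) <= dP by rewrite !subrr absC0 ltW.
  have [||P _] := HP (Psi (reC x, 0)) p _ _ pP.1 pP.2.
  - exact: le_trans G1 (le_trans ex (ltW x3)).
  - exact: le_trans G2 (le_trans ex (ltW x3)).
  rewrite K Phip /= subr0 xE in P.
  have : LP * (absC ((Psi (reC x, 0)).1 - p.1) + absC ((Psi (reC x, 0)).2 - p.2)) <= LP * (e * x + e * x).
    by apply: ler_wpM2l => //; exact: lerD.
  have : e * (4 * (LP + 1)) * x <= 1 * x by rewrite ler_wpM2r// ltW.
  have : 0 < e * x by rewrite mulr_gt0.
  by move: P x0; move: (LP * (_ + _)) => X; clear; lra.
move=> N.
have [K [eta [K0 eta0 HK]]] := small_of_flat del0 sF fF N.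
(* The bound of order 1 keeps the point (t, -F(t)/2) in the box even when [N] is 0. *)
have [K1 [eta1 [K10 eta10 HK1]]] := small_of_flat del0 sF fF 1.
have [Lr [er [Lr0 er0 Hr]]] := smooth2_lipschitz oV sr Vp.
have [eV eV0 HVb] := open_box oV Vp.
pose m := Num.min (Num.min rho dQ) (Num.min er eV / (LQ + 1)).
have LQ1 : 0 < LQ + 1 by rewrite ltr_wpDl.
have m0 : 0 < m by rewrite !lt_min rho0 dQ0 divr_gt0// lt_min er0.
have mrho : m <= rho by rewrite !ge_min lexx.
have mdQ : m <= dQ by rewrite !ge_min lexx orbT.
have me : LQ * m < er /\ LQ * m < eV.
  have : m <= Num.min er eV / (LQ + 1) by rewrite !ge_min lexx !orbT.
  rewrite ler_pdivlMr// => h.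
  have h1 : Num.min er eV <= er by rewrite ge_min lexx.
  have h2 : Num.min er eV <= eV by rewrite ge_min lexx orbT.
  by move: h h1 h2 m0; clear; split; lra.
clearbody m.
have K11 : 0 < 1 + K1 by rewrite ltr_wpDr.
exists (Lr * (LQ * K)), (Num.min (Num.min eta eta1) (m / (1 + K1))); split.
  by rewrite !lt_min eta0 eta10 divr_gt0.
move=> t; rewrite !lt_min ltr_pdivlMr// => /andP[/andP[t1 t2] t3].
have {}HK := HK t t1; have {}HK1 := HK1 t t2; rewrite expr1 in HK1.
have tpos := absC_ge0 t.
pose s : CC R := reC (- (F t / 2)).
have sE : absC s = `|F t| / 2 by rewrite absC_reC normrN normrM normfV (ger0_norm (ler0n R 2)).
have F0 := normr_ge0 (F t).
have ts : absC t + absC s < m by rewrite sE; move: t3 HK1 F0; clear; lra.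
have spos := absC_ge0 s.
have tm : absC t < m by apply: le_lt_trans ts; rewrite lerDl.
have sm : absC s < m by apply: le_lt_trans ts; rewrite lerDr.
have Wts := Hrho t s (lt_le_trans tm mrho) (lt_le_trans sm mrho).
have [Us Ks] := PhiK _ Wts.
have z0 : absC (0 - 0 : CC R) <= dQ by rewrite subr0 absC0 ltW.
have inQ v : absC v < m -> absC (v - 0) <= dQ by rewrite subr0 => h; rewrite ltW// (lt_le_trans h).
have [A1 A2] := HQ (t, 0) (0, 0) (inQ _ tm) z0 z0 z0.
have [B1 B2] := HQ (t, s) (0, 0) (inQ _ tm) (inQ _ sm) z0 z0.
have [C1 C2] := HQ (t, 0) (t, s) (inQ _ tm) z0 (inQ _ tm) (inQ _ sm).
rewrite /= Psi0 !subr0 absC0 addr0 in A1 A2.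
rewrite /= Psi0 !subr0 in B1 B2.
rewrite /= subrr absC0 add0r sub0r absCN in C1 C2.
have Lt : LQ * absC t <= LQ * m by rewrite ler_wpM2l// ltW.
have Lts : LQ * (absC t + absC s) <= LQ * m by rewrite ler_wpM2l// ltW.
have [me1 me2] := me.
have {}A1 := le_trans A1 Lt; have {}A2 := le_trans A2 Lt.
have {}B1 := le_trans B1 Lts; have {}B2 := le_trans B2 Lts.
have Ms : M (Psi (t, s)).
  apply/(HM _ Us); rewrite Ks /=; by field.
have rs : r (Psi (t, s)) = 0.
  by apply/HV => //; apply: HVb; [exact: le_lt_trans B1 me2|exact: le_lt_trans B2 me2].
have le_er x : x <= LQ * m -> x <= er by move=> h; rewrite ltW// (le_lt_trans h).
have := Hr (Psi (t, 0)) (Psi (t, s)) (le_er _ A1) (le_er _ A2) (le_er _ B1) (le_er _ B2).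
rewrite rs subr0 => /le_trans; apply.
rewrite -mulrA; apply: ler_wpM2l => //.
apply: le_trans (lerD C1 C2) _; rewrite sE -mulrA.
by move: (ler_wpM2l LQ0 HK); clear; lra.
Qed.

(** With (alpha, beta) the coordinate expression of gamma, [lb0] and [la0] show beta'(0) = 0 and
    then alpha'(0) != 0, so h is beta composed with the local inverse [kappa] of alpha. *)
Lemma flat_of_curve M p r Phi F gamma : M p -> local_defining_function M p r ->
  good_coordinate M p Phi F -> in_Gamma_reg p gamma -> tangent_infinite_order r gamma ->
  exists Phi1 F1, good_coordinate M p Phi1 F1 /\ flat_at0 F1.
Proof.
move=> Mp Hr gM [[[dg [dg0 [dg1 dg2]]] gp _] [_ ord1]] Htan.
have [U [[oU Up hPhi _] [oW [Psi [hPsi PsiK]] Phip] [del [del0 [sF _]]] [F0 F10 F01] HM]] := gM.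
have [C [e [C0 e0 HC]]] := coordinate_le_defining Mp Hr oU Up hPhi Phip del0 sF HM.
have g0 : absC (0 : CC R) < dg by rewrite absC0.
have [l1 Hl1] := (derivable_cderiv _ _).1 (dg1 0 g0).
have [l2 Hl2] := (derivable_cderiv _ _).1 (dg2 0 g0).
rewrite /= (cder_subr_cst p.1 Hl1) (cder_subr_cst p.2 Hl2) in ord1.
have [b1 b10 Hb1] := cderiv_bound Hl1; have [b2 b20 Hb2] := cderiv_bound Hl2.
pose G := absC l1 + absC l2 + 1.
have l1p := absC_ge0 l1; have l2p := absC_ge0 l2.
have G0 : 0 < G by rewrite /G; lra.
pose rho := Num.min (Num.min dg (e / G)) (Num.min b1 b2).
have rho0 : 0 < rho by rewrite !lt_min dg0 b10 b20 divr_gt0.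
have rdg : rho <= dg by rewrite !ge_min lexx.
have reG : rho * G <= e by rewrite -ler_pdivlMr// !ge_min lexx orbT.
have rb1 : rho <= b1 by rewrite !ge_min lexx !orbT.
have rb2 : rho <= b2 by rewrite !ge_min lexx !orbT.
clearbody rho.
have gbox t : absC t < rho -> absC ((gamma t).1 - p.1) < e /\ absC ((gamma t).2 - p.2) < e.
  move=> tr; have := Hb1 t (lt_le_trans tr rb1); have := Hb2 t (lt_le_trans tr rb2).
  rewrite !add0r gp => h2 h1; have t0 := absC_ge0 t.
  have tG : absC t * G < e by apply: lt_le_trans reG; rewrite ltr_pM2r.
  have p1 := mulr_ge0 l1p t0; have p2 := mulr_ge0 l2p t0.
  by rewrite /G in tG; move: h1 h2 tG p1 p2 t0; clear; split; lra.
have Ug t : absC t < rho -> U ((gamma t).1, (gamma t).2).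
  by move=> tr; have [h1 h2] := gbox t tr; have [] := HC ((gamma t).1, (gamma t).2) h1 h2.
have [hP1 hP2] := hPhi.
pose alpha t := (Phi ((gamma t).1, (gamma t).2)).1.
pose beta t := (Phi ((gamma t).1, (gamma t).2)).2.
have da t : absC t < rho -> derivable alpha t 1.
  move=> tr; have h := lt_le_trans tr rdg.
  exact: (holo2c_comp oU hP1 (Ug t tr) (dg1 t h) (dg2 t h)).
have db t : absC t < rho -> derivable beta t 1.
  move=> tr; have h := lt_le_trans tr rdg.
  exact: (holo2c_comp oU hP2 (Ug t tr) (dg1 t h) (dg2 t h)).
have r0 : absC (0 : CC R) < rho by rewrite absC0.
have alpha0 : alpha 0 = 0 by rewrite /alpha gp -surjective_pairing Phip.
have beta0 : beta 0 = 0 by rewrite /beta gp -surjective_pairing Phip.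
have [la Hla] := (derivable_cderiv _ _).1 (da 0 r0).
have [lb Hlb] := (derivable_cderiv _ _).1 (db 0 r0).
have small N : exists K d : R, [/\ 0 <= K, 0 < d & forall t, absC t < d ->
    `|2 * complex.Re (beta t : R[i]) + F (alpha t)| <= K * absC t ^+ N].
  have [c [d [d0 Hd]]] := Htan N.
  exists (C * `|c|), (Num.min d rho); split; [by rewrite mulr_ge0|by rewrite lt_min d0|].
  move=> t; rewrite lt_min => /andP[td tr].
  have [h1 h2] := gbox t tr; have [_] := HC ((gamma t).1, (gamma t).2) h1 h2.
  rewrite -/(alpha t) -/(beta t) => /le_trans; apply.
  rewrite -mulrA; apply: ler_wpM2l => //; rewrite -surjective_pairing.
  apply: le_trans (Hd t td) _; rewrite ler_wpM2r ?exprn_ge0 ?absC_ge0//.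
  exact: ler_norm.
have lb0 : lb = 0.
  apply/eqP/negPn/negP => lbn; have L0 : 0 < absC lb by rewrite absC_gt0.
  have [K2 [d2 [K20 d20 H2]]] := small 2.
  have [KF [eta [KF0 eta0 HF]]] := taylor_bound 2 del0 sF.
  have [d3 d30 H3] := cderiv_bound Hla.
  have [d4 d40 H4] := Hlb (absC lb / 4) (divr_gt0 L0 (ltr0Sn _ _)).
  pose A := absC la + 1; have A0 : 0 < A by rewrite ltr_wpDl// absC_ge0.
  pose B := K2 + KF * A ^+ 2.
  have B0 : 0 <= B by rewrite addr_ge0// mulr_ge0// sqr_ge0.
  have B1 : 0 < B + 1 by rewrite ltr_wpDl.
  (* [eta / A] keeps alpha where the Taylor bound of F holds. The last threshold gives
     [B * x <= absC lb], so |2 Re beta| <= |lb| x, whereas the linear part forces 2 Re beta >= (3/2)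
     |lb| x. *)
  have [|x x0 /= /and5P[x2 x3 x4 x5 /andP[x6 _]]] :=
      @exists_small R [:: d2; d3; d4; eta / A; absC lb / (B + 1)].
    by rewrite /= d20 d30 d40 !divr_gt0.
  rewrite ltr_pdivlMr// in x5; rewrite ltr_pdivlMr// in x6.
  have {}x6 : B * x <= absC lb by rewrite mulrDr mulr1 mulrC in x6; move: x6 x0; clear; lra.
  (* The point of modulus [x] in the direction of the conjugate of [lb], where [lb * t] is real and
     equal to [x * absC lb]. *)
  pose t : CC R := reC (x / absC lb) * Complex (complex.Re (lb : R[i])) (- complex.Im (lb : R[i])).
  have sq : complex.Re (lb : R[i]) ^+ 2 + complex.Im (lb : R[i]) ^+ 2 = absC lb ^+ 2.
    by rewrite sqr_sqrtr// addr_ge0// sqr_ge0.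
  have tE : absC t = x.
    rewrite absCM absC_reC normf_div !gtr0_norm//.
    rewrite {2}/absC /= sqrrN -/(absC lb) divfK//; exact: lt0r_neq0.
  have ltE : complex.Re (lb * t : R[i]) = x * absC lb.
    have -> : x * absC lb = x / absC lb * absC lb ^+ 2 by field; exact: lt0r_neq0.
    by rewrite -sq /t; case: (lb) => u v /=; ring.
  have := H2 t; have := H3 t; have := H4 t; rewrite !add0r tE alpha0 beta0 !subr0.
  move=> /(_ x4) h4 /(_ x3) h3 /(_ x2) h2.
  have aeta : absC (alpha t) < eta by apply: le_lt_trans h3 _; rewrite -/A mulrC.
  have := HF _ aeta.
  rewrite !big_ord_recl big_ord0 taylor_hom0// taylor_hom1// !addr0 subr0 => h5.
  have h6 : KF * absC (alpha t) ^+ 2 <= KF * (A * x) ^+ 2.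
    apply: ler_wpM2l => //; apply: lerXn2r; rewrite ?nnegrE ?absC_ge0//.
    by rewrite mulr_ge0// ltW.
  have h7 : `|2 * complex.Re (beta t : R[i])| <= B * x ^+ 2.
    have := ler_normB (2 * complex.Re (beta t : R[i]) + F (alpha t)) (F (alpha t)).
    rewrite addrK => /le_trans; apply; rewrite /B [leRHS]mulrDl.
    apply: (lerD h2); apply: le_trans h5 (le_trans h6 _).
    by rewrite exprMn mulrA.
  have h8 : `|complex.Re (beta t - lb * t : R[i])| <= absC lb / 4 * x.
    exact: le_trans (absC_Re _) h4.
  have Bx : B * x ^+ 2 <= absC lb * x by rewrite expr2 mulrA ler_wpM2r// ltW.
  have xl : 0 < absC lb * x by rewrite mulr_gt0.
  move: h7 h8 ltE; rewrite raddfB /=.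
  move: (complex.Re (lb * t : R[i])) (complex.Re (beta t : R[i])) => X Y.
  move=> /ler_normlP[k1 k2] /ler_normlP[k3 k4].
  by move: k1 k2 k3 k4 Bx xl; clear; lra.
have la0 : la != 0.
  apply/negP => /eqP la0.
  have W0 : (Phi @` U) (0, 0) by exists p.
  have [LQ [dQ [LQ0 dQ0 HQ]]] := holo2_lipschitz oW hPsi W0.
  have PsiG t : absC t < rho -> Psi (alpha t, beta t) = gamma t.
    by move=> tr; rewrite /alpha /beta -surjective_pairing (PsiK _ (Ug t tr)) -surjective_pairing.
  have z0 : absC (0 - 0 : CC R) <= dQ by rewrite subr0 absC0 ltW.
  (* When alpha and beta are both o(t), so is gamma up to its base point, since [Psi] is Lipschitz;
     hence both components of its derivative are arbitrarily small. *)
  have key c : 0 < c -> absC l1 <= 2 * c /\ absC l2 <= 2 * c.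
    move=> c0; have Q1 : 0 < 2 * LQ + 1 by rewrite ltr_wpDl// mulr_ge0.
    have c'0 : 0 < Num.min 1 (c / (2 * LQ + 1)) by rewrite lt_min ltr01 divr_gt0.
    have [d1 d10 H1] := Hla _ c'0; have [d2 d20 H2] := Hlb _ c'0.
    have [d3 d30 H3] := Hl1 c c0; have [d4 d40 H4] := Hl2 c c0.
    have c'1 : Num.min 1 (c / (2 * LQ + 1)) <= 1 by rewrite ge_min lexx.
    have c'c : Num.min 1 (c / (2 * LQ + 1)) * (2 * LQ + 1) <= c.
      by rewrite -ler_pdivlMr// ge_min lexx orbT.
    move: (Num.min 1 _) c'0 H1 H2 c'1 c'c => c' c'0 H1 H2 c'1 c'c.
    have [|x x0 /= /and5P[x1 x2 x3 x4 /and3P[x5 x6 _]]] :=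
        @exists_small R [:: d1; d2; d3; d4; dQ; rho].
      by rewrite /= d10 d20 d30 d40 dQ0 rho0.
    have xE : absC (reC x) = x by rewrite absC_reC gtr0_norm.
    have xr : absC (reC x) < rho by rewrite xE.
    have := H1 (reC x); have := H2 (reC x); have := H3 (reC x); have := H4 (reC x).
    rewrite xE !add0r alpha0 beta0 la0 lb0 !mul0r !subr0.
    move=> /(_ x4) h4 /(_ x3) h3 /(_ x2) h2 /(_ x1) h1.
    have cx : c' * x <= x by rewrite ler_piMl// ltW.
    have xdQ : c' * x <= dQ by rewrite (le_trans cx)// ltW.
    have i1 : absC (alpha (reC x) - 0) <= dQ by rewrite subr0 (le_trans h1).
    have i2 : absC (beta (reC x) - 0) <= dQ by rewrite subr0 (le_trans h2).
    have := HQ (alpha (reC x), beta (reC x)) (0, 0) i1 i2 z0 z0.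
    rewrite (PsiG _ xr) -Phip (PsiK _ Up) Phip /= !subr0 => -[q1 q2].
    have hh : LQ * (absC (alpha (reC x)) + absC (beta (reC x))) <= LQ * (c' * x + c' * x).
      by apply: ler_wpM2l => //; exact: lerD.
    have cc : c' * (2 * LQ + 1) * x <= c * x by rewrite ler_wpM2r// ltW.
    have c'x : 0 < c' * x by rewrite mulr_gt0.
    have fin (l : CC R) (y : CC R) : absC y <= LQ * (c' * x + c' * x) ->
        absC (y - l * reC x) <= c * x -> absC l <= 2 * c.
      move=> y1 y2; rewrite -(ler_pM2r x0) -[X in _ * X <= _]xE -absCM.
      have := absC_triangle y (l * reC x) 0; rewrite !subr0 (absCBC _ y).
      move: (absC y) (absC (y - _)) (absC (l * _)) y1 y2 => Y1 Y2 Y3 y1 y2 h.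
      by move: y1 y2 cc c'x h; clear; lra.
    rewrite gp in h3 h4.
    split; [apply: fin h3; exact: le_trans q1 hh|apply: fin h4; exact: le_trans q2 hh].
  have z (l : CC R) : (forall c, 0 < c -> absC l <= 2 * c) -> l = 0.
    move=> H; apply/eqP; rewrite -absC_eq0 -normr_le0 ger0_norm ?absC_ge0//.
    apply/ler_addgt0Pr => c c0; rewrite add0r.
    by move: (H (c / 2) (divr_gt0 c0 (ltr0Sn _ 1))); clear; lra.
  have e1 : l1 = 0 by apply: z => c /key[].
  have e2 : l2 = 0 by apply: z => c /key[].
  by move: ord1; rewrite e1 e2 eqxx => -[].
have [d [K [kappa [d0 [K0 Hk]]]]] := local_inverse rho0 da Hla alpha0 la0.
have dd0 : absC (0 : CC R) < d by rewrite absC0.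
have kappa0 : kappa 0 = 0.
  have [_ _ _] := Hk 0 dd0; rewrite absC0 mulr0 => h; apply/eqP; rewrite -absC_eq0.
  by rewrite eq_le h absC_ge0.
apply: (@good_coordinate_shear R M p Phi F (fun z => beta (kappa z)) d gM d0).
- move=> z zd; have [dk _ kr _] := Hk z zd.
  by apply: (derivableC_comp dk); exact: db.
- by rewrite kappa0.
(* At z = alpha(kappa z), the required quantity is the bounded one at the parameter [kappa z], and
   |kappa z| <= K |z| preserves the order. *)
move=> N; have [K' [d' [K'0 d'0 H']]] := small N.
have K1 : 0 < K + 1 by rewrite ltr_wpDl.
exists (K' * K ^+ N), (Num.min d (d' / (K + 1))); split; first by rewrite lt_min d0 divr_gt0.
move=> z; rewrite lt_min ltr_pdivlMr// => /andP[zd zd'].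
have [_ ak _ kK] := Hk z zd; have z0 := absC_ge0 z.
have kd : absC (kappa z) < d' by apply: le_lt_trans kK _; move: zd' z0; clear; lra.
have := H' _ kd; rewrite ak addrC => /le_trans; apply.
rewrite -mulrA -exprMn; apply: ler_wpM2l => //.
by apply: lerXn2r; rewrite ?nnegrE ?mulr_ge0// absC_ge0.
Qed.

End Curves.

Theorem theorem5p5 (R : realType) (M : set (CC R * CC R)) (p : CC R * CC R)
    (r : CC R * CC R -> R) :
  smooth_real_hypersurface M -> M p ->
  local_defining_function M p r ->
  (exists Phi F, good_coordinate M p Phi F) ->
  Delta1_infinite p r ->
  ((exists gamma, in_Gamma_reg p gamma /\ tangent_infinite_order r gamma) <->
   (exists Phi F, good_coordinate M p Phi F /\ flat_at0 F)) /\
  ((exists Phi F, good_coordinate M p Phi F /\ flat_at0 F) <->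
   (exists Phi F c, [/\ good_coordinate M p Phi F, S_coefficients F c &
                       positive_radius c])).
Proof.
move=> _ Mp rM [Phi0 [F0 g0]] _; split; split.
- by move=> [gamma [reg tang]]; exact: flat_of_curve Mp rM g0 reg tang.
- by move=> [Phi [F [gF fF]]]; exact: curve_of_flat Mp rM gF fF.
- move=> [Phi [F [gF fF]]]; have [c [Sc pc]] := convergent_of_flat fF.
  by exists Phi, F, c.
- by move=> [Phi [F [c [gF Sc pc]]]]; exact: flat_of_convergent gF Sc pc.
Qed.
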